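(* Let $n$ be a positive integer and let $\mathcal{L}\subset\mathbf{S}^2_n$ be a set of $n$ distinct points, with associated force field $F$, integral curves $Y_x$ and flow durations $\tau_x$. Then $$\frac1n\int_{\mathbf{S}^2_n}\int_0^{\tau_x}|F(Y_x(t))|\,dt\,d\lambda_n(x)=\frac1{2\pi n}\int_{\mathbf{S}^2_n}|F(x)|\,d\lambda_n(x).$$
   Context: For a positive integer $n$, $\mathbf{S}^2_n\subset\mathbf{R}^3$ is the sphere centered at the origin with surface area $n$ (radius $\sqrt{n/(4\pi)}$), and $\lambda_n$ denotes surface area measure on it. $|\cdot|$ is the Euclidean norm in $\mathbf{R}^3$ (and the induced norm on tangent vectors). Given $\mathcal{L}$, let $U(x)=\sum_{z\in\mathcal{L}}\log|x-z|$ on $\mathbf{S}^2_n$ and let $F(x)$ be the negative gradient of $U$ at $x\in\mathbf{S}^2_n\setminus\mathcal{L}$ with respect to the Riemannian metric induced from $\mathbf{R}^3$. For $x\in\mathbf{S}^2_n\setminus\mathcal{L}$, $Y_x$ is the integral curve $\frac{dY_x}{dt}(t)=F(Y_x(t))$, $Y_x(0)=x$, on its maximal interval of definition $(-\infty,\tau_x)$, $0<\tau_x\le\infty$. *)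

(* Defs.v *)
From HB Require Import structures.
From mathcomp Require Import all_boot all_order all_algebra.
From mathcomp Require Import all_classical all_reals all_analysis.
From mathcomp Require Import measurable_realfun.

Set Implicit Arguments.
Unset Strict Implicit.
Unset Printing Implicit Defensive.

Import Order.TTheory GRing.Theory Num.Theory.
Import numFieldNormedType.Exports.

Local Open Scope classical_set_scope.
Local Open Scope ring_scope.

(* R^3 is the product R * R * R, which carries the product (Borel) sigma-algebra
   and the product topology. Its library norm `|x| is the sup norm, so the
   Euclidean norm is enorm below. *)
Notation R3 R := ((R * R * R)%type).

Section euclidean_sphere.
Context {R : realType}.
Implicit Types (n : nat) (x u v : R3 R).

Definition dot u v : R := u.1.1 * v.1.1 + u.1.2 * v.1.2 + u.2 * v.2.

Definition enorm u : R := Num.sqrt (dot u u).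

Definition sphere_radius n : R := Num.sqrt (n%:R / (4 * pi)).

Definition sphere n : set (R3 R) := [set x | enorm x = sphere_radius n].

(* p = (polar angle, azimuth) *)
Definition spherical_coord n (p : R * R) : R3 R :=
  (sphere_radius n * (sin p.1 * cos p.2), sphere_radius n * (sin p.1 * sin p.2),
   sphere_radius n * cos p.1).

Definition angles : set (R * R) := `[0, pi] `*` `[0, 2 * pi].

(* Norm of the cross product of the two partial derivatives of
   spherical_coord n. *)
Definition area_element n (p : R * R) : R := sphere_radius n ^+ 2 * sin p.1.

Definition surface_area n (A : set (R3 R)) : \bar R :=
  (\int[lebesgue_measure \x lebesgue_measure]_(p in
     angles `&` spherical_coord n @^-1` A) (area_element n p)%:E)%E.

Lemma measurable_angles : measurable angles.
Proof. exact: measurableX. Qed.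

Lemma measurable_spherical_coord n : measurable_fun setT (spherical_coord n).
Proof.
have ms1 : measurable_fun setT (fun p : R * R => sin p.1).
  exact: measurableT_comp (continuous_measurable_fun (@continuous_sin R))
    measurable_fst.
have mc1 : measurable_fun setT (fun p : R * R => cos p.1).
  exact: measurableT_comp (continuous_measurable_fun (@continuous_cos R))
    measurable_fst.
have ms2 : measurable_fun setT (fun p : R * R => sin p.2).
  exact: measurableT_comp (continuous_measurable_fun (@continuous_sin R))
    measurable_snd.
have mc2 : measurable_fun setT (fun p : R * R => cos p.2).
  exact: measurableT_comp (continuous_measurable_fun (@continuous_cos R))
    measurable_snd.
apply: measurable_fun_pair; last exact: measurable_funM.
by apply: measurable_fun_pair; apply: measurable_funM => //;
  exact: measurable_funM.
Qed.

Lemma measurable_area_element n : measurable_fun setT (area_element n).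
Proof.
apply: measurable_funM => //.
exact: measurableT_comp (continuous_measurable_fun (@continuous_sin R))
  measurable_fst.
Qed.

Lemma area_element_ge0 n p : angles p -> 0 <= area_element n p.
Proof.
move=> [] /=; rewrite in_itv /= => /sin_ge0_pi p0 _.
by rewrite mulr_ge0 // sqr_ge0.
Qed.

Let surface_area0 n : surface_area n set0 = 0%E.
Proof. by rewrite /surface_area preimage_set0 setI0 integral_set0. Qed.

Let surface_area_ge0 n A : (0 <= surface_area n A)%E.
Proof.
by apply: integral_ge0 => p [ap _]; rewrite lee_fin area_element_ge0.
Qed.

Let surface_area_sigma_additive n : semi_sigma_additive (surface_area n).
Proof.
move=> A mA tA mUA.
have mB k : measurable (angles `&` spherical_coord n @^-1` A k).
  apply: measurableI; first exact: measurable_angles.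
  by rewrite -[X in measurable X]setTI; exact: measurable_spherical_coord.
rewrite /surface_area preimage_bigcup setI_bigcupr ge0_integral_bigcup //=.
- by apply: is_cvg_ereal_nneg_natsum_cond => k _ _; exact: surface_area_ge0.
- apply: measurable_funTS.
  by apply/measurable_EFinP; exact: measurable_area_element.
- by move=> p [k _ [ap _]]; rewrite lee_fin area_element_ge0.
- apply/trivIsetP => i j _ _ ij; move/trivIsetP : tA => /(_ i j I I ij) Aij.
  by rewrite setIACA setIid -preimage_setI Aij preimage_set0 setI0.
Qed.

HB.instance Definition _ n := isMeasure.Build _ _ _ (surface_area n)
  (surface_area0 n) (surface_area_ge0 n) (@surface_area_sigma_additive n).

(* g is the gradient at x of the restriction of f to the sphere, for the metric
   induced from R^3: g is tangent at x, and the differential of f at x, computed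
   along curves drawn on the sphere, is the inner product with g. *)
Definition is_gradient n (f : R3 R -> R) x (g : R3 R) : Prop :=
  dot x g = 0 /\
  forall (c : R -> R3 R) (v : R3 R), (forall t, sphere n (c t)) -> c 0 = x ->
    is_derive (0 : R) (1 : R) c v ->
    is_derive (0 : R) (1 : R) (f \o c) (dot g v).

(* The default value 0 is used only where f has no gradient; a gradient is
   unique as every tangent vector at x is the velocity of some curve. *)
Definition gradient n (f : R3 R -> R) x : R3 R := xget 0 (is_gradient n f x).

Definition potential (L : set (R3 R)) x : R :=
  \sum_(z \in L) ln (enorm (x - z)).

Definition force n (L : set (R3 R)) x : R3 R := - gradient n (potential L) x.

Definition integral_curve n (L : set (R3 R)) x (Y : R -> R3 R) (T : set R) :
    Prop :=
  Y 0 = x /\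
  forall t, T t -> (sphere n `\` L) (Y t) /\
    is_derive (t : R) (1 : R) Y (force n L (Y t)).

Definition before (b : \bar R) : set R := [set t | (t%:E < b)%E].

(* Y is a family of integral curves, Y x having the maximal interval of
   definition (-oo, tau x); Y x t is arbitrary for t outside that interval. *)
Definition is_flow n (L : set (R3 R)) (Y : R3 R -> R -> R3 R)
    (tau : R3 R -> \bar R) : Prop :=
  forall x, (sphere n `\` L) x ->
    [/\ (0 < tau x)%E,
        integral_curve n L x (Y x) (before (tau x)) &
        forall (b : \bar R) (Z : R -> R3 R),
          integral_curve n L x Z (before b) ->
          {in before (tau x), Z =1 Y x} -> (b <= tau x)%E].

End euclidean_sphere.

(* Main.v *)
(* F has divergence 2 pi off L: each of the n points contributes 2 pi / n. Hence,
   for a function h vanishing near L, the integral of h (Y_x t) over the points x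
   with t < tau x decays like exp (- 2 pi t), and integrating over t >= 0 divides
   the integral of h by 2 pi. It remains to let h increase to |F|.
   No change of variables on the sphere is needed for the decay: h (Y_x t) is
   Lipschitz in x, uniformly in t, so a time step d may be replaced by an
   approximation to order d ^ 2, namely the composition of three rotations about
   orthogonal axes whose angles depend on the point. Each of them only changes the
   azimuth around its axis, where the substitution is one-dimensional. *)

(* The obstacle is that F is singular on L and that a trajectory may run into L in finite time. The
   product [gaps] of the numbers |x - z|^2 / 2, which is exp (2 U) up to a constant factor,
   decreases along the flow; so its superlevel sets are stable backwards in time, and F is bounded
   and Lipschitz on each of them of positive level. This is why h is made to vanish where [gaps] < 2
   c, why comparisons run in the superlevel set of c, and why time steps go backwards, towards times
   at which every trajectory is defined. The rotations must be defined on the whole sphere, so 1 /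
   gap is replaced below a threshold by its tangent, which changes nothing where h is transported.
   Area is defined by coordinates around one axis; that the other two axes serve as well rests on
   the invariance of area under the exchange of two coordinates, obtained by projecting the sphere
   on their plane. The constant 2 pi arises because one point contributes the divergence 1 / (2
   r^2), where r^2 = n / (4 pi). *)
Require Import Defs.
From HB Require Import structures.
From mathcomp Require Import all_boot all_order all_algebra.
From mathcomp Require Import all_classical all_reals all_analysis.
From mathcomp Require Import measurable_realfun ring lra.

Set Implicit Arguments.
Unset Strict Implicit.
Unset Printing Implicit Defensive.

Import Order.TTheory GRing.Theory Num.Theory.
Import numFieldNormedType.Exports.

Local Open Scope classical_set_scope.
Local Open Scope ring_scope.

(** * Vectors and bounded Lipschitz functions *)

Section vectors.
Context {R : realType}.
Implicit Types (u v w x y : R3 R) (a b : R).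

Lemma R3_eqP x y : x.1.1 = y.1.1 -> x.1.2 = y.1.2 -> x.2 = y.2 -> x = y.
Proof. by move: x y => [[? ?] ?] [[? ?] ?] /= -> -> ->. Qed.

Lemma dotC u v : dot u v = dot v u.
Proof. by rewrite /dot; ring. Qed.

Lemma dotDl u v w : dot (u + v) w = dot u w + dot v w.
Proof. by rewrite /dot /=; ring. Qed.

Lemma dotDr u v w : dot w (u + v) = dot w u + dot w v.
Proof. by rewrite /dot /=; ring. Qed.

Lemma dotNl u w : dot (- u) w = - dot u w.
Proof. by rewrite /dot /=; ring. Qed.

Lemma dotNr u w : dot w (- u) = - dot w u.
Proof. by rewrite /dot /=; ring. Qed.

Lemma dotBl u v w : dot (u - v) w = dot u w - dot v w.
Proof. by rewrite /dot /=; ring. Qed.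

Lemma dotBr u v w : dot w (u - v) = dot w u - dot w v.
Proof. by rewrite /dot /=; ring. Qed.

Lemma dotZl a u w : dot (a *: u) w = a * dot u w.
Proof. by rewrite /dot /= /GRing.scale /=; ring. Qed.

Lemma dotZr a u w : dot w (a *: u) = a * dot w u.
Proof. by rewrite /dot /= /GRing.scale /=; ring. Qed.

Lemma dot0l u : dot 0 u = 0.
Proof. by rewrite /dot /=; ring. Qed.

Lemma dot_sumr (T : Type) (s : seq T) (F : T -> R3 R) w :
  dot w (\sum_(z <- s) F z) = \sum_(z <- s) dot w (F z).
Proof.
elim/big_ind2: _ => //; first by rewrite dotC dot0l.
by move=> ? ? ? ? <- <-; rewrite dotDr.
Qed.

Lemma dot_ge0 u : 0 <= dot u u.
Proof. by rewrite /dot -!expr2 !addr_ge0 ?sqr_ge0. Qed.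

Lemma dot_eq0 u : (dot u u == 0) = (u == 0).
Proof.
apply/idP/idP => [|/eqP ->]; last by rewrite dot0l.
rewrite /dot -!expr2 paddr_eq0 ?addr_ge0 ?sqr_ge0// paddr_eq0 ?sqr_ge0//.
by rewrite !sqrf_eq0 => /andP[/andP[/eqP u1 /eqP u2] /eqP u3]; case: u u1 u2 u3 => -[? ?] ? /= -> -> ->.
Qed.

Lemma sqr_enorm u : enorm u ^+ 2 = dot u u.
Proof. by rewrite sqr_sqrtr// dot_ge0. Qed.

Lemma enorm_ge0 u : 0 <= enorm u.
Proof. exact: sqrtr_ge0. Qed.

Lemma enorm0 : enorm 0 = 0 :> R.
Proof. by rewrite /enorm dot0l sqrtr0. Qed.

Lemma enorm_eq0 u : (enorm u == 0) = (u == 0).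
Proof. by rewrite -sqrf_eq0 sqr_enorm dot_eq0. Qed.

Lemma enormN u : enorm (- u) = enorm u.
Proof. by rewrite /enorm dotNl dotNr opprK. Qed.

Lemma enormZ a u : enorm (a *: u) = `|a| * enorm u.
Proof.
by rewrite /enorm dotZl dotZr mulrA -expr2 sqrtrM ?sqr_ge0// sqrtr_sqr.
Qed.

Lemma enormC u v : enorm (u - v) = enorm (v - u).
Proof. by rewrite -enormN opprB. Qed.

Lemma le_enorm u a : 0 <= a -> (enorm u <= a) = (dot u u <= a ^+ 2).
Proof. by move=> a0; rewrite -sqr_enorm ler_pXn2r// nnegrE// enorm_ge0. Qed.

Lemma dot_le u v : dot u v <= enorm u * enorm v.
Proof.
apply: le_trans (ler_norm _) _.
rewrite -(@ler_pXn2r _ 2)// ?nnegrE ?mulr_ge0 ?enorm_ge0//.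
rewrite real_normK ?num_real// exprMn !sqr_enorm -subr_ge0 /dot.
set X := (X in 0 <= X).
have -> : X = (u.1.1 * v.1.2 - u.1.2 * v.1.1) ^+ 2 +
  (u.1.1 * v.2 - u.2 * v.1.1) ^+ 2 + (u.1.2 * v.2 - u.2 * v.1.2) ^+ 2.
  by rewrite /X; ring.
by rewrite !addr_ge0 ?sqr_ge0.
Qed.

Lemma normr_dot_le u v : `|dot u v| <= enorm u * enorm v.
Proof.
by rewrite ler_norml dot_le andbT lerNl -dotNl (le_trans (dot_le _ _))// enormN.
Qed.

Lemma enormD u v : enorm (u + v) <= enorm u + enorm v.
Proof.
rewrite le_enorm ?addr_ge0 ?enorm_ge0// sqrrD !sqr_enorm dotDl !dotDr.
by have := dot_le u v; rewrite (dotC v u); lra.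
Qed.

Lemma enorm_distD w u v : enorm (u - v) <= enorm (u - w) + enorm (w - v).
Proof. by rewrite (le_trans _ (enormD _ _))// addrA subrK. Qed.

Lemma lerB_enorm u v : `|enorm u - enorm v| <= enorm (u - v).
Proof.
rewrite ler_norml; apply/andP; split.
  by rewrite lerNl opprB lerBlDr enormC (le_trans _ (enormD _ _))// subrK.
by rewrite lerBlDr (le_trans _ (enormD _ _))// subrK.
Qed.

Lemma enorm_ge_coord u :
  [/\ `|u.1.1| <= enorm u, `|u.1.2| <= enorm u & `|u.2| <= enorm u].
Proof.
have sqle a : a ^+ 2 <= dot u u -> `|a| <= enorm u.
  by move=> au; rewrite -sqrtr_sqr ler_wsqrtr.
have := (sqr_ge0 u.1.1, sqr_ge0 u.1.2, sqr_ge0 u.2).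
by move=> [[? ?] ?]; split; apply: sqle; rewrite /dot -!expr2; lra.
Qed.

Lemma enorm_le_coord u : enorm u <= `|u.1.1| + `|u.1.2| + `|u.2|.
Proof.
rewrite le_enorm ?addr_ge0//.
have e a : a ^+ 2 = `|a| ^+ 2 by rewrite real_normK ?num_real.
rewrite /dot -!expr2 (e u.1.1) (e u.1.2) (e u.2).
have := (normr_ge0 u.1.1, normr_ge0 u.1.2, normr_ge0 u.2).
by move=> [[? ?] ?]; nra.
Qed.

End vectors.

Section bounded_lipschitz.
Context {R : realType}.
Implicit Types (A : set (R3 R)) (K : R).

(** A single constant serves as bound and as Lipschitz constant, since stability under products
    needs both. *)
Definition blip A K (f : R3 R -> R) :=
  (forall x, A x -> `|f x| <= K) /\
  (forall x y, A x -> A y -> `|f x - f y| <= K * enorm (x - y)).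

(** The index allows families with one common constant, such as functions indexed by time; a single
    function is a family over [unit]. *)
Definition bl A (T : Type) (D : set T) (f : T -> R3 R -> R) :=
  exists2 K, 0 <= K & forall i, D i -> blip A K (f i).

Lemma blipW A K K' f : K <= K' -> blip A K f -> blip A K' f.
Proof.
move=> KK' [fb fl]; split=> [x Ax|x y Ax Ay].
  exact: le_trans (fb _ Ax) _.
by rewrite (le_trans (fl _ _ Ax Ay))// ler_wpM2r// enorm_ge0.
Qed.

Lemma eq_bl A (T : Type) (D : set T) f g :
  (forall i x, D i -> A x -> f i x = g i x) -> bl A D f -> bl A D g.
Proof.
move=> fg [K K0 Kf]; exists K => // i Di; have [fb fl] := Kf _ Di.
by split=> [x Ax|x y Ax Ay]; rewrite -!fg//; [exact: fb|exact: fl].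
Qed.

Lemma bl_family A (T T' : Type) (D : set T) (D' : set T') f (i : T) :
  D i -> bl A D f -> bl A D' (fun=> f i).
Proof. by move=> Di [K K0 Kf]; exists K => // _ _; exact: Kf. Qed.

Section closure.
Variables (A : set (R3 R)) (T : Type) (D : set T).
Implicit Types f g : T -> R3 R -> R.

Lemma bl_cst (k : T -> R) M : (forall i, D i -> `|k i| <= M) ->
  bl A D (fun i _ => k i).
Proof.
move=> kM; exists `|M| => // i Di; split=> [x _|x y _ _].
  exact: le_trans (kM _ Di) (ler_norm _).
by rewrite subrr normr0 mulr_ge0// enorm_ge0.
Qed.

Lemma blD f g : bl A D f -> bl A D g -> bl A D (fun i x => f i x + g i x).
Proof.
move=> [K K0 Kf] [K' K'0 Kg]; exists (K + K'); first exact: addr_ge0.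
move=> i Di; have [fb fl] := Kf _ Di; have [gb gl] := Kg _ Di.
split=> [x Ax|x y Ax Ay].
  by rewrite (le_trans (ler_normD _ _))// lerD ?fb ?gb.
rewrite opprD addrACA (le_trans (ler_normD _ _))// mulrDl lerD ?fl ?gl//.
Qed.

Lemma blM f g : bl A D f -> bl A D g -> bl A D (fun i x => f i x * g i x).
Proof.
move=> [K K0 Kf] [K' K'0 Kg]; exists (2 * (K * K')).
  by rewrite !mulr_ge0.
move=> i Di; have [fb fl] := Kf _ Di; have [gb gl] := Kg _ Di.
have KK : 0 <= K * K' by exact: mulr_ge0.
split=> [x Ax|x y Ax Ay].
  rewrite normrM (@le_trans _ _ (K * K'))//; last lra.
  by rewrite ler_pM ?fb ?gb.
have -> : f i x * g i x - f i y * g i y =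
  f i x * (g i x - g i y) + (f i x - f i y) * g i y by ring.
rewrite (le_trans (ler_normD _ _))// !normrM.
rewrite mulr_natl mulr2n mulrDl lerD//.
  by rewrite -mulrA ler_pM ?fb ?gl.
by rewrite mulrAC ler_pM ?fl ?gb.
Qed.

Lemma blZ (k : R) f : bl A D f -> bl A D (fun i x => k * f i x).
Proof. by apply: blM; apply: (@bl_cst _ `|k|). Qed.

Lemma blN f : bl A D f -> bl A D (fun i x => - f i x).
Proof.
by move=> /(blZ (-1)); apply: eq_bl => i x _ _; rewrite mulN1r.
Qed.

Lemma blB f g : bl A D f -> bl A D g -> bl A D (fun i x => f i x - g i x).
Proof. by move=> bf bg; apply: blD => //; exact: blN. Qed.

Lemma bl_sum (J : Type) (s : seq J) (F : J -> T -> R3 R -> R) :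
  (forall j, bl A D (F j)) -> bl A D (fun i x => \sum_(j <- s) F j i x).
Proof.
move=> bF; elim: s => [|j s IH].
  by apply: eq_bl (@bl_cst (fun=> 0) 0 _) => [i x _ _|i _]; rewrite ?big_nil ?normr0.
by apply: eq_bl (blD (bF j) IH) => i x _ _; rewrite big_cons.
Qed.

Lemma bl_prod (J : Type) (s : seq J) (F : J -> T -> R3 R -> R) :
  (forall j, bl A D (F j)) -> bl A D (fun i x => \prod_(j <- s) F j i x).
Proof.
move=> bF; elim: s => [|j s IH].
  by apply: eq_bl (@bl_cst (fun=> 1) 1 _) => [i x _ _|i _]; rewrite ?big_nil ?normr1.
by apply: eq_bl (blM (bF j) IH) => i x _ _; rewrite big_cons.
Qed.

Lemma bl_comp (k : T -> R -> R) f (M : R) :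
  (forall i x, D i -> A x -> `|k i (f i x)| <= M) ->
  (forall i x y, D i -> A x -> A y ->
     `|k i (f i x) - k i (f i y)| <= M * `|f i x - f i y|) ->
  bl A D f -> bl A D (fun i x => k i (f i x)).
Proof.
move=> kM kl [K K0 Kf]; exists (`|M| * (K + 1)).
  by rewrite mulr_ge0// addr_ge0.
move=> i Di; have [fb fl] := Kf _ Di; split=> [x Ax|x y Ax Ay].
  rewrite (le_trans (kM _ _ Di Ax))// (le_trans (ler_norm _))//.
  by rewrite ler_peMr// lerDr.
rewrite (le_trans (kl _ _ _ Di Ax Ay))//.
rewrite (@le_trans _ _ (`|M| * `|f i x - f i y|)) ?ler_wpM2r ?ler_norm//.
rewrite -mulrA ler_wpM2l// (le_trans (fl _ _ Ax Ay))// ler_wpM2r ?enorm_ge0//.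
by rewrite lerDl.
Qed.

End closure.

End bounded_lipschitz.

(** * Integration over the sphere *)

Section image_of_density.
Context d1 d2 (T1 : measurableType d1) (T2 : measurableType d2) (R : realType).
Variables (mu : {measure set T1 -> \bar R}) (nu : {measure set T2 -> \bar R}).
Variables (phi : T1 -> T2) (D : set T1) (w : T1 -> R).
Hypotheses (mphi : measurable_fun setT phi) (mD : measurable D).
Hypotheses (mw : measurable_fun D w) (w0 : forall x, D x -> 0 <= w x).
Hypothesis nuE : forall A, measurable A ->
  nu A = (\int[mu]_(x in D `&` phi @^-1` A) (w x)%:E)%E.

Import HBNNSimple.

Local Open Scope ereal_scope.

(** The formula for sets in [nuE] makes [nu] the image under [phi] of the density [w]; linearity
    carries it to simple functions, and monotone limits then carry it to nonnegative measurable
    ones. *)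
Lemma sintegral_image_density (h : {nnsfun T2 >-> R}) :
  sintegral nu h = \int[mu]_(x in D) ((h (phi x))%:E * (w x)%:E).
Proof.
have mpre y : measurable (phi @^-1` (h @^-1` [set y])).
  by rewrite -[X in measurable X]setTI; apply: mphi.
have mEw : measurable_fun D (EFin \o w) by exact/measurable_EFinP.
have ind0 y x : 0 <= (y * \1_(h @^-1` [set y]) (phi x))%:E.
  rewrite lee_fin indicE; case: (boolP (phi x \in _)) => [|_]; last by rewrite mulr0.
  by rewrite inE /= => <-; rewrite mulr1.
rewrite sintegralE.
transitivity (\int[mu]_(x in D) \sum_(y \in range h)
    ((y * \1_(h @^-1` [set y]) (phi x))%:E * (w x)%:E)); last first.
  apply: eq_integral => x; rewrite inE => Dx.
  rewrite -ge0_mule_fsuml; last first.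
    by [].
  by rewrite fsumEFin// -fimfunE.
have mind y : measurable_fun D (fun x => (\1_(h @^-1` [set y]) (phi x))%:E : \bar R).
  by apply/measurable_EFinP/measurable_funTS; exact: measurableT_comp.
rewrite ge0_integral_fsum//; last 2 first.
- move=> y; apply: emeasurable_funM => //.
  under eq_fun do rewrite EFinM.
  by apply: emeasurable_funM.
- by move=> y x Dx; rewrite mule_ge0// lee_fin w0.
apply: eq_fsbigr => y; rewrite inE => -[t _ hy].
under [RHS]eq_integral do rewrite EFinM -muleA.
rewrite ge0_integralZl//=; last 3 first.
- exact: emeasurable_funM.
- by move=> x Dx; rewrite mule_ge0// lee_fin ?w0// indicE.
- by rewrite -hy lee_fin.
congr (_ * _); rewrite nuE// setIC integral_mkcondl.
apply: eq_integral => x _; rewrite patchE indicE /=.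
rewrite -[x \in _]/(phi x \in h @^-1` [set y]).
by case: ifPn; rewrite ?mul1e ?mul0e.
Qed.

Lemma ge0_integral_image_density (f : T2 -> \bar R) :
  measurable_fun setT f -> (forall y, 0 <= f y) ->
  \int[nu]_y f y = \int[mu]_(x in D) (f (phi x) * (w x)%:E).
Proof.
move=> mf f0; pose h := nnsfun_approx measurableT mf.
rewrite (@nd_ge0_integral_lim _ _ _ nu f h)//; last 2 first.
- by move=> x m n mn; exact/lefP/nd_nnsfun_approx.
- by move=> x; exact: cvg_nnsfun_approx.
transitivity (limn (fun n => \int[mu]_(x in D) ((h n (phi x))%:E * (w x)%:E))).
  by congr (limn _); apply/funext => n; rewrite /= sintegral_image_density.
rewrite -monotone_convergence//.
- apply: eq_integral => x; rewrite inE => Dx; apply/cvg_lim => //.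
  by apply: cvgeZr => //; exact: cvg_nnsfun_approx.
- move=> n; apply: emeasurable_funM; last exact/measurable_EFinP.
  by apply/measurable_EFinP/measurable_funTS; exact: measurableT_comp.
- by move=> n x Dx; rewrite mule_ge0// lee_fin ?w0.
- move=> x Dx m n mn; rewrite lee_wpmul2r ?lee_fin ?w0//.
  exact/lefP/nd_nnsfun_approx.
Qed.

End image_of_density.

Section fubini_tonelli_rectangle.
Local Open Scope ereal_scope.
Context d1 d2 (T1 : measurableType d1) (T2 : measurableType d2) (R : realType).
Variables (m1 : {sigma_finite_measure set T1 -> \bar R}).
Variables (m2 : {sigma_finite_measure set T2 -> \bar R}).
Variables (D1 : set T1) (D2 : set T2) (f : T1 * T2 -> \bar R).
Hypotheses (mD1 : measurable D1) (mD2 : measurable D2).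
Hypotheses (mf : measurable_fun (D1 `*` D2) f).
Hypotheses (f0 : forall p, (D1 `*` D2) p -> 0 <= f p).

Let mfD : measurable_fun setT (f \_ (D1 `*` D2)).
Proof. by apply/(measurable_restrictT _ _).1 => //; exact: measurableX. Qed.

Let fD0 p : 0 <= (f \_ (D1 `*` D2)) p.
Proof. exact: erestrict_ge0. Qed.

(** Extension by zero reduces integrals over a rectangle to Tonelli's theorem on the whole
    product. *)
Lemma fubini_tonelli_rectangle :
  \int[m1 \x m2]_(p in D1 `*` D2) f p =
  \int[m1]_(x in D1) \int[m2]_(y in D2) f (x, y).
Proof.
rewrite integral_mkcond (fubini_tonelli1 _ mfD fD0) /fubini_F.
rewrite [RHS]integral_mkcond; apply: eq_integral => x _.
rewrite patchE; case: ifPn => xD.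
  rewrite [RHS]integral_mkcond; apply: eq_integral => y _.
  rewrite !patchE; congr (if _ then _ else _).
  by apply/idP/idP; rewrite !inE /=; [case|move=> ?; split=> //; exact/set_mem].
rewrite integral0_eq// => y _; rewrite patchE memNset//.
by move=> [/= Dx _]; move/negP: xD; apply; exact/mem_set.
Qed.

Lemma fubini_tonelli_rectangleC :
  \int[m1]_(x in D1) \int[m2]_(y in D2) f (x, y) =
  \int[m2]_(y in D2) \int[m1]_(x in D1) f (x, y).
Proof.
rewrite -fubini_tonelli_rectangle integral_mkcond (fubini_tonelli2 _ mfD fD0).
rewrite /fubini_G [RHS]integral_mkcond; apply: eq_integral => y _.
rewrite patchE; case: ifPn => yD.
  rewrite [RHS]integral_mkcond; apply: eq_integral => x _.
  rewrite !patchE; congr (if _ then _ else _).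
  by apply/idP/idP; rewrite !inE /=; [case|move=> ?; split=> //; exact/set_mem].
rewrite integral0_eq// => x _; rewrite patchE memNset//.
by move=> [/= _ Dy]; move/negP: yD; apply; exact/mem_set.
Qed.

Lemma measurable_fun_integral_rectangle :
  measurable_fun D1 (fun x => \int[m2]_(y in D2) f (x, y)).
Proof.
have := measurable_fun_fubini_tonelli_F (m2 := m2) _ mfD fD0.
move=> /(measurable_funTS (D := D1)).
apply: eq_measurable_fun => x; rewrite inE => Dx.
rewrite /fubini_F [RHS]integral_mkcond; apply: eq_integral => y _.
rewrite !patchE; congr (if _ then _ else _).
by apply/idP/idP; rewrite !inE /=; [case|move=> ?; split].
Qed.

Lemma measurable_fun_section_rectangle x : D1 x ->
  measurable_fun D2 (fun y => f (x, y)).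
Proof.
move=> Dx; apply: (@measurable_comp _ _ _ _ _ _ (D1 `*` D2) f D2 (fun y => (x, y))) => //.
- exact: measurableX.
- by move=> _ [y Dy <-].
- exact: measurable_funTS (pair1_measurable x).
Qed.

End fubini_tonelli_rectangle.

Section measurability.
Context {R : realType}.

(** [f] is the pointwise infimum of countably many measurable functions: [f x < a] exactly when some
    [g k x < a]. *)
Lemma measurable_fun_dense d (T : measurableType d) (D : set T) (f : T -> R)
    (I : countType) (g : I -> T -> R) :
  (forall k, measurable_fun D (g k)) ->
  (forall k x, D x -> f x <= g k x) ->
  (forall x e, D x -> 0 < e -> exists k, g k x < f x + e) ->
  measurable_fun D f.
Proof.
move=> mg fg gf mD; apply: (measurability _ (RGenInftyO.measurableE R)) => //.
move=> _ [_ [a ->] <-].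
rewrite (_ : D `&` _ = \bigcup_(k in [set: I]) (D `&` g k @^-1` `]-oo, a[)).
  apply: countable_bigcupT_measurable; first exact: countableP.
  by move=> k; apply: mg.
apply/seteqP; split=> [x [Dx /=]|x [k _ [Dx /=]]]; rewrite ?in_itv/=.
  move=> fxa; have [|k kx] := gf x (a - f x) Dx; first by rewrite subr_gt0.
  by exists k => //; split=> //=; rewrite ?in_itv/=; lra.
by move=> gka; split=> //=; rewrite ?in_itv/= (le_lt_trans (fg k x Dx)).
Qed.

Lemma measurable_enorm : measurable_fun setT (@enorm R).
Proof.
have ms : measurable_fun setT (@Num.sqrt R).
  by apply: continuous_measurable_fun; exact: sqrt_continuous.
rewrite (_ : enorm = Num.sqrt \o (fun u : R3 R => dot u u))//.
apply: (measurableT_comp ms).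
have m11 : measurable_fun setT (fun x : R3 R => x.1.1).
  exact: measurableT_comp.
have m12 : measurable_fun setT (fun x : R3 R => x.1.2).
  exact: measurableT_comp.
by apply: measurable_funD; [apply: measurable_funD|]; apply: measurable_funM.
Qed.

Lemma measurable_enormB (y : R3 R) : measurable_fun setT (fun x : R3 R => enorm (x - y)).
Proof.
apply: measurableT_comp; first exact: measurable_enorm.
have m11 : measurable_fun setT (fun x : R3 R => x.1.1).
  exact: measurableT_comp.
have m12 : measurable_fun setT (fun x : R3 R => x.1.2).
  exact: measurableT_comp.
apply: measurable_fun_pair; last exact: measurable_funB.
by apply: measurable_fun_pair; exact: measurable_funB.
Qed.

Lemma rat3_dense (x : R3 R) (e : R) : 0 < e ->
  exists q : rat * rat * rat,
    enorm (x - (ratr q.1.1, ratr q.1.2, ratr q.2)) < e.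
Proof.
move=> e0.
have ap (a : R) : exists q : rat, `|a - ratr q| < e / 3.
  have [|q] := @rat_in_itvoo R (a - e / 3) (a + e / 3); first lra.
  rewrite in_itv/= => /andP[q1 q2]; exists q.
  by rewrite ltr_norml; apply/andP; split; lra.
have [q1 h1] := ap x.1.1; have [q2 h2] := ap x.1.2; have [q3 h3] := ap x.2.
exists (q1, q2, q3); apply: le_lt_trans (enorm_le_coord _) _ => /=.
lra.
Qed.

End measurability.

Section sphere.
Context {R : realType} (n : nat) (n0 : (0 < n)%N).
Let r : R := sphere_radius n.
Let S : set (R3 R) := sphere n.
Let sph : R * R -> R3 R := spherical_coord n.
Notation leb := (@lebesgue_measure R).

Lemma sphere_radius_gt0 : 0 < r.
Proof.
by rewrite /r /sphere_radius sqrtr_gt0 divr_gt0// ?ltr0n// mulr_gt0// pi_gt0.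
Qed.

Lemma sphereP x : S x <-> dot x x = r ^+ 2.
Proof.
have r0 : 0 <= r by exact/ltW/sphere_radius_gt0.
rewrite /S /sphere /=; split=> [xr|xr]; first by rewrite -sqr_enorm xr.
by rewrite /enorm xr sqrtr_sqr ger0_norm.
Qed.

Lemma spherical_coord_sphere p : S (sph p).
Proof.
apply/sphereP; rewrite /dot /sph /spherical_coord /= -/r.
have := cos2Dsin2 p.1; have := cos2Dsin2 p.2.
set c := cos p.2; set s := sin p.2; set c' := cos p.1; set s' := sin p.1.
move=> h h'.
transitivity (r ^+ 2 * (s' ^+ 2 * (c ^+ 2 + s ^+ 2) + c' ^+ 2)); first ring.
by rewrite h mulr1 addrC h' mulr1.
Qed.

Lemma measurable_sphere : measurable S.
Proof.
rewrite (_ : S = enorm @^-1` [set r])//.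
by rewrite -[X in measurable X]setTI; apply: measurable_enorm.
Qed.

(* Nonzero points of Q^3 project radially onto a dense subset of the sphere. *)
Let net (q : rat * rat * rat) : R3 R :=
  let v := (ratr q.1.1, ratr q.1.2, ratr q.2) : R3 R in
  if v == 0 then (0, 0, r) else (r / enorm v) *: v.

Lemma sphere_net : exists u : rat * rat * rat -> R3 R,
  (forall q, S (u q)) /\
  forall x e, S x -> 0 < e -> exists q, enorm (x - u q) < e.
Proof.
have r0 := sphere_radius_gt0.
exists net; split=> [q|x e Sx e0].
  rewrite /net; case: ifPn => [_|v0]; apply/sphereP.
    by rewrite /dot/=; ring.
  by rewrite -sqr_enorm enormZ ger0_norm ?divr_ge0 ?enorm_ge0 ?(ltW r0)//
    divfK// enorm_eq0.
(* The radial projection moves [v] by | |v| - r | <= |v - x|, whence the half; the bound by [r]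
   excludes v = 0, since |x| = r. *)
pose e' := Num.min (e / 2) r.
have [|q qe] := @rat3_dense R x e'; first by rewrite lt_min r0 divr_gt0.
exists q; rewrite /net; move: qe; set v := (_, _, _) => qe.
have xr : enorm x = r by exact: Sx.
case: eqVneq => [v0|v0].
  by move: qe; rewrite v0 subr0 xr /e' lt_min ltxx andbF.
rewrite (le_lt_trans (enorm_distD v _ _))//.
have v1 : 0 < enorm v by rewrite lt_def enorm_ge0 andbT enorm_eq0.
have -> : enorm (v - (r / enorm v) *: v) = `|enorm v - r|.
  rewrite -[X in enorm (X - _)]scale1r -scalerBl enormZ -[X in _ * X](ger0_norm (ltW v1)).
  by rewrite -normrM mulrBl mul1r divfK ?gt_eqF.
have := lerB_enorm v x; rewrite xr (enormC v) => vx.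
by move: qe; rewrite /e' lt_min => /andP[+ _]; lra.
Qed.

(** A Lipschitz function is the infimum of the cones [f (u q) + K * enorm (x - u q)] over a
    countable dense set: such a cone overshoots [f x] by at most 2 |K| times the distance from [x]
    to its vertex. *)
Lemma blip_measurable K f : blip S K f -> measurable_fun S f.
Proof.
move=> [_ fl]; have [u [Su ud]] := sphere_net.
apply: (@measurable_fun_dense _ _ _ _ _ _ (fun q (x : R3 R) => f (u q) + K * enorm (x - u q))).
- move=> q; apply: measurable_funD => //; apply: measurable_funM => //.
  by apply: measurable_funTS; exact: measurable_enormB.
- move=> q x Sx; have := fl _ _ Sx (Su q); rewrite ler_norml => /andP[_]; lra.
- move=> x e Sx e0.
  have K1 : 0 < 2 * `|K| + 1 by rewrite ltr_wpDl// mulr_ge0.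
  have [|q qe] := ud x (e / (2 * `|K| + 1)) Sx; first by rewrite divr_gt0.
  exists q; have := fl _ _ (Su q) Sx; rewrite ler_norml enormC => /andP[_].
  move: qe; rewrite ltr_pdivlMr// => qe h.
  have := enorm_ge0 (x - u q); have : K * enorm (x - u q) <= `|K| * enorm (x - u q).
    by rewrite ler_wpM2r ?enorm_ge0// ler_norm.
  by move: qe h; set E := enorm _; lra.
Qed.

Lemma bl_measurable f : bl S setT (fun _ : unit => f) -> measurable_fun S f.
Proof. by move=> [K _ /(_ tt I)]; exact: blip_measurable. Qed.

Lemma sphere_integralE (g : R3 R -> R) :
  measurable_fun S g -> (forall x, S x -> 0 <= g x) ->
  (\int[surface_area n]_(x in S) (g x)%:E =
   \int[leb \x leb]_(p in @angles R) (g (sph p) * area_element n p)%:E)%E.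
Proof.
move=> mg g0.
have mg' : measurable_fun setT ((EFin \o g) \_ S).
  apply/(measurable_restrictT _ _).1; first exact: measurable_sphere.
  exact/measurable_EFinP.
rewrite integral_mkcond.
rewrite (@ge0_integral_image_density _ _ _ _ _ (leb \x leb)%E (surface_area n)
   sph (@angles R) (area_element n) (measurable_spherical_coord n)
   measurable_angles _ _ _ _ mg')//.
- apply: eq_integral => p _; rewrite patchE mem_set//.
  exact: spherical_coord_sphere.
- by apply: measurable_funTS; exact: measurable_area_element.
- exact: area_element_ge0.
- by move=> x; apply: erestrict_ge0 => y Sy; rewrite lee_fin g0.
Qed.

Lemma measurable_sphere_coord (g : R3 R -> R) :
  measurable_fun S g -> measurable_fun setT (g \o sph).
Proof.
move=> mg; have mS := measurable_sphere.
apply: (measurable_comp mS) => //; last exact: measurable_spherical_coord.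
by move=> _ [p _ <-]; exact: spherical_coord_sphere.
Qed.

Lemma sphere_integral_iterated (g : R3 R -> R) :
  measurable_fun S g -> (forall x, S x -> 0 <= g x) ->
  (\int[surface_area n]_(x in S) (g x)%:E =
   \int[leb]_(t in `[0%R, pi]) \int[leb]_(u in `[0%R, (2 * pi)%R])
     (g (sph (t, u)) * area_element n (t, u))%:E)%E.
Proof.
move=> mg g0; rewrite sphere_integralE//.
apply: (@fubini_tonelli_rectangle _ _ _ _ _ leb leb) => //.
- apply/measurable_EFinP; apply: measurable_funTS; apply: measurable_funM.
    exact: measurable_sphere_coord.
  exact: measurable_area_element.
- move=> p ap; rewrite lee_fin mulr_ge0 ?g0//.
    exact: spherical_coord_sphere.
  exact: area_element_ge0.
Qed.

End sphere.

(** * Rotations and swaps preserve area *)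

Section calculus.
Context {R : realType}.
Notation leb := (@lebesgue_measure R).
Implicit Types (f F H psi : R -> R) (a b x T B : R).

Lemma is_derive_continuous f x (df : R) :
  is_derive x 1 f df -> {for x, continuous f}.
Proof. by move=> [dfx _]; apply/differentiable_continuous/derivable1_diffP. Qed.

Lemma FTC2_is_derive F f a b : a <= b ->
  (forall x, a <= x <= b -> is_derive x (1 : R) F (f x)) -> continuous f ->
  (\int[leb]_(x in `[a, b]) (f x)%:E = (F b - F a)%:E)%E.
Proof.
rewrite le_eqVlt => /predU1P[-> _ _|ab dF cf].
  by rewrite set_itv1 integral_set1 subrr.
rewrite (@continuous_FTC2 R f F)//; first exact: continuous_subspaceT.
- have cF x : a <= x <= b -> {for x, continuous F}.
    by move=> /dF; exact: is_derive_continuous.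
  split=> [x||].
  + by rewrite in_itv/= => /andP[/ltW ? /ltW ?]; apply: (@ex_derive _ _ _ _ _ _ _ (dF _ _)); apply/andP.
  + by apply: cvg_at_right_filter; apply: cF; rewrite lexx ltW.
  + by apply: cvg_at_left_filter; apply: cF; rewrite lexx ltW.
- move=> x; rewrite in_itv/= => /andP[/ltW ? /ltW ?].
  by rewrite derive1E (@derive_val _ _ _ _ _ _ _ (dF _ _))//; apply/andP.
Qed.

(** Integration starts at [- B]. A bounded interval is enough, as the changes of variables below
    take their values in one. *)
Lemma continuous_primitive f B : continuous f ->
  exists F, forall x, - B < x < B -> is_derive x (1 : R) F (f x).
Proof.
move=> cf; exists (fun x => \int[leb]_(t in `[- B, x]) f t) => x /andP[Bx xB].
have [|dF F'] := @continuous_FTC1_closed R f (- B) x B xB _ Bx (cf x).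
- apply: continuous_compact_integrable; first exact: segment_compact.
  exact: continuous_subspaceT.
- by apply: (DeriveDef dF); rewrite -derive1E; exact: F'.
Qed.

(** The integrand is the derivative of [F \o psi], so increasing, decreasing and non-monotone
    changes of variables are covered alike. *)
Lemma substitution_primitive H psi dpsi F a b B : a <= b -> continuous H ->
  continuous dpsi -> (forall u : R, is_derive u (1 : R) psi (dpsi u)) ->
  (forall u, a <= u <= b -> - B < psi u < B) ->
  (forall x, - B < x < B -> is_derive x (1 : R) F (H x)) ->
  (\int[leb]_(u in `[a, b]) (H (psi u) * dpsi u)%:E =
   (F (psi b) - F (psi a))%:E)%E.
Proof.
move=> ab cH cd dpsiE psiB dF.
apply: (@FTC2_is_derive (F \o psi) (fun u => H (psi u) * dpsi u)) => //.
- move=> u uab; have := dF _ (psiB _ uab) => dFu.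
  have := dpsiE u => dpu.
  by have := @is_derive1_comp R F psi u _ _ dFu dpu; rewrite mulrC.
- move=> u; apply: continuousM; last exact: cd.
  apply: continuous_comp; last exact: cH.
  exact: (is_derive_continuous (dpsiE u)).
Qed.

(** The function [F (z + T) - F z] has derivative [H (z + T) - H z] = 0. The bounds by [B] keep both
    arguments in the interval where [F] is a primitive. *)
Lemma primitive_shift F H a T : 0 <= T -> (forall x, H (x + T) = H x) ->
  forall B, - B < 0 -> T < B -> - B < a -> a + T < B ->
  (forall x, - B < x < B -> is_derive x (1 : R) F (H x)) ->
  F (a + T) - F a = F T - F 0.
Proof.
move=> T0 HT B B0 TB Ba aTB dF.
suff main x y : - B < x -> y + T < B -> x <= y -> F (x + T) - F x = F (y + T) - F y.
  have [a0|/ltW a0] := leP 0 a; last by rewrite (main a 0) ?add0r.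
  by rewrite -(main 0 a) ?add0r.
move=> Bx yB xy; apply/esym/eqP; rewrite -subr_eq0; apply/eqP.
pose G z := F (z + T) - F z.
have dG z : x <= z <= y -> is_derive z (1 : R) G 0.
  move=> /andP[xz zy].
  have d1 : is_derive (z + T) (1 : R) F (H (z + T)) by apply: dF; lra.
  have d2 : is_derive z (1 : R) F (H z) by apply: dF; lra.
  have d3 : is_derive z (1 : R) (fun z : R => z + T) 1.
    by apply: is_derive_eq; rewrite addr0.
  have d4 := @is_derive1_comp R F _ z _ _ d1 d3.
  have := is_deriveB d4 d2; rewrite HT mulr1 subrr.
  exact.
have [||c _] := @MVT_segment R G (cst 0) x y xy.
- move=> z /itvP zxy; apply: dG; by rewrite !ltW// zxy.
- apply: derivable_within_continuous => z; rewrite in_itv/= => /dG [+ _].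
  exact.
- by rewrite /G /= mul0r.
Qed.

(** The substitution leads to the integral of [H] from [psi 0] to [psi 0 + T], which by periodicity
    is its integral over [0, T]. *)
Lemma integral_periodic_substitution H psi dpsi T : 0 < T ->
  continuous H -> (forall x, H (x + T) = H x) ->
  continuous dpsi -> (forall u : R, is_derive u (1 : R) psi (dpsi u)) ->
  psi T = psi 0 + T ->
  (\int[leb]_(u in `[0%R, T]) (H (psi u) * dpsi u)%:E =
   \int[leb]_(u in `[0%R, T]) (H u)%:E)%E.
Proof.
move=> T0 cH HT cd dE psiT.
have cpsi : {within `[0, T], continuous psi}.
  by apply: derivable_within_continuous => u _; have [] := dE u.
have [c1 _ c1m] := EVT_max (ltW T0) cpsi.
have [c2 _ c2m] := EVT_min (ltW T0) cpsi.
(* Room for all values of [psi] on the period, and for 0 and [T]. *)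
pose B := `|psi c1| + `|psi c2| + T + 1.
have psiB u : 0 <= u <= T -> - B < psi u < B.
  move=> uT; have := c1m u; have := c2m u; rewrite !in_itv/= uT.
  move=> /(_ isT) ? /(_ isT) ?; rewrite /B.
  have := ler_norm (psi c1); have := ler_norm (- psi c2); rewrite normrN.
  have := normr_ge0 (psi c1); have := normr_ge0 (psi c2); lra.
have BT : T < B by rewrite /B; have := normr_ge0 (psi c1); have := normr_ge0 (psi c2); lra.
have [F dF] := continuous_primitive B cH.
rewrite (substitution_primitive (ltW T0) cH cd dE psiB dF).
have dF' x : 0 <= x <= T -> is_derive x (1 : R) F (H x).
  by move=> /andP[? ?]; apply: dF; lra.
rewrite (FTC2_is_derive (ltW T0) dF' cH).
have /andP[? ?] := psiB 0 ltac:(lra).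
have /andP[? ?] := psiB T ltac:(lra).
rewrite psiT; congr EFin; apply: (primitive_shift _ HT _ _ _ _ dF); lra.
Qed.

End calculus.

Section trigonometric_bounds.
Context {R : realType}.
Implicit Types a b : R.

Lemma le_normr_cos a : `|cos a| <= 1.
Proof. by rewrite ler_norml cos_geN1 cos_le1. Qed.

Lemma le_normr_sin a : `|sin a| <= 1.
Proof. by rewrite ler_norml sin_geN1 sin_le1. Qed.

Lemma is_derive_lipschitz (f df : R -> R) (M : R) a b :
  (forall x, is_derive x (1 : R) f (df x)) ->
  (forall x, Num.min a b <= x <= Num.max a b -> `|df x| <= M) ->
  `|f a - f b| <= M * `|a - b|.
Proof.
move=> dE dM; wlog ab : a b dM / a <= b.
  move=> wl; have [ab|/ltW ba] := leP a b; first exact: wl.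
  by rewrite distrC (distrC a) wl// => x; rewrite minC maxC; exact: dM.
have cf : {within `[a, b], continuous f}.
  by apply: derivable_within_continuous => x _; have [] := dE x.
have [c] := MVT_segment ab (fun x _ => dE x) cf.
rewrite in_itv/= => acb fab.
rewrite distrC fab normrM (distrC b a) ler_wpM2r// dM//.
by rewrite (min_idPl ab) (max_idPr ab).
Qed.

Lemma sin_lipschitz a b : `|sin a - sin b| <= `|a - b|.
Proof.
rewrite -[leRHS]mul1r; apply: (@is_derive_lipschitz sin cos) => x _.
exact: le_normr_cos.
Qed.

Lemma cos_lipschitz a b : `|cos a - cos b| <= `|a - b|.
Proof.
rewrite -[leRHS]mul1r; apply: (@is_derive_lipschitz cos (fun x => - sin x)) => x _.
by rewrite normrN le_normr_sin.
Qed.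

Let between0 a x : Num.min a 0 <= x <= Num.max a 0 -> `|x| <= `|a|.
Proof.
have [a0|/ltW a0] := leP 0 a; rewrite ?(min_idPr a0) ?(max_idPl a0)
  ?(min_idPl a0) ?(max_idPr a0) => /andP[? ?]; first by rewrite !ger0_norm.
by rewrite !ler0_norm// lerN2.
Qed.

(** Between 0 and [a] the derivative is at most |a| in size; the factor 1/2 of the sharp bound is
    given up. *)
Lemma cosB1_le a : `|cos a - 1| <= a ^+ 2.
Proof.
have := @is_derive_lipschitz cos (fun x => - sin x) `|a| a 0.
rewrite cos0 subr0 -expr2 real_normK ?num_real//; apply=> x /between0.
rewrite normrN; apply: le_trans.
by have := sin_lipschitz x 0; rewrite sin0 !subr0.
Qed.

Lemma sinB_le a : `|sin a - a| <= a ^+ 2.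
Proof.
have := @is_derive_lipschitz (fun x => sin x - x) (fun x => cos x - 1) `|a| a 0.
rewrite sin0 !subr0 -expr2 real_normK ?num_real//; apply=> x /between0.
by apply: le_trans; have := cos_lipschitz x 0; rewrite cos0 subr0.
Qed.

End trigonometric_bounds.

Section rotation.
Context {R : realType}.
Implicit Types (a b : R) (x y : R3 R).

Definition rot3 a x : R3 R :=
  (x.1.1 * cos a - x.1.2 * sin a, x.1.1 * sin a + x.1.2 * cos a, x.2).

(** The cross product of the third basis vector with [x], that is the velocity of [rot3] at angle
    0. *)
Definition gen3 x : R3 R := (- x.1.2, x.1.1, 0).

Lemma rot3D a b x : rot3 (a + b) x = rot3 a (rot3 b x).
Proof. by rewrite /rot3 /= cosD sinD; congr (_, _, _); ring. Qed.

Lemma dot_rot3 a x y : dot (rot3 a x) (rot3 a y) = dot x y.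
Proof.
rewrite /dot /rot3 /=; have := cos2Dsin2 a; set c := cos a; set s := sin a => h.
transitivity ((x.1.1 * y.1.1 + x.1.2 * y.1.2) * (c ^+ 2 + s ^+ 2) + x.2 * y.2).
  ring.
by rewrite h mulr1.
Qed.

(** At a fixed angle the rotation is an isometry; a change of angle yields four products, each at
    most |a - b| |y|, hence the constant 4. *)
Lemma rot3_lipschitz a b x y :
  enorm (rot3 a x - rot3 b y) <= enorm (x - y) + 4 * `|a - b| * enorm y.
Proof.
rewrite (le_trans (enorm_distD (rot3 a y) _ _))// lerD//.
  rewrite (_ : rot3 a x - rot3 a y = rot3 a (x - y)); last first.
    by rewrite /rot3 /=; congr (_, _, _) => /=; ring.
  by rewrite /enorm dot_rot3.
have [y1 y2 _] := enorm_ge_coord y.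
have c := cos_lipschitz a b; have s := sin_lipschitz a b.
apply: le_trans (enorm_le_coord _) _; rewrite /rot3 /= subrr normr0 addr0.
have e0 := enorm_ge0 y.
have -> : y.1.1 * cos a - y.1.2 * sin a - (y.1.1 * cos b - y.1.2 * sin b) =
  y.1.1 * (cos a - cos b) - y.1.2 * (sin a - sin b) by ring.
have -> : y.1.1 * sin a + y.1.2 * cos a - (y.1.1 * sin b + y.1.2 * cos b) =
  y.1.1 * (sin a - sin b) + y.1.2 * (cos a - cos b) by ring.
have bnd p q : `|p| <= enorm y -> `|q| <= `|a - b| -> `|p * q| <= `|a - b| * enorm y.
  by move=> ? ?; rewrite normrM mulrC ler_pM.
have := ler_normB (y.1.1 * (cos a - cos b)) (y.1.2 * (sin a - sin b)).
have := ler_normD (y.1.1 * (sin a - sin b)) (y.1.2 * (cos a - cos b)).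
have := bnd _ _ y1 c; have := bnd _ _ y2 c; have := bnd _ _ y1 s; have := bnd _ _ y2 s.
lra.
Qed.

Lemma rot3_first_order a x :
  enorm (rot3 a x - (x + a *: gen3 x)) <= 4 * a ^+ 2 * enorm x.
Proof.
have [x1 x2 _] := enorm_ge_coord x.
have c := cosB1_le a; have s := sinB_le a.
apply: le_trans (enorm_le_coord _) _; rewrite /rot3 /gen3 /= /GRing.scale /=.
have e0 := enorm_ge0 x.
have -> : x.1.1 * cos a - x.1.2 * sin a - (x.1.1 + a * - x.1.2) =
  x.1.1 * (cos a - 1) - x.1.2 * (sin a - a) by ring.
have -> : x.1.1 * sin a + x.1.2 * cos a - (x.1.2 + a * x.1.1) =
  x.1.1 * (sin a - a) + x.1.2 * (cos a - 1) by ring.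
rewrite (_ : x.2 - _ = 0) ?normr0 ?addr0; last by ring.
have bnd p q : `|p| <= enorm x -> `|q| <= a ^+ 2 -> `|p * q| <= a ^+ 2 * enorm x.
  by move=> ? ?; rewrite normrM mulrC ler_pM.
have := ler_normB (x.1.1 * (cos a - 1)) (x.1.2 * (sin a - a)).
have := ler_normD (x.1.1 * (sin a - a)) (x.1.2 * (cos a - 1)).
have := bnd _ _ x1 c; have := bnd _ _ x2 c; have := bnd _ _ x1 s; have := bnd _ _ x2 s.
lra.
Qed.

Lemma enorm_gen3 x : enorm (gen3 x) <= enorm x.
Proof.
rewrite le_enorm ?enorm_ge0// sqr_enorm /dot /gen3 /=.
by have := sqr_ge0 x.2; lra.
Qed.

Lemma gen3B x y : gen3 x - gen3 y = gen3 (x - y).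
Proof. by rewrite /gen3 /=; congr (_, _, _) => /=; ring. Qed.

End rotation.

Section rotation_sphere.
Context {R : realType} (n : nat) (n0 : (0 < n)%N).
Let r : R := sphere_radius n.
Let S : set (R3 R) := sphere n.
Let sph : R * R -> R3 R := spherical_coord n.
Notation leb := (@lebesgue_measure R).

Lemma rot3_spherical_coord a t u : rot3 a (sph (t, u)) = sph (t, u + a).
Proof.
by rewrite /rot3 /sph /spherical_coord /= cosD sinD; congr (_, _, _); ring.
Qed.

Lemma rot3_sphere a x : S x -> S (rot3 a x).
Proof. by rewrite /S /sphere /enorm /= dot_rot3. Qed.

Lemma sphere_enorm x : S x -> enorm x = r.
Proof. by []. Qed.

Lemma blip_rot3 K M g w : 0 <= K -> 0 <= M -> blip S K g -> blip S M w ->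
  blip S (K * (1 + 4 * M * r)) (fun x => g (rot3 (w x) x)).
Proof.
move=> K0 M0 [gb gl] [wb wl]; have r0 := sphere_radius_gt0 (R := R) n0.
split=> [x Sx|x y Sx Sy].
  rewrite (le_trans (gb _ _))//; first exact: rot3_sphere.
  by rewrite ler_peMr// lerDl !mulr_ge0// ltW.
rewrite (le_trans (gl _ _ _ _))//; [exact: rot3_sphere|exact: rot3_sphere|].
rewrite -[leRHS]mulrA ler_wpM2l// (le_trans (rot3_lipschitz _ _ _ _))//.
rewrite [leRHS]mulrDl mul1r lerD2l (sphere_enorm Sy).
have -> : 4 * M * r * enorm (x - y) = 4 * (M * enorm (x - y)) * r by ring.
by rewrite ler_wpM2r ?(ltW r0)// ler_wpM2l// wl.
Qed.

Lemma bl_rot3 (T : Type) (D : set T) (g w : T -> R3 R -> R) :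
  bl S D g -> bl S D w -> bl S D (fun i x => g i (rot3 (w i x) x)).
Proof.
move=> [K K0 Kg] [M M0 Mw]; exists (K * (1 + 4 * M * r)).
  by rewrite !mulr_ge0// addr_ge0// !mulr_ge0// ltW// sphere_radius_gt0.
by move=> i Di; apply: blip_rot3 => //; [exact: Kg|exact: Mw].
Qed.

Lemma blip_continuous_comp K f (p : R -> R3 R) (u : R) : blip S K f ->
  (forall v, S (p v)) -> {for u, continuous (fun v => (p v).1.1)} ->
  {for u, continuous (fun v => (p v).1.2)} ->
  {for u, continuous (fun v => (p v).2)} ->
  {for u, continuous (f \o p)}.
Proof.
move=> [_ fl] Sp c1 c2 c3; apply/cvgrPdist_lt => e e0.
have K1 : 0 < 3 * (`|K| + 1) by rewrite mulr_gt0// ltr_wpDl.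
have e1 : 0 < e / (3 * (`|K| + 1)) by rewrite divr_gt0.
move/cvgrPdist_lt : c1 => /(_ _ e1) c1; move/cvgrPdist_lt : c2 => /(_ _ e1) c2.
move/cvgrPdist_lt : c3 => /(_ _ e1) c3.
near=> v.
have h1 : `|(p u).1.1 - (p v).1.1| < e / (3 * (`|K| + 1)) by near: v.
have h2 : `|(p u).1.2 - (p v).1.2| < e / (3 * (`|K| + 1)) by near: v.
have h3 : `|(p u).2 - (p v).2| < e / (3 * (`|K| + 1)) by near: v.
rewrite (le_lt_trans (fl _ _ (Sp u) (Sp v)))//.
rewrite (@le_lt_trans _ _ ((`|K| + 1) * enorm (p u - p v)))//.
  by rewrite ler_wpM2r ?enorm_ge0// (le_trans (ler_norm _))// lerDl.
have := enorm_le_coord (p u - p v) => /=.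
rewrite -ltr_pdivlMl ?ltr_wpDl// => /le_lt_trans; apply.
rewrite (@lt_le_trans _ _ (3 * (e / (3 * (`|K| + 1)))))//; first lra.
by rewrite le_eqVlt; apply/orP; left; apply/eqP; field; rewrite gt_eqF// ltr_wpDl.
Unshelve. all: by end_near. Qed.

Lemma continuous_sph2 K f t : blip S K f -> continuous (fun u => f (sph (t, u))).
Proof.
move=> fK u; apply: (@blip_continuous_comp K f (fun u => sph (t, u))) => //=.
- by move=> v; exact: spherical_coord_sphere.
- apply: continuousM; first exact: cst_continuous.
  by apply: continuousM; [exact: cst_continuous|exact: continuous_cos].
- apply: continuousM; first exact: cst_continuous.
  by apply: continuousM; [exact: cst_continuous|exact: continuous_sin].
- exact: cst_continuous.
Qed.

Lemma spherical_coord_periodic t u : sph (t, u + 2 * pi) = sph (t, u).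
Proof.
rewrite /sph /spherical_coord /=; congr (_, _, _); congr (_ * _); congr (_ * _).
  by rewrite mulr_natl cosD2pi.
by rewrite mulr_natl sinD2pi.
Qed.

(* Along each parallel, x |-> rot3 (d * w x) x is a change of the azimuth by a
   C^1 map of degree one, with derivative 1 + d * D x. *)
Lemma rot3_change_of_variables K1 K2 K3 g w D (d : R) :
  0 <= K1 -> 0 <= K2 -> 0 <= K3 ->
  blip S K1 g -> blip S K2 w -> blip S K3 D ->
  (forall x, S x -> is_derive (0 : R) (1 : R) (fun a => w (rot3 a x)) (D x)) ->
  (forall x, S x -> 0 <= g x) -> (forall x, S x -> 0 <= 1 + d * D x) ->
  (\int[surface_area n]_(x in S) (g (rot3 (d * w x) x) * (1 + d * D x))%:E =
   \int[surface_area n]_(x in S) (g x)%:E)%E.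
Proof.
move=> K10 K20 K30 gK wK DK dw g0 D0.
have dwK : blip S (`|d| * K2) (fun x => d * w x).
  move: wK => [wb wl]; split=> [x Sx|x y Sx Sy].
    by rewrite normrM ler_wpM2l// wb.
  by rewrite -mulrBr normrM -mulrA ler_wpM2l// wl.
have mg := blip_measurable n0 gK.
rewrite (sphere_integral_iterated n0 mg g0).
rewrite (@sphere_integral_iterated _ _ n0
  (fun x => g (rot3 (d * w x) x) * (1 + d * D x))); last 2 first.
- apply: measurable_funM.
    apply: (blip_measurable n0 (K := K1 * (1 + 4 * (`|d| * K2) * r))).
    by apply: blip_rot3 => //; rewrite mulr_ge0.
  apply: measurable_funD => //; apply: measurable_funM => //.
  exact: (blip_measurable n0 DK).
- by move=> x Sx; rewrite mulr_ge0 ?D0 ?g0//; exact: rot3_sphere.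
apply: eq_integral => t _.
(* The area element depends on the polar angle only, hence the azimuth 0. *)
pose H v := g (sph (t, v)) * area_element n (t, 0).
pose psi u := u + d * w (sph (t, u)).
pose dpsi u := 1 + d * D (sph (t, u)).
have dpsiE (u : R) : is_derive u (1 : R) psi (dpsi u).
  have Su := spherical_coord_sphere n0 (t, u).
  (* A rotation shifts the azimuth, so the derivative at azimuth [u] is the derivative at angle 0
     for the point of azimuth [u]. *)
  have d0 := dw _ Su.
  have dB : is_derive u (1 : R) (fun v : R => v - u) 1.
    by apply: is_derive_eq; rewrite subr0.
  have d0' : is_derive (u - u) (1 : R) (fun a => w (rot3 a (sph (t, u))))
      (D (sph (t, u))) by rewrite subrr.
  have := @is_derive1_comp R _ _ u _ _ d0' dB; rewrite mulr1.
  have -> : (fun a => w (rot3 a (sph (t, u)))) \o (fun v : R => v - u) =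
      (fun v => w (sph (t, v))).
    by apply/funext => v /=; rewrite rot3_spherical_coord addrC subrK.
  move=> dwu; rewrite /psi /dpsi.
  apply: is_deriveD; have := is_deriveZ d dwu; exact.
transitivity (\int[leb]_(u in `[0%R, (2 * pi)%R]) (H (psi u) * dpsi u)%:E)%E.
  apply: eq_integral => u _; congr EFin.
  by rewrite /H /psi /dpsi rot3_spherical_coord /area_element /=; ring.
apply: (@integral_periodic_substitution R H psi dpsi (2 * pi)).
- by rewrite mulr_gt0// pi_gt0.
- rewrite /H => u; apply: (@continuousM _ _ (fun v => g (sph (t, v))) (fun=> area_element n (t, 0))); last exact: cst_continuous.
  exact: (@continuous_sph2 K1).
- by move=> u; rewrite /H spherical_coord_periodic.
- rewrite /dpsi => u.
  apply: cvgD; first exact: cvg_cst.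
  apply: (@continuousM _ _ (fun=> d) (fun v => D (sph (t, v)))).
    exact: cst_continuous.
  exact: (@continuous_sph2 K3).
- by rewrite /psi -[2 * pi]add0r spherical_coord_periodic; ring.
Qed.

End rotation_sphere.

(** * Invariance of area under the exchange of two coordinates *)

Section swap.
Context {R : realType} (n : nat) (n0 : (0 < n)%N).
Let r : R := sphere_radius n.
Let S : set (R3 R) := sphere n.
Let sph : R * R -> R3 R := spherical_coord n.
Notation leb := (@lebesgue_measure R).

(** Conjugation by this reflection turns rotations about the third axis into rotations about the
    first. *)
Definition swap13 (x : R3 R) : R3 R := (x.2, x.1.2, x.1.1).

Lemma swap13K : involutive swap13.
Proof. by case=> -[]. Qed.

Lemma dot_swap13 x y : dot (swap13 x) (swap13 y) = dot x y.
Proof. by rewrite /dot /=; ring. Qed.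

Lemma swap13_sphere x : S x -> S (swap13 x).
Proof. by rewrite /S /sphere /enorm /= dot_swap13. Qed.

Lemma blip_swap13 K f : blip S K f -> blip S K (f \o swap13).
Proof.
move=> [fb fl]; split=> [x Sx|x y Sx Sy]; first exact/fb/swap13_sphere.
rewrite (le_trans (fl _ _ (swap13_sphere Sx) (swap13_sphere Sy)))//.
rewrite (_ : swap13 x - swap13 y = swap13 (x - y))//.
by rewrite /enorm dot_swap13.
Qed.

Lemma integral_itv_split (f : R -> R) a b c : a <= b -> b <= c -> continuous f ->
  (\int[leb]_(x in `[a, c]) (f x)%:E =
   \int[leb]_(x in `[a, b]) (f x)%:E + \int[leb]_(x in `[b, c]) (f x)%:E)%E.
Proof.
move=> ab bc cf.
have [F dF] := continuous_primitive (`|a| + `|c| + 1) cf.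
have dF' x : a <= x <= c -> is_derive x (1 : R) F (f x).
  move=> /andP[ax xc]; apply: dF; have := ler_norm (- a); have := ler_norm c.
  by rewrite normrN; have := normr_ge0 a; have := normr_ge0 c; lra.
have F2 x y : a <= x -> x <= y -> y <= c ->
    (\int[leb]_(z in `[x, y]) (f z)%:E = (F y - F x)%:E)%E.
  by move=> ? ? ?; apply: FTC2_is_derive => // z /andP[? ?]; apply: dF'; lra.
by rewrite !F2 -?EFinD ?lexx//; [congr EFin; ring|exact: le_trans bc].
Qed.

Section hemisphere.
Variables (K : R) (m : R3 R -> R).
Hypothesis mK : blip S K m.

Let r0 : 0 < r. Proof. exact: sphere_radius_gt0. Qed.

(* The hemispheres y > 0 and y < 0 as graphs over the disc of radius r in the
   plane of the coordinates x and z; Num.sqrt vanishes outside the disc. *)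
Definition height (u v : R) : R := Num.sqrt (r ^+ 2 - u ^+ 2 - v ^+ 2).

(** On these graphs the area is (r / height) du dv, so y^2 f times the area is r times the slice:
    the weight y^2 removes the singularity of the density at the rim of the disc. *)
Definition slice (f : R3 R -> R) (e u v : R) : R :=
  height u v * f (u, e * height u v, v).

Lemma heightC u v : height u v = height v u.
Proof. by rewrite /height; congr Num.sqrt; ring. Qed.

Lemma slice_swap e u v : slice (m \o swap13) e u v = slice m e v u.
Proof. by rewrite /slice /swap13 /= heightC. Qed.

Let disc : set (R * R) := [set p | 0 <= r ^+ 2 - p.1 ^+ 2 - p.2 ^+ 2].

Lemma slice_out e u v : r ^+ 2 - u ^+ 2 - v ^+ 2 <= 0 -> slice m e u v = 0.
Proof. by move=> h; rewrite /slice /height ler0_sqrtr// mul0r. Qed.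

Lemma height_sphere e u v : e ^+ 2 = 1 -> 0 <= r ^+ 2 - u ^+ 2 - v ^+ 2 ->
  S (u, e * height u v, v).
Proof.
move=> e1 h; apply/(sphereP n0); rewrite /dot /=.
have := sqr_sqrtr h; rewrite -/(height u v) -/r => {}h.
transitivity (u ^+ 2 + e ^+ 2 * (height u v) ^+ 2 + v ^+ 2); first ring.
by rewrite e1 h; ring.
Qed.

Lemma measurable_slice e : e ^+ 2 = 1 ->
  measurable_fun setT (fun p : R * R => slice m e p.1 p.2).
Proof.
move=> e1.
have mq0 : measurable_fun setT (fun p : R * R => r ^+ 2 - p.1 ^+ 2 - p.2 ^+ 2).
  by apply: measurable_funB; [apply: measurable_funB|]; rewrite ?measurable_funX//;
    apply: measurable_funX.
have mq : measurable_fun setT (fun p : R * R => height p.1 p.2).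
  have ms : measurable_fun setT (@Num.sqrt R).
    by apply: continuous_measurable_fun; exact: sqrt_continuous.
  exact: (measurableT_comp ms mq0).
have mdisc : measurable disc.
  rewrite (_ : disc = (fun p : R * R => r ^+ 2 - p.1 ^+ 2 - p.2 ^+ 2) @^-1` `[0, +oo[).
    by rewrite -[X in measurable X]setTI; apply: mq0.
  by apply/seteqP; split=> p; rewrite /disc /= in_itv /= andbT.
have md : measurable_fun disc (fun p : R * R => slice m e p.1 p.2).
  rewrite /slice; apply: measurable_funM; first exact: measurable_funTS.
  pose G (p : R * R) : R3 R := (p.1, e * height p.1 p.2, p.2).
  have mG : measurable_fun disc G.
    apply: measurable_funTS; apply: measurable_fun_pair => //.
    by apply: measurable_fun_pair => //; exact: measurable_funM.
  apply: (measurable_comp (measurable_sphere n) _ _ mG).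
  - by move=> _ [p dp <-]; exact: height_sphere.
  - exact: (blip_measurable n0 mK).
rewrite (_ : (fun p => _) = (fun p : R * R => slice m e p.1 p.2) \_ disc).
  exact: ((measurable_restrictT _ mdisc).1 md).
apply/funext => p; rewrite patchE; case: ifPn => //.
rewrite notin_setE /disc /= => /negP; rewrite -ltNge => /ltW.
exact: slice_out.
Qed.

Lemma continuous_slice e v : e ^+ 2 = 1 -> `|v| <= r ->
  continuous (fun u => slice m e u v).
Proof.
move=> e1 vr; have v2 : 0 <= r ^+ 2 - v ^+ 2.
  rewrite subr_ge0 -(real_normK (num_real v)) ler_pXn2r// nnegrE//.
  exact: ltW.
pose s := Num.sqrt (r ^+ 2 - v ^+ 2).
have s0 : 0 <= s by exact: sqrtr_ge0.
have s2 : s ^+ 2 = r ^+ 2 - v ^+ 2 by exact: sqr_sqrtr.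
(* Clamping [u] to [-s, s] keeps the point on the sphere, where [m] is Lipschitz; outside this
   interval [height] vanishes, so the slice is unchanged. *)
pose c u : R^o := Num.max (- s) (Num.min u s).
have cc : continuous c.
  move=> u; apply: (@continuous_max _ _ (fun=> - s) (fun u => Num.min u s)).
    exact: cst_continuous.
  by apply: (@continuous_min _ _ id (fun=> s)); [exact: cvg_id|exact: cst_continuous].
have cs u : 0 <= r ^+ 2 - c u ^+ 2 - v ^+ 2.
  suff : c u ^+ 2 <= s ^+ 2 by rewrite s2; lra.
  rewrite -(real_normK (num_real (c u))) ler_pXn2r// ?nnegrE// ler_norml.
  by rewrite /c le_max lexx /= ge_max ge_min lexx orbT andbT; lra.
have ch (f : R -> R) : continuous f -> continuous (fun u => height (f u) v).
  move=> cf u; apply: (@continuous_comp _ _ _ (fun u => r ^+ 2 - f u ^+ 2 - v ^+ 2) Num.sqrt).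
    apply: cvgB; last exact: cvg_cst.
    apply: cvgB; first exact: cvg_cst.
    by apply: (@continuousM _ _ f f); exact: cf.
  exact: sqrt_continuous.
have -> : (fun u => slice m e u v) =
    (fun u => height u v * (m \o (fun u => (c u, e * height (c u) v, v))) u).
  apply/funext => u; rewrite /slice /=.
  have [us|us] := leP (u ^+ 2) (s ^+ 2).
    have : `|u| <= s by rewrite -(@ler_pXn2r _ 2)// ?nnegrE// real_normK ?num_real.
    rewrite ler_norml => /andP[us1 us2].
    by rewrite /c (min_idPl us2) (max_idPr us1).
  by rewrite {1 3}/height ler0_sqrtr ?mul0r//; lra.
move=> u; apply: (@continuousM _ _ (height^~ v)).
  by apply: (ch id) => ?; exact: cvg_id.
apply: (blip_continuous_comp mK) => /=.
- by move=> w; exact: height_sphere.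
- exact: cc.
- by apply: (@continuousM _ _ (fun=> e)); [exact: cst_continuous|exact: ch].
- exact: cst_continuous.
Qed.

Hypothesis m0 : forall x, S x -> 0 <= m x.

Lemma slice_ge0 e u v : e ^+ 2 = 1 -> 0 <= slice m e u v.
Proof.
move=> e1; have [h|h] := leP 0 (r ^+ 2 - u ^+ 2 - v ^+ 2).
  by rewrite mulr_ge0 ?sqrtr_ge0// m0//; exact: height_sphere.
by rewrite slice_out// ltW.
Qed.

Definition slices u v := slice m 1 u v + slice m (- 1) u v.

Lemma slices_ge0 u v : 0 <= slices u v.
Proof. by rewrite addr_ge0// slice_ge0// ?expr1n// sqrrN expr1n. Qed.

Lemma continuous_slices v : `|v| <= r -> continuous (slices^~ v).
Proof.
move=> vr u; apply: cvgD; apply: continuous_slice => //; rewrite ?expr1n//.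
by rewrite sqrrN expr1n.
Qed.

(** The substitution x = s cos u is made on each of the half-turns where y = s sin u has a constant
    sign. Of the two factors |y|, one is [height] and the other is the derivative of s cos u up to
    sign. *)
Lemma integral_parallel (s v : R) : 0 <= s -> s ^+ 2 + v ^+ 2 = r ^+ 2 ->
  (\int[leb]_(u in `[0%R, (2 * pi)%R])
     ((s * sin u) ^+ 2 * m (s * cos u, s * sin u, v))%:E =
   \int[leb]_(u in `[(- r)%R, r]) (slices u v)%:E)%E.
Proof.
move=> s0 sv; have pi0 := pi_gt0 R.
have sr : s <= r.
  by rewrite -(@ler_pXn2r _ 2)// ?nnegrE// ?(ltW r0)//; have := sqr_ge0 v; lra.
have vr : `|v| <= r.
  rewrite -(@ler_pXn2r _ 2)// ?nnegrE// ?(ltW r0)// real_normK ?num_real//.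
  by have := sqr_ge0 s; lra.
have e1 : (1 : R) ^+ 2 = 1 by rewrite expr1n.
have eN1 : (- 1 : R) ^+ 2 = 1 by rewrite sqrrN expr1n.
have cp := continuous_slice e1 vr; have cn := continuous_slice eN1 vr.
have [Fp dFp] := continuous_primitive (r + 1) cp.
have [Fn dFn] := continuous_primitive (r + 1) cn.
(* Between [s] and [r] the slice vanishes, so the increments over [-r, r] and over [-s, s] agree. *)
have Ftail e F : (forall x, - (r + 1) < x < r + 1 ->
    is_derive x (1 : R) F (slice m e x v)) -> F r - F (- r) = F s - F (- s).
  move=> dF.
  have tail a b : a <= b -> - r <= a -> b <= r ->
      (forall x, a <= x <= b -> s ^+ 2 <= x ^+ 2) -> F a = F b.
    move=> ab ra br sx.
    have [||c] := @MVT_segment R F (fun x => slice m e x v) a b ab.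
    - by move=> x; rewrite in_itv/= => /andP[? ?]; apply: dF; lra.
    - apply: derivable_within_continuous => x; rewrite in_itv/= => /andP[? ?].
      by have [] : is_derive x (1 : R) F (slice m e x v) by apply: dF; lra.
    - rewrite in_itv/= => acb; rewrite slice_out ?mul0r; last first.
        by have := sx _ acb; lra.
      by move/eqP; rewrite subr_eq0 => /eqP.
  rewrite (tail s r)// 1?(tail (- r) (- s))//; try lra.
  - by move=> x /andP[? ?]; nra.
  - by move=> x /andP[? ?]; nra.
have psiE (u : R) : is_derive u (1 : R) (fun u => s * cos u) (- (s * sin u)).
  by rewrite -mulrN; apply: is_deriveZ.
have psiB u : - (r + 1) < s * cos u < r + 1.
  have := cos_le1 u; have := cos_geN1 u; nra.
have cpsi : continuous (fun u => - (s * sin u)).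
  move=> u; apply: cvgN; apply: (@continuousM _ _ (fun=> s)).
    exact: cst_continuous.
  exact: continuous_sin.
have hE u : height (s * cos u) v = `|s * sin u|.
  rewrite -sqrtr_sqr /height; congr Num.sqrt.
  have := cos2Dsin2 u => h; rewrite -sv.
  transitivity (s ^+ 2 * (1 - cos u ^+ 2)); first ring.
  by rewrite -h; ring.
rewrite (@integral_itv_split _ 0 pi (2 * pi)); [|lra|lra|]; last first.
  move=> u0; apply: (@continuousM _ _ (fun u => (s * sin u) ^+ 2)
    (m \o fun u => (s * cos u, s * sin u, v))).
    by apply: (@continuousM _ _ (fun u => s * sin u) (fun u => s * sin u));
      apply: (@continuousM _ _ (fun=> s)); by [exact: cst_continuous|exact: continuous_sin].
  apply: (blip_continuous_comp mK) => /=.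
  - move=> u; apply/(sphereP n0); rewrite /dot /= -/r -sv.
    have := cos2Dsin2 u => h.
    transitivity (s ^+ 2 * (cos u ^+ 2 + sin u ^+ 2) + v ^+ 2); first ring.
    by rewrite h mulr1.
  - by apply: (@continuousM _ _ (fun=> s)); [exact: cst_continuous|exact: continuous_cos].
  - by apply: (@continuousM _ _ (fun=> s)); [exact: cst_continuous|exact: continuous_sin].
  - exact: cst_continuous.
(* On the first half-turn s cos u decreases from s to -s, hence the opposite primitive; on the
   second it increases back. *)
have -> : (\int[leb]_(u in `[0%R, pi])
     ((s * sin u) ^+ 2 * m (s * cos u, s * sin u, v))%:E =
    (- Fp (s * cos pi) - (- Fp (s * cos 0)))%:E)%E.
  have dFN x : - (r + 1) < x < r + 1 ->
      is_derive x (1 : R) (fun x => - Fp x) (- slice m 1 x v).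
    by move=> xB; have := dFp _ xB => ?; apply: is_deriveN.
  have cN : continuous (fun x => - slice m 1 x v).
    by move=> x; apply: cvgN; exact: cp.
  have /= <- := substitution_primitive (ltW pi0) cN cpsi psiE (fun u _ => psiB u) dFN.
  apply: eq_integral => u; rewrite inE/= in_itv/= => u0.
  congr EFin; rewrite /slice hE ger0_norm ?mulr_ge0 ?sin_ge0_pi// mul1r.
  by ring.
have -> : (\int[leb]_(u in `[pi, (2 * pi)%R])
     ((s * sin u) ^+ 2 * m (s * cos u, s * sin u, v))%:E =
    (Fn (s * cos (2 * pi)) - Fn (s * cos pi))%:E)%E.
  have pi2 : (pi : R) <= 2 * pi by lra.
  have /= <- := substitution_primitive pi2 cn cpsi psiE (fun u _ => psiB u) dFn.
  apply: eq_integral => u; rewrite inE/= in_itv/= => /andP[u1 u2].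
  have su : s * sin u <= 0.
    rewrite -oppr_ge0 -mulrN mulr_ge0//.
    have -> : - sin u = sin (u - pi) by rewrite sinB cospi sinpi; ring.
    by apply: sin_ge0_pi; lra.
  congr EFin; rewrite /slice hE ler0_norm// mulrNN mul1r.
  by ring.
have dFpn x : - r <= x <= r -> is_derive x (1 : R) (fun x => Fp x + Fn x) (slices x v).
  move=> xr; have hB : - (r + 1) < x < r + 1 by lra.
  by have := dFp _ hB; have := dFn _ hB => ? ?; apply: is_deriveD.
have rr : - r <= r by lra.
rewrite -EFinD (FTC2_is_derive rr dFpn (continuous_slices vr)).
congr EFin; have hp := Ftail _ _ dFp; have hn := Ftail _ _ dFn.
rewrite cos0 cospi (_ : cos (2 * pi) = 1); last by rewrite mulr_natl cos2pi.
by rewrite !mulr1 !mulrN1; lra.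
Qed.

End hemisphere.

End swap.

Lemma normr_maxB {R : realDomainType} (a b c : R) :
  `|Num.max a c - Num.max b c| <= `|a - b|.
Proof.
have := ler_norm (a - b); have := ler_norm (b - a); rewrite (distrC b a).
by case: (leP a c) => ?; case: (leP b c) => ? ? ?; rewrite ler_norml;
  apply/andP; split; lra.
Qed.

(** The map sending z to 1 / max (z, c) is bounded by 1 / c and Lipschitz with constant 1 / c^2; the
    sum of the two serves as the single constant. *)
Lemma bl_invmax {R : realType} (c : R) (A : set (R3 R)) (T : Type) (D : set T) (f : T -> R3 R -> R) :
  0 < c -> bl A D f -> bl A D (fun i x => (Num.max (f i x) c)^-1).
Proof.
move=> c0; pose h (z : R) := (Num.max z c)^-1.
apply: (@bl_comp _ _ _ D (fun=> h) f (c^-1 + c^-1 ^+ 2)).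
- move=> i x _ _; rewrite /h ger0_norm; last first.
    by rewrite invr_ge0 le_max (ltW c0) orbT.
  rewrite (@le_trans _ _ c^-1)// ?lerDl ?sqr_ge0//.
  by rewrite lef_pV2 ?posrE ?le_max ?lexx ?orbT// lt_max c0 orbT.
- move=> i x y _ _ _; rewrite /h; set a := f i x; set b := f i y.
  have pa : 0 < Num.max a c by rewrite lt_max c0 orbT.
  have pb : 0 < Num.max b c by rewrite lt_max c0 orbT.
  have -> : (Num.max a c)^-1 - (Num.max b c)^-1 =
      (Num.max b c - Num.max a c) * ((Num.max a c)^-1 * (Num.max b c)^-1).
    by field; rewrite !gt_eqF.
  rewrite normrM mulrC ler_pM//.
    rewrite ger0_norm ?mulr_ge0 ?invr_ge0 ?(ltW pa) ?(ltW pb)//.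
    rewrite (@le_trans _ _ (c^-1 ^+ 2)) ?lerDr ?invr_ge0 ?(ltW c0)//.
    by rewrite expr2 ler_pM ?invr_ge0 ?(ltW pa) ?(ltW pb)// lef_pV2 ?posrE// le_max lexx orbT.
  by rewrite distrC; exact: normr_maxB.
Qed.

Lemma lebesgue_fubini_tonelli {R : realType} (I J : interval R) (f : R -> R -> R) :
  measurable_fun setT (fun p : R * R => f p.1 p.2) ->
  (forall x y, x \in I -> y \in J -> 0 <= f x y) ->
  (\int[@lebesgue_measure R]_(x in [set` I]) \int[@lebesgue_measure R]_(y in [set` J])
     (f x y)%:E =
   \int[@lebesgue_measure R]_(y in [set` J]) \int[@lebesgue_measure R]_(x in [set` I])
     (f x y)%:E)%E.
Proof.
move=> mf f0.
apply: (@fubini_tonelli_rectangleC _ _ _ _ R (@lebesgue_measure R)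
  (@lebesgue_measure R) [set` I] [set` J] (fun p => (f p.1 p.2)%:E)) => //.
- by apply/measurable_EFinP; apply: measurable_funTS.
- by move=> p [/= ? ?]; rewrite lee_fin f0.
Qed.

Section swap_invariance.
Context {R : realType} (n : nat) (n0 : (0 < n)%N).
Let r : R := sphere_radius n.
Let S : set (R3 R) := sphere n.
Let sph : R * R -> R3 R := spherical_coord n.
Notation leb := (@lebesgue_measure R).

Let r0 : 0 < r. Proof. exact: sphere_radius_gt0. Qed.

Section square_weight.
Variables (K : R) (m : R3 R -> R).
Hypotheses (mK : blip S K m) (m0 : forall x, S x -> 0 <= m x).

Let e1 : (1 : R) ^+ 2 = 1. Proof. by rewrite expr1n. Qed.
Let eN1 : (- 1 : R) ^+ 2 = 1. Proof. by rewrite sqrrN expr1n. Qed.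

Lemma measurable_slices :
  measurable_fun setT (fun p : R * R => slices n m p.1 p.2).
Proof. by apply: measurable_funD; apply: (measurable_slice n0 mK). Qed.

(** [integral_parallel] replaces the azimuth by x on each parallel; once the integrals are
    exchanged, v = r cos t replaces the polar angle. In the result x and v play symmetric roles,
    which makes the exchange of coordinates an instance of Tonelli's theorem. *)
Lemma sphere_integral_square_weight : measurable_fun S m ->
  (\int[surface_area n]_(x in S) (x.1.2 ^+ 2 * m x)%:E =
   \int[leb]_(x in `[(- r)%R, r]) \int[leb]_(v in `[(- r)%R, r])
     (r * slices n m x v)%:E)%E.
Proof.
move=> mm; have pi0 := pi_gt0 R.
rewrite (@sphere_integral_iterated _ _ n0 (fun x => x.1.2 ^+ 2 * m x)); last 2 first.
- apply: measurable_funM => //; apply: measurable_funTS; apply: measurable_funX.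
  exact: measurableT_comp.
- by move=> x Sx; rewrite mulr_ge0 ?sqr_ge0 ?m0.
transitivity (\int[leb]_(t in `[0%R, pi]) \int[leb]_(x in `[(- r)%R, r])
    (slices n m x (r * cos t) * (r ^+ 2 * sin t))%:E)%E.
  apply: eq_integral => t; rewrite inE/= in_itv/= => t0.
  have st := sin_ge0_pi t0.
  have a0 : 0 <= r ^+ 2 * sin t by rewrite mulr_ge0 ?sqr_ge0.
  transitivity (\int[leb]_(u in `[0%R, (2 * pi)%R])
    (((r * (sin t * sin u)) ^+ 2 * m (sph (t, u)))%:E * (r ^+ 2 * sin t)%:E))%E.
    by apply: eq_integral => u _; rewrite -EFinM.
  under [RHS]eq_integral do rewrite EFinM.
  have ct := continuous_sph2 n0 (t := t) mK.
  have rt : `|r * cos t| <= r.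
    by rewrite normrM (ger0_norm (ltW r0)) ler_piMr ?(ltW r0) ?le_normr_cos.
  have cg : continuous (fun u : R => (r * (sin t * sin u)) ^+ 2 * m (sph (t, u))).
    have c1 : continuous (fun u : R => r * (sin t * sin u)).
      move=> u; apply: (@continuousM _ _ (fun=> r) (fun u => sin t * sin u)).
        exact: cst_continuous.
      apply: (@continuousM _ _ (fun=> sin t) sin); first exact: cst_continuous.
      exact: continuous_sin.
    move=> u; apply: (@continuousM _ _ (fun u : R => (r * (sin t * sin u)) ^+ 2)
      (fun u : R => m (sph (t, u)))); last exact: ct.
    exact: (@continuousM _ _ (fun u : R => r * (sin t * sin u)) (fun u : R => r * (sin t * sin u)) _ (c1 u) (c1 u)).
  rewrite [LHS]ge0_integralZr//; last 2 first.
  - apply/measurable_EFinP; apply: measurable_funTS.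
    exact: (continuous_measurable_fun cg).
  - move=> u _; rewrite lee_fin mulr_ge0 ?sqr_ge0 ?m0//.
    exact: spherical_coord_sphere.
  rewrite [RHS]ge0_integralZr//; last 2 first.
  - apply/measurable_EFinP; apply: measurable_funTS.
    exact: (continuous_measurable_fun (continuous_slices n0 mK rt)).
  - by move=> u _; rewrite lee_fin; exact: slices_ge0.
  congr (_ * _)%E; rewrite -(integral_parallel n0 mK (s := r * sin t)).
  - apply: eq_integral => u _; congr EFin.
    by rewrite /sph /spherical_coord /= -/r !mulrA.
  - by rewrite mulr_ge0 ?(ltW r0).
  - have := cos2Dsin2 t => h; rewrite -/r.
    transitivity (r ^+ 2 * (cos t ^+ 2 + sin t ^+ 2)); first ring.
    by rewrite h mulr1.
rewrite (@lebesgue_fubini_tonelli R `[0%R, pi] `[(- r)%R, r]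
  (fun t x => slices n m x (r * cos t) * (r ^+ 2 * sin t))); last 2 first.
- apply: measurable_funM.
    have mG : measurable_fun setT (fun p : R * R => (p.2, r * cos p.1)).
      apply: measurable_fun_pair => //; apply: measurable_funM => //.
      apply: measurableT_comp => //.
      by apply: continuous_measurable_fun; exact: continuous_cos.
    exact: (measurableT_comp measurable_slices mG).
  apply: measurable_funM => //; apply: measurableT_comp => //.
  by apply: continuous_measurable_fun; exact: continuous_sin.
- move=> t x; rewrite in_itv/= => /sin_ge0_pi st _.
  rewrite mulr_ge0//; first exact: slices_ge0.
  by rewrite mulr_ge0 ?sqr_ge0.
apply: eq_integral => x; rewrite inE/= in_itv/= => xr.
have rx : `|x| <= r by rewrite ler_norml.
(* [continuous_slices] concerns the first argument; exchanging the coordinates transfers it to the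
   second. *)
have cx : continuous (fun v => r * slices n m x v).
  have -> : slices n m x = (slices n (m \o swap13))^~ x.
    by apply/funext => v; rewrite /slices !slice_swap.
  move=> v; apply: (@continuousM _ _ (fun=> r) (fun v => slices n (m \o swap13) v x)).
    exact: cst_continuous.
  exact: (continuous_slices n0 (blip_swap13 mK)).
have cxN : continuous (fun v => - (r * slices n m x v)).
  by move=> v; apply: cvgN; exact: cx.
have [F dF] := continuous_primitive (r + 1) cx.
have dFN v : - (r + 1) < v < r + 1 ->
    is_derive v (1 : R) (fun x => - F x) (- (r * slices n m x v)).
  by move=> vB; have := dF _ vB => ?; apply: is_deriveN.
have psiE (t : R) : is_derive t (1 : R) (fun t => r * cos t) (- (r * sin t)).
  by rewrite -mulrN; apply: is_deriveZ.
have psiB (t : R) : - (r + 1) < r * cos t < r + 1.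
  by have := cos_le1 t; have := cos_geN1 t; have := r0; nra.
have cpsi : continuous (fun t => - (r * sin t)).
  move=> t; apply: cvgN; apply: (@continuousM _ _ (fun=> r) sin).
    exact: cst_continuous.
  exact: continuous_sin.
transitivity (F r - F (- r))%:E.
  have := substitution_primitive (ltW pi0) cxN cpsi psiE (fun t _ => psiB t) dFN.
  rewrite /= cos0 cospi mulr1 mulrN1 opprK addrC => <-.
  by apply: eq_integral => t _; congr EFin; ring.
have rr : - r <= r by have := r0; lra.
have dF' v : - r <= v <= r -> is_derive v (1 : R) F (r * slices n m x v).
  by move=> vr; apply: dF; lra.
by rewrite (FTC2_is_derive rr dF' cx).
Qed.

End square_weight.

Lemma swap13_square_weight K (m : R3 R -> R) : blip S K m ->
  (forall x, S x -> 0 <= m x) ->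
  (\int[surface_area n]_(x in S) (x.1.2 ^+ 2 * m (swap13 x))%:E =
   \int[surface_area n]_(x in S) (x.1.2 ^+ 2 * m x)%:E)%E.
Proof.
move=> mK m0; have mK' := blip_swap13 mK.
have m0' x : S x -> 0 <= (m \o swap13) x by move=> Sx; apply: m0; exact: swap13_sphere.
rewrite (sphere_integral_square_weight mK m0 (blip_measurable n0 mK)).
rewrite (sphere_integral_square_weight mK' m0' (blip_measurable n0 mK')).
rewrite (@lebesgue_fubini_tonelli R `[(- r)%R, r] `[(- r)%R, r]
  (fun x v => r * slices n (m \o swap13) x v)); last 2 first.
- apply: measurable_funM => //; exact: (measurable_slices mK').
- by move=> x v _ _; rewrite mulr_ge0 ?(ltW r0)//; exact: slices_ge0.
apply: eq_integral => x _; apply: eq_integral => v _ /=.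
by rewrite /slices !slice_swap.
Qed.

(* The great circle y = 0 meets each parallel at finitely many azimuths. *)
Lemma surface_area_equator : surface_area n (S `&` [set x | x.1.2 = 0]) = 0%E.
Proof.
set N := [set x : R3 R | x.1.2 = 0]; have pi0 := pi_gt0 R.
have mN : measurable N.
  have m12 : measurable_fun setT (fun x : R3 R => x.1.2) by exact: measurableT_comp.
  rewrite (_ : N = (fun x : R3 R => x.1.2) @^-1` [set 0])//.
  by rewrite -[X in measurable X]setTI; apply: m12.
have mS := measurable_sphere (R := R) n.
rewrite setIC -(integral_indic (surface_area n) mS)//.
rewrite (@sphere_integral_iterated _ _ n0 (\1_N)); last 2 first.
- by apply: measurable_funTS; exact: measurable_indic.
- by move=> x _; rewrite indicE.
apply: integral0_eq => t; rewrite /= in_itv/= => t0.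
have [st|st] := eqVneq (sin t) 0.
  by apply: integral0_eq => u _; rewrite /area_element /= st !mulr0.
pose F : set R := [set 0] `|` [set pi] `|` [set 2 * pi].
have mF : measurable F by rewrite /F; apply: measurableU => //; exact: measurableU.
rewrite (@ge0_negligible_integral _ _ _ leb _ F)//.
- apply: integral0_eq => u [/=]; rewrite in_itv/= => /andP[u0 u2] uF.
  rewrite indicE memNset ?mul0r// /N /= => /eqP; apply/negP.
  apply: mulf_neq0; first by rewrite (gt_eqF r0).
  apply: mulf_neq0 => //.
  have [u1|u1] := ltP u pi.
    rewrite gt_eqF// sin_gt0_pi// u1 andbT lt_neqAle u0 andbT.
    by apply/eqP => u0'; apply: uF; left; left; rewrite /= u0'.
  rewrite -oppr_eq0 gt_eqF//.
  have -> : - sin u = sin (u - pi) by rewrite sinB cospi sinpi; ring.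
  have u3 : u != pi by apply/eqP => u0'; apply: uF; left; right.
  have u4 : u != 2 * pi by apply/eqP => u0'; apply: uF; right.
  have : pi < u by rewrite lt_neqAle eq_sym u3.
  have : u < 2 * pi by rewrite lt_neqAle u4.
  by move=> ? ?; apply: sin_gt0_pi; lra.
- rewrite /area_element /=; apply/measurable_EFinP.
  apply: measurable_funM; last exact: measurable_cst.
  have mG : measurable_fun setT (fun u : R => sph (t, u)).
    by apply: measurableT_comp; first exact: measurable_spherical_coord.
  apply: measurable_funTS.
  by apply: (measurableT_comp _ mG); exact: measurable_indic.
- move=> u uI; rewrite lee_fin mulr_ge0 ?indicE//.
  by apply: area_element_ge0; split=> //=; rewrite in_itv.
- apply/countable_lebesgue_measure0/finite_set_countable.
  by rewrite /F !finite_setU; split; [split|]; exact: finite_set1.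
Qed.

Lemma sphere_integral_off_equator (g : R3 R -> R) : measurable_fun S g ->
  (forall x, S x -> 0 <= g x) ->
  (\int[surface_area n]_(x in S) (g x)%:E =
   \int[surface_area n]_(x in S) (g x * (x.1.2 != 0)%:R)%:E)%E.
Proof.
move=> mg g0; have mS := measurable_sphere (R := R) n.
have m12 : measurable_fun setT (fun x : R3 R => x.1.2) by exact: measurableT_comp.
have mN : measurable (S `&` [set x : R3 R | x.1.2 = 0]).
  apply: measurableI => //.
  rewrite (_ : [set x | _] = (fun x : R3 R => x.1.2) @^-1` [set 0])//.
  by rewrite -[X in measurable X]setTI; apply: m12.
have mc : measurable_fun S (fun x : R3 R => (x.1.2 != 0)%:R : R).
  rewrite (_ : (fun x => _) = \1_(~` [set x : R3 R | x.1.2 = 0])).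
    apply: measurable_indic; apply: measurableC.
    rewrite (_ : [set x | _] = (fun x : R3 R => x.1.2) @^-1` [set 0])//.
    by rewrite -[X in measurable X]setTI; apply: m12.
  apply/funext => x; rewrite indicE; congr (_%:R); congr nat_of_bool.
  by apply/idP/idP; rewrite ?inE => /eqP.
rewrite (ge0_negligible_integral mN mS _ _ surface_area_equator)//; last first.
  exact/measurable_EFinP.
rewrite [RHS](ge0_negligible_integral mN mS _ _ surface_area_equator)//; last 2 first.
- by apply/measurable_EFinP; exact: measurable_funM.
- by move=> x Sx; rewrite lee_fin mulr_ge0// g0.
apply: eq_integral => x; rewrite inE => -[Sx xN].
suff -> : x.1.2 != 0 by rewrite mulr1.
by apply/eqP => x0; apply: xN.
Qed.

(** The square weight is divided out: with m_k = g / max (y^2, 1 / (k + 1)), which is bounded and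
    Lipschitz, y^2 m_k increases to g off the equator, a null set. The exchange leaves y, hence the
    denominator, unchanged. *)
Lemma swap13_integral K g : blip S K g -> (forall x, S x -> 0 <= g x) ->
  (\int[surface_area n]_(x in S) (g (swap13 x))%:E =
   \int[surface_area n]_(x in S) (g x)%:E)%E.
Proof.
move=> gK g0; have mS := measurable_sphere (R := R) n.
pose e (k : nat) : R := k.+1%:R^-1.
have e0 k : 0 < e k by rewrite invr_gt0 ltr0n.
pose c k (x : R3 R) := Num.max (x.1.2 ^+ 2) (e k).
have c0 k x : 0 < c k x by rewrite lt_max e0 orbT.
pose m k (x : R3 R) := g x / c k x.
have xr x : S x -> `|x.1.2| <= r by move=> xr; have [_ + _] := enorm_ge_coord x; rewrite (xr : enorm x = r).
have coord2 : bl S setT (fun (_ : unit) (x : R3 R) => x.1.2).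
  exists (r + 1); first by rewrite addr_ge0 ?(ltW r0).
  move=> _ _; split=> [x Sx|x y Sx Sy]; first by rewrite (le_trans (xr _ Sx))// lerDl.
  have [_ /= + _] := enorm_ge_coord (x - y) => /le_trans; apply.
  by rewrite ler_peMl ?enorm_ge0// lerDr (ltW r0).
have mbl k : bl S setT (fun _ : unit => m k).
  apply: blM; first by exists `|K| => // _ _; apply: blipW gK; exact: ler_norm.
  by apply: (bl_invmax (e0 k)); apply: blM.
have lim_ (f : R3 R -> R) : measurable_fun S f -> (forall x, S x -> 0 <= f x) ->
    (forall k, exists M, blip S M (fun x => f x / c k x)) ->
    (\int[surface_area n]_(x in S) (x.1.2 ^+ 2 * (f x / c k x))%:E @[k --> \oo] -->
     \int[surface_area n]_(x in S) (f x)%:E)%E.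
  move=> mf f0 fc; rewrite sphere_integral_off_equator//.
  have ml k : measurable_fun S (fun x => x.1.2 ^+ 2 * (f x / c k x)).
    have m2 : measurable_fun S (fun x : R3 R => x.1.2 ^+ 2).
      by apply: measurable_funX; apply: measurable_funTS; exact: measurableT_comp.
    apply: measurable_funM => //.
    by have [M hM] := fc k; exact: (blip_measurable n0 hM).
  have fE k x : x.1.2 ^+ 2 * (f x / c k x) = f x * (x.1.2 ^+ 2 / c k x) by ring.
  rewrite (@eq_integral _ _ _ _ _ (fun x : R3 R => limn (fun k => (x.1.2 ^+ 2 * (f x / c k x))%:E))).
    apply: cvg_monotone_convergence => //.
    - by move=> k; exact/measurable_EFinP.
    - by move=> k x Sx; rewrite lee_fin mulr_ge0 ?sqr_ge0// divr_ge0 ?f0// ltW.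
    - move=> x Sx j k jk; rewrite lee_fin !fE ler_wpM2l ?f0// ler_wpM2l ?sqr_ge0//.
      rewrite lef_pV2 ?posrE// /c ge_max !le_max lexx /=; apply/orP; right.
      by rewrite /e lef_pV2 ?posrE ?ltr0n// ler_nat.
  move=> x _; apply/esym/cvg_lim => //.
  have [x0|x0] := eqVneq x.1.2 0.
    rewrite mulr0 (_ : (fun _ => _) = cst 0%E); first exact: cvg_cst.
    by apply/funext => k; rewrite x0 expr0n mul0r.
  rewrite mulr1; apply: cvg_near_cst.
  have x2 : 0 < x.1.2 ^+ 2 by rewrite exprn_even_gt0.
  have [k0 _ hk] : \forall k \near \oo, e k < x.1.2 ^+ 2.
    by apply: (cvgr_lt _ (@cvg_harmonic R)).
  exists k0 => // k /= k0k; congr EFin; rewrite fE /c.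
  rewrite (max_idPl _); last by apply: ltW; exact: hk.
  by rewrite divff ?mulr1// gt_eqF.
have g0' x : S x -> 0 <= (g \o swap13) x by move=> Sx; apply: g0; exact: swap13_sphere.
have gK' := blip_swap13 gK.
have mg k : exists M, blip S M (m k) by have [M _ /(_ tt I)] := mbl k; exists M.
have h1 := lim_ g (blip_measurable n0 gK) g0 mg.
have h2 := lim_ _ (blip_measurable n0 gK') g0' _.
rewrite -(cvg_lim _ h1)// -(cvg_lim _ (h2 _))//.
  congr (limn _); apply/funext => k.
  have [M hM] := mg k; rewrite -(swap13_square_weight hM)//.
  by move=> x Sx; rewrite divr_ge0 ?g0// ltW.
by move=> k; have [M hM] := mg k; exists M; exact: (blip_swap13 hM).
Qed.

End swap_invariance.

Section sphere_integral.
Context {R : realType} (n : nat) (n0 : (0 < n)%N).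
Let r : R := sphere_radius n.
Let S : set (R3 R) := sphere n.
Notation leb := (@lebesgue_measure R).

Definition sphere_integral (g : R3 R -> R) : R :=
  (\int[surface_area n]_(x in S) g x)%R.

Notation SI := sphere_integral.

Lemma surface_area_sphere_fin : (surface_area n S < +oo)%E.
Proof.
have mS := measurable_sphere (R := R) n.
have -> : surface_area n S = (\int[surface_area n]_(x in S) (cst (1 : R) x)%:E)%E.
  by rewrite -[LHS]mul1e -integral_cst.
rewrite (@sphere_integral_iterated _ _ n0 (cst 1))//.
have pi0 := pi_gt0 R.
rewrite [X in (X < _)%E](_ : _ =
    (\int[leb]_(t in `[0%R, pi]) (2 * pi * (r ^+ 2 * sin t))%:E)%E); last first.
  apply: eq_integral => t _; rewrite /area_element /=.
  under eq_integral do rewrite mul1r.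
  rewrite integral_cst//= lebesgue_measure_itv/= lte_fin ifT ?mulr_gt0//.
  by rewrite -EFinB subr0 -EFinM mulrC.
have dc (t : R) : is_derive t (1 : R) (fun t => - (2 * pi * r ^+ 2 * cos t)) (2 * pi * (r ^+ 2 * sin t)).
  have := is_deriveN (is_deriveZ (2 * pi * r ^+ 2) (is_derive_cos t)).
  by rewrite /GRing.scale /= mulrN opprK mulrA.
have cs : continuous (fun t : R => 2 * pi * (r ^+ 2 * sin t)).
  move=> t; apply: (@continuousM _ _ (fun=> 2 * pi) (fun t => r ^+ 2 * sin t)).
    exact: cst_continuous.
  apply: (@continuousM _ _ (fun=> r ^+ 2) sin); first exact: cst_continuous.
  exact: continuous_sin.
by rewrite (FTC2_is_derive (ltW pi0) (fun t _ => dc t) cs) ltry.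
Qed.

Let A : R := fine (surface_area n S).

Lemma sphere_area_ge0 : 0 <= A.
Proof. by rewrite fine_ge0. Qed.

Lemma blip_integrable K f : blip S K f ->
  (surface_area n).-integrable S (EFin \o f).
Proof.
move=> fK; apply: measurable_bounded_integrable.
- exact: measurable_sphere.
- exact: surface_area_sphere_fin.
- exact: (blip_measurable n0 fK).
- exists K; split; first exact: num_real.
  by move=> M KM x Sx /=; apply: le_trans (fK.1 _ Sx) (ltW KM).
Qed.

Lemma bl_integrable f : bl S setT (fun _ : unit => f) ->
  (surface_area n).-integrable S (EFin \o f).
Proof. by move=> [K _ /(_ tt I)]; exact: blip_integrable. Qed.

Lemma sphere_integral_EFin f : bl S setT (fun _ : unit => f) ->
  (\int[surface_area n]_(x in S) (f x)%:E = (SI f)%:E)%E.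
Proof.
move=> bf; rewrite /SI /Rintegral fineK//.
by apply: (integrable_fin_num (measurable_sphere n)); exact: bl_integrable.
Qed.

Lemma sphere_integralD f g : bl S setT (fun _ : unit => f) ->
  bl S setT (fun _ : unit => g) -> SI (fun x => f x + g x) = SI f + SI g.
Proof.
by move=> bf bg; apply: RintegralD;
  [exact: measurable_sphere|exact: bl_integrable|exact: bl_integrable].
Qed.

Lemma sphere_integralB f g : bl S setT (fun _ : unit => f) ->
  bl S setT (fun _ : unit => g) -> SI (fun x => f x - g x) = SI f - SI g.
Proof.
by move=> bf bg; apply: RintegralB;
  [exact: measurable_sphere|exact: bl_integrable|exact: bl_integrable].
Qed.

Lemma sphere_integralZ (k : R) f : bl S setT (fun _ : unit => f) ->
  SI (fun x => k * f x) = k * SI f.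
Proof.
by move=> bf; apply: RintegralZl; [exact: measurable_sphere|exact: bl_integrable].
Qed.

Lemma eq_sphere_integral f g : (forall x, S x -> f x = g x) -> SI f = SI g.
Proof. by move=> fg; apply: eq_Rintegral => x; rewrite inE; exact: fg. Qed.

Lemma sphere_integral_bound f M : bl S setT (fun _ : unit => f) ->
  (forall x, S x -> `|f x| <= M) -> `|SI f| <= M * A.
Proof.
move=> bf fM; have mS := measurable_sphere (R := R) n.
have cstI : (surface_area n).-integrable S (EFin \o cst M).
  apply: bl_integrable; exact: (@bl_cst _ _ _ _ (fun=> M) `|M|).
rewrite ler_norml -mulNr; apply/andP; split.
  rewrite -(Rintegral_cst (surface_area n) mS (- M)); apply: le_Rintegral => //.
  - by apply: bl_integrable; apply: (@bl_cst _ _ _ _ (fun=> - M) `|- M|).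
  - exact: bl_integrable.
  - by move=> x /fM; rewrite ler_norml => /andP[].
rewrite -(Rintegral_cst (surface_area n) mS M); apply: le_Rintegral => //.
  exact: bl_integrable.
by move=> x /fM; rewrite ler_norml => /andP[].
Qed.

Lemma sphere_integral_dist f g M : bl S setT (fun _ : unit => f) ->
  bl S setT (fun _ : unit => g) ->
  (forall x, S x -> `|f x - g x| <= M) -> `|SI f - SI g| <= M * A.
Proof.
move=> bf bg fg; rewrite -sphere_integralB//.
by apply: sphere_integral_bound => //; exact: blB.
Qed.

End sphere_integral.

(** * Approximate flows by rotations *)

Section stepper.
Context {R : realType} (n : nat) (n0 : (0 < n)%N).
Let r : R := sphere_radius n.
Let S : set (R3 R) := sphere n.
Notation SI := (@sphere_integral R n).
Let A : R := fine (surface_area n S).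

(* E d approximates the time-d map of the flow of v, a vector field with
   divergence D: no regularity beyond Lipschitz is needed of the test function
   h in the last clause. *)
Definition stepper (v : R3 R -> R3 R) (D : R3 R -> R) (E : R -> R3 R -> R3 R) :=
  exists d0 C : R, [/\ 0 < d0 <= 1, 0 <= C, blip S C D,
    (forall x, S x -> enorm (v x) <= C) /\
    (forall x y, S x -> S y -> enorm (v x - v y) <= C * enorm (x - y)) &
    forall d, `|d| <= d0 ->
    [/\ forall x, S x -> S (E d x),
        forall x y, S x -> S y -> enorm (E d x - E d y) <= C * enorm (x - y),
        forall x, S x -> enorm (E d x - (x + d *: v x)) <= C * d ^+ 2 &
        forall K h, 0 <= K -> blip S K h -> (forall x, S x -> 0 <= h x) ->
          `|SI (h \o E d) - SI h + d * SI (fun x => D x * h x)| <=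
          C * K * d ^+ 2]].

Lemma blip_comp K C h E : 0 <= K -> 0 <= C -> blip S K h ->
  (forall x, S x -> S (E x)) ->
  (forall x y, S x -> S y -> enorm (E x - E y) <= C * enorm (x - y)) ->
  blip S (K * (C + 1)) (h \o E).
Proof.
move=> K0 C0 [hb hl] SE EC; split=> [x Sx|x y Sx Sy] /=.
  by rewrite (le_trans (hb _ (SE _ Sx)))// ler_peMr// lerDr.
rewrite (le_trans (hl _ _ (SE _ Sx) (SE _ Sy)))// -mulrA ler_wpM2l//.
by rewrite (le_trans (EC _ _ Sx Sy))// ler_wpM2r ?enorm_ge0// lerDl.
Qed.

Lemma blip_bl K f : 0 <= K -> blip S K f -> bl S setT (fun _ : unit => f).
Proof. by move=> K0 fK; exists K. Qed.

(** For a test function h, [h \o E1 d] is again bounded and Lipschitz, with a constant uniform in d.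
    The clause on [E2] is applied to it and the clause on [E1] to h, so that the divergences add. *)
Lemma stepper_comp v1 D1 E1 v2 D2 E2 :
  stepper v1 D1 E1 -> stepper v2 D2 E2 ->
  stepper (fun x => v1 x + v2 x) (fun x => D1 x + D2 x) (fun d => E1 d \o E2 d).
Proof.
move=> [d1 [C1 [/andP[d10 d11] C10 DC1 [v1b v1l] H1]]].
move=> [d2 [C2 [/andP[d20 d21] C20 DC2 [v2b v2l] H2]]].
have A0 : 0 <= A by exact: sphere_area_ge0.
(* A sum of the constants required below: C1 + C2 for the fields and divergences, the product C1 C2
   for the Lipschitz bound, then the term for the displacement, and the last three for the
   integrals. *)
pose C := C1 + C2 + C1 * C2 + C1 * (C2 + C2) + C2 * (C1 + 1) + C1 + C2 * (C1 + C1) * A.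
exists (Num.min d1 d2), C.
have p1 : 0 <= C1 * C2 by exact: mulr_ge0.
have p2 : 0 <= C1 * (C2 + C2) by rewrite mulr_ge0// addr_ge0.
have p3 : 0 <= C2 * (C1 + 1) by rewrite mulr_ge0// addr_ge0.
have p4 : 0 <= C2 * (C1 + C1) * A by rewrite !mulr_ge0// addr_ge0.
split.
- by rewrite lt_min d10 d20 ge_min d11.
- by rewrite /C; lra.
- apply: (@blipW _ _ (C1 + C2)); first by rewrite /C; lra.
  split=> [x Sx|x y Sx Sy].
    by rewrite (le_trans (ler_normD _ _))// lerD//; [exact: DC1.1|exact: DC2.1].
  rewrite opprD addrACA (le_trans (ler_normD _ _))// mulrDl lerD//.
    exact: DC1.2.
  exact: DC2.2.
- split=> [x Sx|x y Sx Sy].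
    have := enormD (v1 x) (v2 x); have := v1b _ Sx; have := v2b _ Sx.
    by rewrite /C; lra.
  rewrite (_ : v1 x + v2 x - (v1 y + v2 y) = (v1 x - v1 y) + (v2 x - v2 y)); last first.
    by rewrite opprD addrACA.
  rewrite (le_trans (enormD _ _))// (@le_trans _ _ ((C1 + C2) * enorm (x - y)))//.
    by rewrite mulrDl lerD ?v1l ?v2l.
  by rewrite ler_wpM2r ?enorm_ge0// /C; lra.
move=> d; rewrite le_min => /andP[dd1 dd2].
have [S1 L1 F1 I1] := H1 _ dd1; have [S2 L2 F2 I2] := H2 _ dd2.
have dle1 : `|d| <= 1 by exact: le_trans dd1 _.
have d2E : d ^+ 2 = `|d| * `|d| by rewrite -expr2 real_normK ?num_real.
have move2 x : S x -> enorm (E2 d x - x) <= (C2 + C2) * `|d|.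
  move=> Sx; rewrite (le_trans (enorm_distD (x + d *: v2 x) _ _))//.
  rewrite mulrDl lerD//.
    by rewrite (le_trans (F2 _ Sx))// d2E mulrA ler_piMr ?mulr_ge0.
  by rewrite addrC addKr enormZ mulrC ler_wpM2r// v2b.
have move1 x : S x -> enorm (E1 d x - x) <= (C1 + C1) * `|d|.
  move=> Sx; rewrite (le_trans (enorm_distD (x + d *: v1 x) _ _))//.
  rewrite mulrDl lerD//.
    by rewrite (le_trans (F1 _ Sx))// d2E mulrA ler_piMr ?mulr_ge0.
  by rewrite addrC addKr enormZ mulrC ler_wpM2r// v1b.
split.
- by move=> x Sx; exact/S1/S2.
- move=> x y Sx Sy; rewrite (le_trans (L1 _ _ (S2 _ Sx) (S2 _ Sy)))//.
  rewrite (@le_trans _ _ (C1 * C2 * enorm (x - y)))//.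
    by rewrite -mulrA ler_wpM2l// L2.
  by rewrite ler_wpM2r ?enorm_ge0// /C; lra.
- move=> x Sx /=; have := S2 _ Sx; have := F2 _ Sx; have := move2 _ Sx.
  move: (E2 d x) => y m2 h2 Sy.
  have -> : E1 d y - (x + d *: (v1 x + v2 x)) =
    (E1 d y - (y + d *: v1 y)) + ((y - (x + d *: v2 x)) + d *: (v1 y - v1 x)).
    by apply: R3_eqP => /=; rewrite /GRing.scale /=; ring.
  rewrite (le_trans (enormD _ _))//.
  have h1 := F1 _ Sy.
  have h3 : enorm (d *: (v1 y - v1 x)) <= C1 * (C2 + C2) * d ^+ 2.
    rewrite enormZ d2E mulrC -!mulrA mulrA mulrA ler_wpM2r//.
    by rewrite (le_trans (v1l _ _ Sy Sx))// -mulrA ler_wpM2l.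
  have := enormD (y - (x + d *: v2 x)) (d *: (v1 y - v1 x)).
  suff : C1 * d ^+ 2 + C2 * d ^+ 2 + C1 * (C2 + C2) * d ^+ 2 <= C * d ^+ 2 by lra.
  by rewrite -!mulrDl ler_wpM2r ?sqr_ge0// /C; lra.
- move=> K h K0 hK h0.
  have hK1 : blip S (K * (C1 + 1)) (h \o E1 d) by exact: blip_comp.
  have K10 : 0 <= K * (C1 + 1) by rewrite mulr_ge0// addr_ge0.
  have e1 := I1 _ _ K0 hK h0.
  have e2 := I2 _ _ K10 hK1 (fun x Sx => h0 _ (S1 _ Sx)).
  have bh := blip_bl K0 hK; have bh1 := blip_bl K10 hK1.
  have bD1 := blip_bl C10 DC1; have bD2 := blip_bl C20 DC2.
  (* Replacing [h \o E1 d] by [h] costs O(d), and this difference is multiplied by [d] in [e5]. *)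
  have e3 : `|SI (fun x => D2 x * (h \o E1 d) x) - SI (fun x => D2 x * h x)| <=
      C2 * (K * ((C1 + C1) * `|d|)) * A.
    apply: (sphere_integral_dist n0); [exact: blM|exact: blM|].
    move=> x Sx; rewrite -mulrBr normrM ler_pM//; first exact: DC2.1.
    by rewrite (le_trans (hK.2 _ _ (S1 _ Sx) Sx))// ler_wpM2l// move1.
  have e4 : SI (fun x => (D1 x + D2 x) * h x) =
      SI (fun x => D1 x * h x) + SI (fun x => D2 x * h x).
    rewrite -(sphere_integralD n0); [|exact: blM|exact: blM].
    by apply: eq_sphere_integral => x _; rewrite mulrDl.
  have e5 : `|d * (SI (fun x => D2 x * h x) - SI (fun x => D2 x * (h \o E1 d) x))| <=
      C2 * (C1 + C1) * A * K * d ^+ 2.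
    rewrite normrM distrC.
    rewrite (@le_trans _ _ (`|d| * (C2 * (K * ((C1 + C1) * `|d|)) * A)))//.
      by rewrite ler_wpM2l.
    by rewrite d2E le_eqVlt; apply/orP; left; apply/eqP; ring.
  rewrite e4 compA.
  have -> : SI ((h \o E1 d) \o E2 d) - SI h +
    d * (SI (fun x => D1 x * h x) + SI (fun x => D2 x * h x)) =
    (SI ((h \o E1 d) \o E2 d) - SI (h \o E1 d) + d * SI (fun x => D2 x * (h \o E1 d) x)) +
    (SI (h \o E1 d) - SI h + d * SI (fun x => D1 x * h x)) +
    d * (SI (fun x => D2 x * h x) - SI (fun x => D2 x * (h \o E1 d) x)) by ring.
  rewrite (le_trans (ler_normD _ _))//.
  have := ler_normD (SI ((h \o E1 d) \o E2 d) - SI (h \o E1 d) + d * SI (fun x => D2 x * (h \o E1 d) x))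
    (SI (h \o E1 d) - SI h + d * SI (fun x => D1 x * h x)).
  suff : C2 * (K * (C1 + 1)) * d ^+ 2 + C1 * K * d ^+ 2 + C2 * (C1 + C1) * A * K * d ^+ 2
     <= C * K * d ^+ 2 by lra.
  have -> : C2 * (K * (C1 + 1)) = C2 * (C1 + 1) * K by ring.
  rewrite -!mulrDl ler_wpM2r ?sqr_ge0// ler_wpM2r// /C; lra.
Qed.

(* A frame is an orthogonal change of coordinates preserving the area. *)
Definition frame (tau tau' : R3 R -> R3 R) :=
  [/\ cancel tau tau' /\ cancel tau' tau,
      forall a u v, tau (u + a *: v) = tau u + a *: tau v,
      forall a u v, tau' (u + a *: v) = tau' u + a *: tau' v,
      (forall x, enorm (tau x) = enorm x) &
      forall K g, blip S K g -> (forall x, S x -> 0 <= g x) ->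
      (\int[surface_area n]_(x in S) (g (tau x))%:E =
       \int[surface_area n]_(x in S) (g x)%:E)%E].

(** The rotations about the axis that [tau] sends to the third one. *)
Definition rot (tau tau' : R3 R -> R3 R) a x := tau' (rot3 a (tau x)).

Definition gen (tau tau' : R3 R -> R3 R) x := tau' (gen3 (tau x)).

Section rotation_stepper.
Variables tau tau' : R3 R -> R3 R.
Hypothesis tauF : frame tau tau'.

Let tauK : cancel tau tau'. Proof. by case: tauF => -[]. Qed.
Let tau'K : cancel tau' tau. Proof. by case: tauF => -[]. Qed.
Let tauN x : enorm (tau x) = enorm x. Proof. by case: tauF. Qed.
Let tau'N x : enorm (tau' x) = enorm x. Proof. by rewrite -tauN tau'K. Qed.
Let tauB x y : tau x - tau y = tau (x - y).
Proof. by case: tauF => _ + _ _ _ => tl; rewrite -scaleN1r -tl scaleN1r. Qed.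
Let tau'B x y : tau' x - tau' y = tau' (x - y).
Proof. by case: tauF => _ _ + _ _ => tl; rewrite -scaleN1r -tl scaleN1r. Qed.
Let tauS x : S x -> S (tau x). Proof. by rewrite /S /sphere /= tauN. Qed.
Let tau'S x : S x -> S (tau' x). Proof. by rewrite /S /sphere /= tau'N. Qed.

Let blip_tau' K f : blip S K f -> blip S K (f \o tau').
Proof.
move=> [fb fl]; split=> [x Sx|x y Sx Sy]; first exact/fb/tau'S.
by rewrite (le_trans (fl _ _ (tau'S Sx) (tau'S Sy)))// tau'B tau'N.
Qed.

Lemma rot_sphere a x : S x -> S (rot tau tau' a x).
Proof. by move=> Sx; apply: tau'S; apply: rot3_sphere; exact: tauS. Qed.

Lemma rot_lipschitz a b x y :
  enorm (rot tau tau' a x - rot tau tau' b y) <=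
  enorm (x - y) + 4 * `|a - b| * enorm y.
Proof.
rewrite /rot tau'B tau'N (le_trans (rot3_lipschitz _ _ _ _))//.
by rewrite tauB !tauN.
Qed.

Lemma rot_first_order a x :
  enorm (rot tau tau' a x - (x + a *: gen tau tau' x)) <= 4 * a ^+ 2 * enorm x.
Proof.
have -> : x + a *: gen tau tau' x = tau' (tau x + a *: gen3 (tau x)).
  by case: tauF => _ _ -> _ _; rewrite tauK.
by rewrite /rot tau'B tau'N (le_trans (rot3_first_order _ _))// tauN.
Qed.

Lemma enorm_gen x : enorm (gen tau tau' x) <= enorm x.
Proof. by rewrite tau'N (le_trans (enorm_gen3 _))// tauN. Qed.

Lemma genB x y : gen tau tau' x - gen tau tau' y = gen tau tau' (x - y).
Proof. by rewrite /gen tau'B gen3B tauB. Qed.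

Lemma rot_change_of_variables K1 K2 K3 g w D (d : R) :
  0 <= K1 -> 0 <= K2 -> 0 <= K3 ->
  blip S K1 g -> blip S K2 w -> blip S K3 D ->
  (forall x, S x ->
     is_derive (0 : R) (1 : R) (fun a => w (rot tau tau' a x)) (D x)) ->
  (forall x, S x -> 0 <= g x) -> (forall x, S x -> 0 <= 1 + d * D x) ->
  (\int[surface_area n]_(x in S) (g (rot tau tau' (d * w x) x) * (1 + d * D x))%:E =
   \int[surface_area n]_(x in S) (g x)%:E)%E.
Proof.
move=> K10 K20 K30 gK wK DK dw g0 D0.
have [_ _ _ _ inv] := tauF.
pose g' := g \o tau'; pose w' := w \o tau'; pose D' := D \o tau'.
have g'0 x : S x -> 0 <= g' x by move=> Sx; apply: g0; exact: tau'S.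
have D'0 x : S x -> 0 <= 1 + d * D' x by move=> Sx; apply: D0; exact: tau'S.
have bg' : bl S setT (fun _ : unit => g') by exists K1 => // _ _; exact: blip_tau'.
have bw' : bl S setT (fun _ : unit => w') by exists K2 => // _ _; exact: blip_tau'.
have bD' : bl S setT (fun _ : unit => D') by exists K3 => // _ _; exact: blip_tau'.
have dw' x : S x -> is_derive (0 : R) (1 : R) (fun a => w' (rot3 a x)) (D' x).
  by move=> Sx; have := dw _ (tau'S Sx); rewrite /rot /w' /D' /= tau'K.
pose k x := g' (rot3 (d * w' x) x) * (1 + d * D' x).
have [K K0 /(_ tt I) kK] : bl S setT (fun _ : unit => k).
  apply: blM.
    exact: (@bl_rot3 _ _ n0 _ _ (fun=> g') (fun _ x => d * w' x) bg' (blZ d bw')).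
  apply: blD; last exact: blZ.
  by apply: (@bl_cst _ _ _ _ (fun=> 1) 1) => ? _; rewrite normr1.
have k0 x : S x -> 0 <= k x.
  by move=> Sx; rewrite mulr_ge0 ?D'0 ?g'0//; exact: rot3_sphere.
transitivity (\int[surface_area n]_(x in S) (k (tau x))%:E)%E.
  by apply: eq_integral => x _; rewrite /k /g' /w' /D' /= !tauK.
rewrite (inv _ _ kK k0).
rewrite (rot3_change_of_variables n0 K10 K20 K30 (blip_tau' gK) (blip_tau' wK)
  (blip_tau' DK) dw' g'0 D'0).
rewrite -(inv _ _ (blip_tau' gK) g'0).
by apply: eq_integral => x _; rewrite /g' /= tauK.
Qed.

(** The change of variables is exact: the integral of h is that of h(E) plus d times that of D h(E).
    The only error comes from replacing h(E) by h in the last term, where |E x - x| = O(d). *)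
Lemma stepper_rot w D : bl S setT (fun _ : unit => w) ->
  bl S setT (fun _ : unit => D) ->
  (forall x, S x ->
     is_derive (0 : R) (1 : R) (fun a => w (rot tau tau' a x)) (D x)) ->
  stepper (fun x => w x *: gen tau tau' x) D
    (fun d x => rot tau tau' (d * w x) x).
Proof.
move=> [M M0 /(_ tt I) wM] [N N0 /(_ tt I) DN] dw.
have r0 := sphere_radius_gt0 (R := R) n0; rewrite -/r in r0.
have A0 : 0 <= A by exact: sphere_area_ge0.
have Sr x : S x -> enorm x = r by [].
pose C := N + M * r + (M * r + M) + (1 + 4 * M * r) + 4 * M ^+ 2 * r +
  N * (4 * M * r) * A.
have q1 : 0 <= M * r by rewrite mulr_ge0// ltW.
have q3 : 0 <= M ^+ 2 * r by rewrite mulr_ge0 ?sqr_ge0// ltW.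
have q4 : 0 <= N * (4 * M * r) * A by rewrite !mulr_ge0// ltW.
(* For |d| up to this bound |d D| <= 1, so the Jacobian [1 + d * D x] is nonnegative. *)
exists (N + 1)^-1, C; split.
- by rewrite invr_gt0 ltr_wpDl//= invf_le1 ?lerDr// ltr_wpDl.
- by rewrite /C; lra.
- by apply: blipW DN; rewrite /C; lra.
- split=> [x Sx|x y Sx Sy].
    rewrite enormZ (@le_trans _ _ (M * r))//; last by rewrite /C; lra.
    by rewrite ler_pM ?enorm_ge0 ?wM.1// (le_trans (enorm_gen _))// Sr.
  have -> : w x *: gen tau tau' x - w y *: gen tau tau' y =
      (w x - w y) *: gen tau tau' x + w y *: gen tau tau' (x - y).
    by rewrite -genB scalerBl scalerBr addrA subrK.
  rewrite (le_trans (enormD _ _))// !enormZ.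
  rewrite (@le_trans _ _ ((M * r + M) * enorm (x - y)))//; last first.
    by rewrite ler_wpM2r ?enorm_ge0// /C; lra.
  rewrite mulrDl lerD//.
    rewrite mulrAC ler_pM ?enorm_ge0 ?wM.2//.
    by rewrite (le_trans (enorm_gen _))// Sr.
  by rewrite ler_pM ?enorm_ge0 ?wM.1// enorm_gen.
move=> d dN.
have dD x : S x -> 0 <= 1 + d * D x.
  move=> Sx; suff : `|d * D x| <= 1 by rewrite ler_norml => /andP[? _]; lra.
  rewrite normrM (@le_trans _ _ ((N + 1)^-1 * N))//.
    by rewrite ler_pM ?DN.1.
  by rewrite mulrC ler_pdivrMr ?mul1r ?lerDl// ltr_wpDl.
have d1 : `|d| <= 1.
  by rewrite (le_trans dN)// invf_le1 ?lerDr// ltr_wpDl.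
have d2E : d ^+ 2 = `|d| * `|d| by rewrite -expr2 real_normK ?num_real.
have EL x y : S x -> S y -> enorm (rot tau tau' (d * w x) x - rot tau tau' (d * w y) y)
    <= (1 + 4 * M * r) * enorm (x - y).
  move=> Sx Sy; rewrite (le_trans (rot_lipschitz _ _ _ _))// (Sr y)//.
  rewrite [leRHS]mulrDl mul1r lerD2l -mulrBr normrM.
  have -> : 4 * M * r * enorm (x - y) = 4 * (M * enorm (x - y)) * r by ring.
  rewrite ler_wpM2r ?(ltW r0)// ler_wpM2l//.
  by rewrite (le_trans _ (wM.2 _ _ Sx Sy))// ler_piMl.
split.
- by move=> x Sx; exact: rot_sphere.
- move=> x y Sx Sy; rewrite (le_trans (EL _ _ Sx Sy))//.
  by rewrite ler_wpM2r ?enorm_ge0// /C; lra.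
- move=> x Sx; rewrite scalerA (le_trans (rot_first_order _ _))// (Sr x)//.
  rewrite exprMn (@le_trans _ _ (4 * M ^+ 2 * r * d ^+ 2))//; last first.
    by rewrite ler_wpM2r ?sqr_ge0// /C; lra.
  have -> : 4 * (d ^+ 2 * w x ^+ 2) * r = 4 * (w x ^+ 2) * r * d ^+ 2 by ring.
  rewrite ler_wpM2r ?sqr_ge0// ler_wpM2r ?(ltW r0)// ler_wpM2l//.
  by rewrite -(real_normK (num_real (w x))) ler_pXn2r ?nnegrE// wM.1.
move=> K h K0 hK h0.
set E := fun x => rot tau tau' (d * w x) x.
have SE x : S x -> S (E x) by exact: rot_sphere.
have C10 : 0 <= 1 + 4 * M * r by lra.
have bh := blip_bl K0 hK.
have bhE : bl S setT (fun _ : unit => h \o E).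
  by apply: (@blip_bl (K * ((1 + 4 * M * r) + 1))); [rewrite mulr_ge0//; lra|exact: blip_comp].
have bD := blip_bl N0 DN.
have bDh : bl S setT (fun (_ : unit) x => D x * h x) by exact: blM.
have bDE : bl S setT (fun (_ : unit) x => D x * (h \o E) x) by exact: blM.
have cv := rot_change_of_variables K0 M0 N0 hK wM DN dw h0 dD.
have b1 : bl S setT (fun (_ : unit) x => (h \o E) x * (1 + d * D x)).
  apply: blM => //; apply: blD; last exact: blZ.
  by apply: (@bl_cst _ _ _ _ (fun=> 1) 1) => ? _; rewrite normr1.
have {}cv : SI h = SI (h \o E) + d * SI (fun x => D x * (h \o E) x).
  rewrite -sphere_integralZ// -sphere_integralD//; last exact: blZ.
  rewrite [RHS](@eq_sphere_integral _ _ _ (fun x => (h \o E) x * (1 + d * D x))); last first.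
    by move=> x _; ring.
  by apply: EFin_inj; rewrite -!sphere_integral_EFin.
have -> : SI (h \o E) - SI h + d * SI (fun x => D x * h x) =
  d * (SI (fun x => D x * h x) - SI (fun x => D x * (h \o E) x)) by rewrite cv; ring.
have e1 : `|SI (fun x => D x * h x) - SI (fun x => D x * (h \o E) x)| <=
    N * (K * (4 * (`|d| * M) * r)) * A.
  apply: (sphere_integral_dist n0) => // x Sx.
  rewrite -mulrBr normrM ler_pM ?DN.1//.
  rewrite (le_trans (hK.2 _ _ Sx (SE _ Sx)))// ler_wpM2l//.
  (* Viewed as rotated by the angle 0, [x] is compared with [E x] through [rot_lipschitz]. *)
  have {1}-> : x = rot tau tau' 0 x.
    by rewrite /rot /rot3 cos0 sin0 !mulr1 !mulr0 subr0 add0r -{1}(tauK x);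
      congr tau'; exact: R3_eqP.
  rewrite (le_trans (rot_lipschitz _ _ _ _))// subrr enorm0 add0r (Sr x)// sub0r normrN.
  by rewrite ler_wpM2r ?(ltW r0)// ler_wpM2l// normrM ler_wpM2l// wM.1.
rewrite normrM (le_trans (ler_wpM2l (normr_ge0 d) e1))//.
rewrite (@le_trans _ _ (N * (4 * M * r) * A * K * d ^+ 2))//.
  by rewrite d2E le_eqVlt; apply/orP; left; apply/eqP; ring.
by rewrite ler_wpM2r ?sqr_ge0// ler_wpM2r// /C; lra.
Qed.

End rotation_stepper.

Lemma frame_id : frame id id.
Proof. by []. Qed.

Lemma frame_swap13 : frame swap13 swap13.
Proof.
split=> //.
- by split; exact: swap13K.
- by move=> x; rewrite /enorm dot_swap13.
- by move=> K g gK g0; exact: (swap13_integral n0 gK g0).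
Qed.

(** The change of variables with a constant angle: w = 1, D = 0 and d = a. *)
Lemma rot3_integral a K g : blip S K g -> (forall x, S x -> 0 <= g x) ->
  (\int[surface_area n]_(x in S) (g (rot3 a x))%:E =
   \int[surface_area n]_(x in S) (g x)%:E)%E.
Proof.
move=> gK g0; have gK' : blip S `|K| g by apply: blipW gK; exact: ler_norm.
have w1 : blip S 1 (fun=> 1 : R).
  by split=> *; rewrite ?normr1// subrr normr0 mul1r enorm_ge0.
have D1 : blip S 0 (fun=> 0 : R).
  by split=> *; rewrite ?normr0// subrr normr0 mul0r.
have := @rot3_change_of_variables R n n0 `|K| 1 0 g (fun=> 1) (fun=> 0) a
  (normr_ge0 _) ler01 (lexx _) gK' w1 D1.
move=> <-//.
- by apply: eq_integral => x _; rewrite mulr1 mulr0 addr0 mulr1.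
- by move=> x _; rewrite mulr0 addr0.
Qed.

(** A quarter turn followed by the exchange puts the second coordinate, up to sign, in the third
    place; the rotations of this frame are about the second axis. *)
Lemma frame_turn :
  frame (swap13 \o rot3 (pi / 2)) (rot3 (- (pi / 2)) \o swap13).
Proof.
have rK a x : rot3 (- a) (rot3 a x) = x :> R3 R.
  by rewrite -rot3D addNr /rot3 cos0 sin0; apply: R3_eqP => /=; ring.
split.
- split=> x /=; first by rewrite swap13K rK.
  by rewrite -{1}(opprK (pi / 2)) rK swap13K.
- by move=> a u v; apply: R3_eqP; rewrite /= /GRing.scale /=; ring.
- by move=> a u v; apply: R3_eqP; rewrite /= /GRing.scale /=; ring.
- by move=> x; rewrite /enorm /= dot_swap13 dot_rot3.
- move=> K g gK g0; rewrite -(swap13_integral n0 gK g0).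
  rewrite -(@rot3_integral (pi / 2) K (g \o swap13))//; first exact: blip_swap13.
  by move=> x Sx; apply: g0; exact: swap13_sphere.
Qed.

End stepper.

(** * Regularization of the field and its decomposition into rotations *)

Section regularized_inverse.
Context {R : realType}.
Implicit Types (c u v : R).

(** The difference quotient is within C |h| of [df]. This replaces the rules of calculus at the
    corner of [Num.max] in [reginv]. *)
Lemma is_derive_quadratic (f : R -> R) (x df C : R) :
  (forall h, `|f (x + h) - f x - h * df| <= C * h ^+ 2) ->
  is_derive x (1 : R) f df.
Proof.
move=> fC.
have C0 : 0 <= C by have := fC 1; rewrite expr1n mulr1; exact: le_trans.
have lim : h^-1 *: (f (h *: 1 + x) - f x) @[h --> (0 : R)^'] --> df.
  apply/cvgrPdist_lt => e e0; near=> h.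
  have h0 : h != 0 by near: h; exact: nbhs_dnbhs_neq.
  have hC : `|h| < e / (C + 1).
    near: h; apply: dnbhs0_lt; by rewrite divr_gt0// ltr_wpDl.
  rewrite /GRing.scale /= mulr1 (addrC h).
  have -> : df - h^-1 * (f (x + h) - f x) =
      - (h^-1 * (f (x + h) - f x - h * df)) by field.
  rewrite normrN normrM normfV mulrC ltr_pdivrMr ?normr_gt0//.
  rewrite (le_lt_trans (fC h))// -(real_normK (num_real h)) expr2 mulrA.
  rewrite ltr_pM2r ?normr_gt0//.
  rewrite (@le_lt_trans _ _ ((C + 1) * `|h|))//.
    by rewrite ler_wpM2r// lerDl.
  by move: hC; rewrite ltr_pdivlMr ?ltr_wpDl// mulrC.
apply: DeriveDef; first by apply/cvg_ex; exists df.
exact/cvg_lim.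
Unshelve. all: by end_near. Qed.

(* The C^1 function which is 1 / u for u >= c, extended by its tangent at c. *)
Definition reginv c u := 2 * (Num.max u c)^-1 - u * (Num.max u c)^-1 ^+ 2.

Definition dreginv c u := - (Num.max u c)^-1 ^+ 2.

Lemma reginvE c u : 0 < c -> c <= u -> reginv c u = u^-1.
Proof.
move=> c0 cu; rewrite /reginv (max_idPl cu).
by field; rewrite gt_eqF// (lt_le_trans c0).
Qed.

Lemma dreginvE c u : c <= u -> dreginv c u = - u^-1 ^+ 2.
Proof. by move=> cu; rewrite /dreginv (max_idPl cu). Qed.

(** The second derivative is 2 / u^3 above [c] and 0 below. The remainder is bounded directly, with
    the cruder constant 3 c^-3, according to the sides of [c] on which the two points lie. *)
Lemma is_derive_reginv c u : 0 < c ->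
  is_derive u (1 : R) (reginv c) (dreginv c u).
Proof.
move=> c0; apply: (@is_derive_quadratic _ _ _ (3 * c^-1 ^+ 3)) => h.
set v := u + h; have -> : h = v - u by rewrite /v; ring.
set a := Num.max u c; set b := Num.max v c.
have ac : c <= a by rewrite le_max lexx orbT.
have bc : c <= b by rewrite le_max lexx orbT.
have a0 : 0 < a by exact: lt_le_trans ac.
have b0 : 0 < b by exact: lt_le_trans bc.
have ab : `|b - a| <= `|v - u| by exact: normr_maxB.
have i0 : 0 < c^-1 by rewrite invr_gt0.
have ia : 0 < a^-1 <= c^-1 by rewrite invr_gt0 a0 lef_pV2 ?posrE.
have ib : 0 < b^-1 <= c^-1 by rewrite invr_gt0 b0 lef_pV2 ?posrE.
(* The remainder vanishes when a = b = c, and is (v - a)^2 / (v a^2) when v >= c. *)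
have -> : reginv c v - reginv c u - (v - u) * dreginv c u =
    (b - a) * (b * (b - a) - (b - v) * (a + b)) * (a^-1 * b^-1) ^+ 2.
  rewrite /reginv /dreginv -/a -/b.
  by field; rewrite !gt_eqF.
have i3 p : 0 <= p <= c^-1 -> p * c^-1 ^+ 2 <= c^-1 ^+ 3.
  by move=> /andP[p0 pc]; rewrite exprS ler_wpM2r ?sqr_ge0.
have ab2 : (b - a) ^+ 2 <= (v - u) ^+ 2.
  by rewrite -(real_normK (num_real (b - a))) -(real_normK (num_real (v - u))) ler_pXn2r ?nnegrE.
have [cv|vc] := leP c v.
  have -> : b = v by apply/max_idPl.
  have v0 : 0 < v by exact: lt_le_trans cv.
  have -> : (v - a) * (v * (v - a) - (v - v) * (a + v)) * (a^-1 * v^-1) ^+ 2 =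
     (v - a) ^+ 2 * (v^-1 * a^-1 ^+ 2) by field; rewrite !gt_eqF.
  have bv : b = v by apply/max_idPl.
  have p0 : 0 <= (v - a) ^+ 2 * (v^-1 * a^-1 ^+ 2).
    apply: mulr_ge0; first exact: sqr_ge0.
    by apply: mulr_ge0; [rewrite invr_ge0 ltW|exact: sqr_ge0].
  rewrite (ger0_norm p0) -bv.
  have h1 : b^-1 * a^-1 ^+ 2 <= c^-1 ^+ 3.
    have [ia1 ia2] := andP ia; have [ib1 ib2] := andP ib.
    rewrite (@le_trans _ _ (b^-1 * c^-1 ^+ 2))//; last by apply: i3; rewrite (ltW ib1).
    by rewrite ler_wpM2l ?(ltW ib1)// ler_pXn2r// nnegrE ltW.
  have h0 : 0 <= c^-1 ^+ 3 by apply: exprn_ge0; exact: ltW.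
  have h2 : (b - a) ^+ 2 * (b^-1 * a^-1 ^+ 2) <= (v - u) ^+ 2 * c^-1 ^+ 3.
    apply: ler_pM => //; first exact: sqr_ge0.
    by apply: mulr_ge0; [rewrite invr_ge0 ltW|exact: sqr_ge0].
  have h3 := mulr_ge0 h0 (sqr_ge0 (v - u)).
  by move: h2 h3; rewrite -?bv; lra.
have bE : b = c by apply/max_idPr; exact: ltW.
rewrite bE.
have q0 : 0 <= 3 * c^-1 ^+ 3 * (v - u) ^+ 2.
  apply: mulr_ge0; last exact: sqr_ge0.
  by apply: mulr_ge0 => //; apply: exprn_ge0; exact: ltW.
have [uc|cu] := leP u c.
  have -> : a = c by apply/max_idPr.
  by rewrite subrr !mul0r normr0.
have aE : a = u by apply/max_idPl; exact: ltW.
rewrite aE; have u0 : 0 < u by rewrite -aE.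
have -> : (c - u) * (c * (c - u) - (c - v) * (u + c)) * (u^-1 * c^-1) ^+ 2 =
   (u - c) * (c * (u - c) + (c - v) * (u + c)) * (u^-1 * c^-1) ^+ 2 by ring.
have n1 : 0 <= u - c by rewrite subr_ge0 ltW.
have n2 : 0 <= c * (u - c) + (c - v) * (u + c) by nra.
rewrite ger0_norm; last by rewrite mulr_ge0 ?sqr_ge0// mulr_ge0.
have h2 : (u - c) * (c * (u - c) + (c - v) * (u + c)) <= (u - v) * (3 * u * (u - v)).
  apply: ler_pM => //; first lra.
  by nra.
rewrite (le_trans (ler_wpM2r (sqr_ge0 _) h2))//.
have -> : (u - v) * (3 * u * (u - v)) * (u^-1 * c^-1) ^+ 2 =
  3 * (u^-1 * c^-1 ^+ 2) * (v - u) ^+ 2 by field; rewrite !gt_eqF.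
rewrite ler_wpM2r ?sqr_ge0// ler_wpM2l// i3// invr_ge0 (ltW u0)/=.
by rewrite -aE; case/andP: ia.
Qed.

End regularized_inverse.

Section vector_field.
Context {R : realType} (n : nat) (n0 : (0 < n)%N).
Let r : R := sphere_radius n.
Let S : set (R3 R) := sphere n.
Implicit Types (s : seq (R3 R)) (x z : R3 R) (c : R).

Let r0 : 0 < r. Proof. exact: sphere_radius_gt0. Qed.

(* On the sphere, gap z x = |x - z|^2 / 2. *)
Definition gap z x : R := r ^+ 2 - dot x z.

(** On the sphere each term is the tangential part of [z] at [x] divided by |x - z|^2, that is minus
    the gradient of log |x - z|. *)
Definition field s x : R3 R :=
  \sum_(z <- s) (2 * gap z x)^-1 *: (z - (dot x z / r ^+ 2) *: x).

(** Where every gap is at least [c], this is the inner product of the field with [gen3 x] divided by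
    r^2: the angular velocity about the third axis when the field is split into three rotations. *)
Definition azimuthal c s x : R :=
  \sum_(z <- s) reginv c (gap z x) * dot z (gen3 x) / (2 * r ^+ 2).

Definition dazimuthal c s x : R :=
  \sum_(z <- s) (- dreginv c (gap z x) * dot z (gen3 x) ^+ 2 +
                 reginv c (gap z x) * dot z (gen3 (gen3 x))) / (2 * r ^+ 2).

Lemma is_derive_sum_seq (T : eqType) (l : seq T) (f : T -> R -> R) (df : T -> R) (a : R) :
  (forall j, j \in l -> is_derive a (1 : R) (f j) (df j)) ->
  is_derive a (1 : R) (fun a => \sum_(j <- l) f j a) (\sum_(j <- l) df j).
Proof.
elim: l => [_|j l IH dE].
  rewrite (_ : (fun a => _) = cst 0) ?big_nil; first exact: is_derive_cst.
  by apply/funext => b; rewrite big_nil.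
rewrite (_ : (fun a => _) = (fun a => f j a + \sum_(j <- l) f j a)) ?big_cons.
  have dj : is_derive a (1 : R) (f j) (df j) by apply: dE; rewrite inE eqxx.
  have dl := IH (fun i il => dE i (mem_behead (s := j :: l) il)).
  by apply: is_deriveD.
by apply/funext => b; rewrite big_cons.
Qed.

Lemma is_derive_azimuthal c s x : 0 < c ->
  is_derive (0 : R) (1 : R) (fun a => azimuthal c s (rot3 a x)) (dazimuthal c s x).
Proof.
move=> c0; apply: is_derive_sum_seq => z _.
have dg (b : R) : is_derive b (1 : R) (fun a => gap z (rot3 a x)) (- dot z (gen3 (rot3 b x))).
  rewrite /gap /dot /rot3 /gen3 /=.
  by apply: is_derive_eq; rewrite /GRing.scale /=; ring.
have dw (b : R) : is_derive b (1 : R) (fun a => dot z (gen3 (rot3 a x)))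
    (dot z (gen3 (gen3 (rot3 b x)))).
  rewrite /dot /rot3 /gen3 /=.
  by apply: is_derive_eq; rewrite /GRing.scale /=; ring.
have x0 : rot3 0 x = x by apply: R3_eqP; rewrite /rot3 /= ?cos0 ?sin0; ring.
have dk := is_derive_reginv (gap z (rot3 0 x)) c0.
have dkg := @is_derive1_comp R (reginv c) (fun a => gap z (rot3 a x)) 0 _ _ dk (dg 0).
have := is_deriveM dkg (dw 0).
rewrite /= x0 => dM.
have dM' := is_deriveM dM (is_derive_cst ((2 * r ^+ 2)^-1 : R) (0 : R) (1 : R)).
by apply: (is_derive_eq dM'); rewrite /GRing.scale /=; ring.
Qed.

Section bounded_lipschitz_fields.
Variables (T : Type) (D : set T).

Lemma bl_coord : [/\ bl S D (fun _ x => x.1.1), bl S D (fun _ x => x.1.2) &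
  bl S D (fun _ x => x.2)].
Proof.
have r1 : 0 <= r + 1 by rewrite addr_ge0 ?(ltW r0).
have aux (f : R3 R -> R) : (forall x, `|f x| <= enorm x) ->
    (forall x y, f x - f y = f (x - y)) -> bl S D (fun=> f).
  move=> fe fB; exists (r + 1) => // i _; split=> [x Sx|x y Sx Sy].
    by rewrite (le_trans (fe _))// (Sx : enorm x = r) lerDl.
  by rewrite fB (le_trans (fe _))// ler_peMl ?enorm_ge0// lerDr (ltW r0).
by split; apply: aux => // x; have [] := enorm_ge_coord x.
Qed.

Lemma bl_dot (f g : T -> R3 R -> R3 R) :
  [/\ bl S D (fun i x => (f i x).1.1), bl S D (fun i x => (f i x).1.2) &
      bl S D (fun i x => (f i x).2)] ->
  [/\ bl S D (fun i x => (g i x).1.1), bl S D (fun i x => (g i x).1.2) &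
      bl S D (fun i x => (g i x).2)] ->
  bl S D (fun i x => dot (f i x) (g i x)).
Proof. by move=> [? ? ?] [? ? ?]; apply: blD; [apply: blD|]; exact: blM. Qed.

Lemma bl_const3 z : [/\ bl S D (fun _ _ => z.1.1), bl S D (fun _ _ => z.1.2) &
  bl S D (fun _ _ => z.2)].
Proof. by split; apply: (@bl_cst _ _ _ _ _ _) => i _; exact: lexx. Qed.

Lemma bl_gap z : bl S D (fun=> gap z).
Proof.
apply: blB; first by apply: (@bl_cst _ _ _ _ _ _) => i _; exact: lexx.
by apply: (bl_dot (f := fun _ x => x) (g := fun _ _ => z)); [exact: bl_coord|exact: bl_const3].
Qed.

Lemma bl_reginv c z : 0 < c -> bl S D (fun _ x => reginv c (gap z x)).
Proof.
move=> c0; have bi := bl_invmax c0 (bl_gap z).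
apply: blB; first exact: blZ.
by apply: blM; [exact: bl_gap|exact: blM].
Qed.

Lemma bl_azimuthal c s : 0 < c -> bl S D (fun=> azimuthal c s).
Proof.
move=> c0; apply: bl_sum => z.
have cK (k : R) : bl S D (fun _ _ => k).
  by apply: (@bl_cst _ _ _ _ _ _) => i _; exact: lexx.
apply: blM; last exact: cK.
apply: blM; first exact: bl_reginv.
have [b1 b2 b3] := bl_coord.
apply: (bl_dot (f := fun _ _ => z) (g := fun _ x => gen3 x)); first exact: bl_const3.
by split; [exact: blN|exact: b1|exact: cK].
Qed.

Lemma bl_dazimuthal c s : 0 < c -> bl S D (fun=> dazimuthal c s).
Proof.
move=> c0; apply: bl_sum => z.
have cK (k : R) : bl S D (fun _ _ => k).
  by apply: (@bl_cst _ _ _ _ _ _) => i _; exact: lexx.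
have [b1 b2 b3] := bl_coord.
have bg : bl S D (fun _ x => dot z (gen3 x)).
  apply: (bl_dot (f := fun _ _ => z) (g := fun _ x => gen3 x)); first exact: bl_const3.
  by split; [exact: blN|exact: b1|exact: cK].
have bgg : bl S D (fun _ x => dot z (gen3 (gen3 x))).
  apply: (bl_dot (f := fun _ _ => z) (g := fun _ x => gen3 (gen3 x))); first exact: bl_const3.
  by split; [exact: blN|exact: blN|exact: cK].
have bi := bl_invmax c0 (bl_gap z).
apply: blM; last exact: cK.
apply: blD; last by apply: blM => //; exact: bl_reginv.
apply: blM; last exact: blM.
by apply: blN; apply: blN; exact: blM.
Qed.

End bounded_lipschitz_fields.

Section frame_component.
Variables (tau tau' : R3 R -> R3 R) (c : R) (s : seq (R3 R)).
Hypotheses (tauF : frame n tau tau') (c0 : 0 < c).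

Let tw x := azimuthal c [seq tau z | z <- s] (tau x).
Let tD x := dazimuthal c [seq tau z | z <- s] (tau x).

(** The points of [s] are moved to the frame together with [x], so this is the component of the
    regularized field about the axis of the frame. *)
Lemma stepper_frame :
  stepper n (fun x => tw x *: gen tau tau' x) tD
    (fun d x => rot tau tau' (d * tw x) x).
Proof.
have [[tauK tau'K] tl _ tN _] := tauF.
have tS x : S x -> S (tau x) by rewrite /S /sphere /= tN.
have tB x y : tau x - tau y = tau (x - y) by rewrite -scaleN1r -tl scaleN1r.
have bt f : bl S setT (fun _ : unit => f) -> bl S setT (fun _ : unit => f \o tau).
  move=> [K K0 /(_ tt I) [fb fl]]; exists K => // _ _.
  split=> [x Sx|x y Sx Sy]; first exact/fb/tS.
  by rewrite (le_trans (fl _ _ (tS _ Sx) (tS _ Sy)))// tB tN.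
apply: (stepper_rot n0 tauF).
- by apply: (bt (azimuthal c [seq tau z | z <- s])); exact: bl_azimuthal.
- by apply: (bt (dazimuthal c [seq tau z | z <- s])); exact: bl_dazimuthal.
- move=> x _; rewrite /tw /rot.
  under eq_fun do rewrite tau'K.
  exact: is_derive_azimuthal.
Qed.

End frame_component.

Let turn : R3 R -> R3 R := swap13 \o rot3 (pi / 2).
Let turn' : R3 R -> R3 R := rot3 (- (pi / 2)) \o swap13.

Let turnE x : turn x = (x.2, x.1.1, - x.1.2).
Proof.
by rewrite /turn /= /swap13 /rot3 /= cos_pihalf sin_pihalf; apply: R3_eqP => /=; ring.
Qed.

Let turn'E x : turn' x = (x.1.2, - x.2, x.1.1).
Proof.
rewrite /turn' /= /swap13 /rot3 /= cosN sinN cos_pihalf sin_pihalf.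
by apply: R3_eqP => /=; ring.
Qed.

(** With G_1, G_2, G_3 the infinitesimal rotations about the axes, a tangent vector w at x satisfies
    r^2 w = sum_i (w . G_i x) G_i x; so the three components add up to the field wherever every gap
    is at least [c]. *)
Lemma stepper_field c s : 0 < c ->
  exists v D E, stepper n v D E /\
    forall x, S x -> (forall z, z \in s -> S z /\ c <= gap z x) ->
      v x = field s x /\ D x = (size s)%:R / (2 * r ^+ 2).
Proof.
move=> c0.
have st1 := stepper_frame s (frame_id n) c0.
have st2 := stepper_frame s (frame_swap13 n0) c0.
have st3 := stepper_frame s (frame_turn n0) c0.
have st := stepper_comp n0 (stepper_comp n0 st1 st2) st3.
do 3 eexists; split; first exact: st.
move=> x Sx sx; rewrite /=.
have xx : dot x x = r ^+ 2 by exact/(sphereP n0).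
have r2 : r ^+ 2 != 0 by rewrite sqrf_eq0 gt_eqF.
rewrite /azimuthal /dazimuthal map_id !big_map /field; split.
- rewrite !scaler_suml -!big_split /=.
  apply: eq_big_seq => z zs; have [Sz cz] := sx _ zs.
  have gt : gap (turn z) (turn x) = gap z x.
    by rewrite /gap !turnE /dot /=; ring.
  rewrite -/turn gt (_ : gap (swap13 z) (swap13 x) = gap z x); last first.
    by rewrite /gap dot_swap13.
  rewrite (reginvE c0 cz) /gen -/turn' !turnE turn'E.
  have g0 : gap z x != 0 by rewrite gt_eqF// (lt_le_trans c0).
  have rE : r ^+ 2 = x.1.1 ^+ 2 + x.1.2 ^+ 2 + x.2 ^+ 2.
    by rewrite -xx /dot; ring.
  move: (gap z x) g0 => g g0.
  rewrite /swap13 /gen3 /dot.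
  move: r2; rewrite rE => r2.
  have r2g : (x.1.1 ^+ 2 + x.1.2 ^+ 2 + x.2 ^+ 2 != 0) && (g != 0) by rewrite r2.
  apply: R3_eqP => /=; rewrite /GRing.scale /= ?cos_pihalf ?sin_pihalf; field.
  - exact r2g.
  - exact r2g.
  - exact r2g.
- rewrite -!big_split /=.
  transitivity (\sum_(z <- s) (2 * r ^+ 2)^-1); last first.
    by rewrite big_const_seq count_predT iter_addr_0 [RHS]mulr_natl.
  apply: eq_big_seq => z zs; have [Sz cz] := sx _ zs.
  have zz : dot z z = r ^+ 2 by exact/(sphereP n0).
  have gt : gap (turn z) (turn x) = gap z x.
    by rewrite /gap !turnE /dot /=; ring.
  rewrite -[swap13 (rot3 _ z)]/(turn z) -[swap13 (rot3 _ x)]/(turn x) gt (_ : gap (swap13 z) (swap13 x) = gap z x); last first.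
    by rewrite /gap dot_swap13.
  rewrite (reginvE c0 cz) (dreginvE cz) !turnE.
  have g0 : gap z x != 0 by rewrite gt_eqF// (lt_le_trans c0).
  rewrite -!mulrDl -[RHS]mul1r; congr (_ / _).
  have gE : gap z x = r ^+ 2 - dot x z by [].
  move: (gap z x) g0 gE => g g0 gE.
  (* By Lagrange's identity the squares sum to |x|^2 |z|^2 - (x . z)^2. *)
  pose P := dot z (gen3 x) ^+ 2 + dot (swap13 z) (gen3 (swap13 x)) ^+ 2 +
    dot (z.2, z.1.1, - z.1.2) (gen3 (x.2, x.1.1, - x.1.2)) ^+ 2.
  have PE : P = dot x x * dot z z - dot x z ^+ 2.
    by rewrite /P /dot /gen3 /swap13 /=; ring.
  (* The squares of the three generators sum to -2 times the identity. With |x| = |z| = r and x . z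
     = r^2 - g, the total P / g^2 + Q / g equals 1, whence 1 / (2 r^2) per point. *)
  pose Q := dot z (gen3 (gen3 x)) + dot (swap13 z) (gen3 (gen3 (swap13 x))) +
    dot (z.2, z.1.1, - z.1.2) (gen3 (gen3 (x.2, x.1.1, - x.1.2))).
  have QE : Q = - 2 * dot x z.
    by rewrite /Q /dot /gen3 /swap13 /=; ring.
  transitivity (g^-1 ^+ 2 * P + g^-1 * Q); first by rewrite /P /Q; ring.
  rewrite PE QE xx zz (_ : dot x z = r ^+ 2 - g); last by rewrite gE; ring.
  by field.
Qed.

End vector_field.

(** * The force field and its solutions *)

Section curves.
Context {R : realType}.
Implicit Types (c : R -> R3 R) (t : R) (v : R3 R).

Lemma is_derive_cvgP (V : normedModType R) (f : R -> V) t (df : V) :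
  is_derive t (1 : R) f df <->
  h^-1 *: (f (h *: (1 : R) + t) - f t) @[h --> (0 : R)^'] --> df.
Proof.
split=> [[dc <-]|cv].
  by apply: dc.
apply: DeriveDef; first by apply/cvg_ex; exists df.
exact/cvg_lim.
Qed.

Lemma is_derive_coord c t v : is_derive t (1 : R) c v ->
  [/\ is_derive t (1 : R) (fun u => (c u).1.1) v.1.1,
      is_derive t (1 : R) (fun u => (c u).1.2) v.1.2 &
      is_derive t (1 : R) (fun u => (c u).2) v.2].
Proof.
move=> /is_derive_cvgP cv; split; apply/is_derive_cvgP.
- by apply: (cvg_comp _ (fun x : R3 R => x.1.1) cv); apply: (cvg_comp _ _ cvg_fst cvg_fst).
- by apply: (cvg_comp _ (fun x : R3 R => x.1.2) cv); apply: (cvg_comp _ _ cvg_fst cvg_snd).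
- by apply: (cvg_comp _ (fun x : R3 R => x.2) cv); apply: cvg_snd.
Qed.

Lemma is_derive_R3 c t v :
  is_derive t (1 : R) (fun u => (c u).1.1) v.1.1 ->
  is_derive t (1 : R) (fun u => (c u).1.2) v.1.2 ->
  is_derive t (1 : R) (fun u => (c u).2) v.2 ->
  is_derive t (1 : R) c v.
Proof.
move=> /is_derive_cvgP c1 /is_derive_cvgP c2 /is_derive_cvgP c3.
apply/is_derive_cvgP; case: v c1 c2 c3 => -[v1 v2] v3 c1 c2 c3.
exact: (cvg_pair (cvg_pair c1 c2) c3).
Qed.

Lemma is_derive_dot c e t v w : is_derive t (1 : R) c v -> is_derive t (1 : R) e w ->
  is_derive t (1 : R) (fun u => dot (c u) (e u)) (dot v (e t) + dot (c t) w).
Proof.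
move=> /is_derive_coord[c1 c2 c3] /is_derive_coord[e1 e2 e3].
rewrite /dot.
have := is_deriveD (is_deriveD (is_deriveM c1 e1) (is_deriveM c2 e2)) (is_deriveM c3 e3).
move=> h; apply: (is_derive_eq h); rewrite /GRing.scale /=; ring.
Qed.

Lemma is_derive_shift (c : R -> R3 R) (t a : R) v :
  is_derive (t + a) (1 : R) c v -> is_derive t (1 : R) (fun u => c (u + a)) v.
Proof.
move=> /is_derive_cvgP h; apply/is_derive_cvgP.
by under eq_fun do rewrite -addrA.
Qed.

End curves.

Section force_field.
Context {R : realType} (n : nat) (n0 : (0 < n)%N).
Let r : R := sphere_radius n.
Let S : set (R3 R) := sphere n.
Variable s : seq (R3 R).
Hypotheses (us : uniq s) (sS : forall z, z \in s -> S z).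

Let r0 : 0 < r. Proof. exact: sphere_radius_gt0. Qed.

Lemma gap_dist x z : S x -> S z -> dot (x - z) (x - z) = 2 * gap n z x.
Proof.
move=> /(sphereP n0) xx /(sphereP n0) zz.
by rewrite dotBl !dotBr /gap (dotC z x) xx zz -/r; ring.
Qed.

Lemma gap_ge0 x z : S x -> S z -> 0 <= gap n z x.
Proof.
by move=> Sx Sz; rewrite -(@pmulr_rge0 _ 2)// -gap_dist// dot_ge0.
Qed.

Lemma gap_gt0 x z : S x -> S z -> x <> z -> 0 < gap n z x.
Proof.
move=> Sx Sz xz; rewrite lt_def gap_ge0// andbT.
apply/eqP => g0; apply: xz; have := gap_dist Sx Sz.
by rewrite g0 mulr0 => /eqP; rewrite dot_eq0 subr_eq0 => /eqP.
Qed.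

Lemma dot_field x : S x -> dot x (field n s x) = 0.
Proof.
move=> /(sphereP n0) xx; rewrite dot_sumr big1// => z _.
rewrite dotZr dotBr dotZr xx -/r divfK ?subrr ?mulr0//.
by rewrite sqrf_eq0 gt_eqF.
Qed.

Lemma ln_sqrt (a : R) : 0 <= a -> ln (Num.sqrt a) = 2^-1 * ln a.
Proof.
rewrite le_eqVlt => /predU1P[<-|a0]; first by rewrite sqrtr0 !ln0 ?mulr0.
have s0 : 0 < Num.sqrt a by rewrite sqrtr_gt0.
have : ln a = ln (Num.sqrt a) + ln (Num.sqrt a).
  by rewrite -lnM ?posrE// -expr2 sqr_sqrtr// ltW.
lra.
Qed.

Lemma potentialE x :
  potential [set` s] x = \sum_(z <- s) 2^-1 * ln (dot (x - z) (x - z)).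
Proof.
rewrite /potential -fsbig_seq//.
by apply: eq_bigr => z _; rewrite /enorm ln_sqrt// dot_ge0.
Qed.

Lemma sphere_velocity (c : R -> R3 R) (t : R) v : (forall u, S (c u)) ->
  is_derive t (1 : R) c v -> dot (c t) v = 0.
Proof.
move=> Sc dc; have := is_derive_dot dc dc.
rewrite (_ : (fun u => dot (c u) (c u)) = cst (r ^+ 2)); last first.
  by apply/funext => u; have /(sphereP n0) := Sc u.
move=> /(@derive_val _ _ _ _ _ _ _); rewrite derive_cst (dotC v); lra.
Qed.

(** The potential is a sum of halves of log |x - z|^2, and |x - z|^2 = 2 gap. Velocities are
    orthogonal to [x], so only [z] survives in the inner products. *)
Lemma is_gradient_field x : (S `\` [set` s]) x ->
  is_gradient n (potential [set` s]) x (- field n s x).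
Proof.
move=> [Sx xs]; split; first by rewrite dotNr dot_field// oppr0.
move=> c v Sc c0 dc.
have xv : dot x v = 0 by rewrite -c0; exact: sphere_velocity Sc dc.
rewrite (_ : potential [set` s] \o c =
    (fun t => \sum_(z <- s) 2^-1 * ln (dot (c t - z) (c t - z)))); last first.
  by apply/funext => t /=; rewrite potentialE.
rewrite dotNl dotC dot_sumr -sumrN.
have xsz z : z \in s -> x <> z by move=> zs xz; apply: xs; rewrite xz.
rewrite (eq_big_seq (fun z => 2^-1 * ((2 * gap n z x)^-1 * (- 2 * dot z v)))); last first.
  move=> z zs; rewrite dotZr dotBr dotZr (dotC v x) xv mulr0 subr0 (dotC v z).
  by field; rewrite gt_eqF// gap_gt0//; [exact: sS|exact: xsz].
apply: is_derive_sum_seq => z zs.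
  have dcz : is_derive (0 : R) (1 : R) (fun t => c t - z) v.
    have := is_deriveB dc (is_derive_cst z (0 : R) (1 : R)).
    by rewrite subr0.
  have dd := is_derive_dot dcz dcz.
  have g0 : 0 < dot (c 0 - z) (c 0 - z).
    by rewrite c0 gap_dist//; [rewrite mulr_gt0// gap_gt0//; [exact: sS|exact: xsz]|exact: sS].
  have dl := @is_derive1_comp R (@ln R) (fun t => dot (c t - z) (c t - z)) 0 _ _ (is_derive1_ln g0) dd.
  have := is_deriveZ (2^-1 : R) dl.
  move=> h; apply: (is_derive_eq h); rewrite /GRing.scale /= c0 gap_dist//; last exact: sS.
  by rewrite dotBr dotBl (dotC v x) xv (dotC v z); ring.
Qed.

(** The great circle through [x] in the direction [v], with angular speed |v| / r. *)
Lemma sphere_curve x v : S x -> dot x v = 0 ->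
  exists c : R -> R3 R, [/\ forall t, S (c t), c 0 = x & is_derive (0 : R) (1 : R) c v].
Proof.
move=> Sx xv; have xx : dot x x = r ^+ 2 by exact/(sphereP n0).
have [->|v0] := eqVneq v 0.
  by exists (fun=> x); split=> //; exact: is_derive_cst.
pose b := enorm v / r.
have e0 : 0 < enorm v by rewrite lt_def enorm_ge0 enorm_eq0 v0.
have b0 : b != 0 by rewrite gt_eqF// divr_gt0.
exists (fun t => cos (b * t) *: x + (b^-1 * sin (b * t)) *: v); split.
- move=> t; apply/(sphereP n0); rewrite dotDl !dotDr !dotZl !dotZr (dotC v x) xv xx -/r.
  have -> : dot v v = b ^+ 2 * r ^+ 2.
    by rewrite -sqr_enorm /b expr_div_n divfK// sqrf_eq0 gt_eqF.
  have h := cos2Dsin2 (b * t).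
  transitivity (r ^+ 2 * (cos (b * t) ^+ 2 + sin (b * t) ^+ 2)); last by rewrite h mulr1.
  by field.
- by rewrite !mulr0 cos0 sin0 mulr0 scale1r scale0r addr0.
have dc (p q : R) : is_derive (0 : R) (1 : R)
    (fun t => cos (b * t) * p + (b^-1 * sin (b * t)) * q) q.
  apply: is_derive_eq; rewrite /GRing.scale /= !mulr0 cos0 sin0.
  by field.
by apply: is_derive_R3; exact: dc.
Qed.

(** Both gradients are tested on a curve with velocity g1 - g2. *)
Lemma is_gradient_unique f x g1 g2 : S x ->
  is_gradient n f x g1 -> is_gradient n f x g2 -> g1 = g2.
Proof.
move=> Sx [xg1 G1] [xg2 G2].
have xv : dot x (g1 - g2) = 0 by rewrite dotBr xg1 xg2 subrr.
have [c [Sc c0 dc]] := sphere_curve Sx xv.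
have [_ d1] := G1 c _ Sc c0 dc; have [_ d2] := G2 c _ Sc c0 dc.
apply/eqP; rewrite -subr_eq0 -dot_eq0 dotBl -d1 -d2 subrr.
exact: eqxx.
Qed.

Lemma forceE x : (S `\` [set` s]) x -> force n [set` s] x = field n s x.
Proof.
move=> xs; have Gx := is_gradient_field xs.
rewrite /force /gradient; case: xgetP => [g _ Gg|/(_ (- field n s x))].
  by rewrite (is_gradient_unique xs.1 Gg Gx) opprK.
by [].
Qed.

End force_field.

Lemma is_derive_nonincreasing {R : realType} (f df : R -> R) (a b : R) : a <= b ->
  (forall t : R, a <= t <= b -> is_derive t (1 : R) f (df t)) ->
  (forall t : R, a <= t <= b -> df t <= 0) -> f b <= f a.
Proof.
move=> ab dE df0.
have [||c cab h] := @MVT_segment R f df a b ab.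
- by move=> t; rewrite in_itv/= => /andP[? ?]; apply: dE; rewrite !ltW.
- by apply: derivable_within_continuous => t; rewrite in_itv/= => /dE[].
by rewrite -subr_le0 h mulr_le0_ge0 ?subr_ge0// df0.
Qed.

Section solutions.
Context {R : realType} (n : nat) (n0 : (0 < n)%N).
Let r : R := sphere_radius n.
Let S : set (R3 R) := sphere n.
Variable s : seq (R3 R).
Hypothesis sS : forall z, z \in s -> S z.

Let F : R3 R -> R3 R := field n s.
Let U : set (R3 R) := S `\` [set` s].

Let r0 : 0 < r. Proof. exact: sphere_radius_gt0. Qed.

(** Up to a constant factor, exp (2 U) for the potential U. Unlike U it is Lipschitz on the whole
    sphere, its zeros at [s] included. *)
Definition gaps x : R := \prod_(z <- s) gap n z x.

Definition superlevel (c : R) : set (R3 R) := [set x | S x /\ c <= gaps x].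

Definition solution (A : set R) (X : R -> R3 R) :=
  forall t, A t -> U (X t) /\ is_derive t (1 : R) X (F (X t)).

Lemma sub_solution (A B : set R) X : A `<=` B -> solution B X -> solution A X.
Proof. by move=> AB XB t /AB /XB. Qed.

Lemma gaps_gt0 x : U x -> 0 < gaps x.
Proof.
move=> [Sx xs]; rewrite /gaps big_seq prodr_gt0// => z zs.
by apply: (gap_gt0 n0) => //; [exact: sS|move=> xz; apply: xs; rewrite xz].
Qed.

Lemma gaps_eq0 x : S x -> [set` s] x -> gaps x = 0.
Proof.
move=> Sx /= xs; rewrite /gaps (big_rem x)//= /gap.
by have /(sphereP n0) -> := Sx; rewrite subrr mul0r.
Qed.

Lemma superlevel_U c x : 0 < c -> superlevel c x -> U x.
Proof.
move=> c0 [Sx cx]; split=> // xs; move: cx; rewrite gaps_eq0//.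
by rewrite leNgt c0.
Qed.

Lemma superlevel_le c c' : c <= c' -> superlevel c' `<=` superlevel c.
Proof. by move=> cc x [Sx cx]; split=> //; exact: le_trans cx. Qed.

Lemma gaps_bl : exists2 K : R, 0 <= K &
  forall x y, S x -> S y -> `|gaps x - gaps y| <= K * enorm (x - y).
Proof.
have [K K0 /(_ tt I) [_ Kl]] : bl S setT (fun _ : unit => gaps).
  by apply: bl_prod => z; exact: bl_gap.
by exists K.
Qed.

Lemma superlevel_gap c : 0 < c -> exists2 c', 0 < c' &
  forall x, superlevel c x -> forall z, z \in s -> c' <= gap n z x.
Proof.
(* A gap is at most 2 r^2. The added 1 makes B >= 1, so that the power [size s] also bounds the
   product of the [size s - 1] other factors. *)
move=> c0; pose B := 1 + 2 * r ^+ 2.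
have B1 : 1 <= B by rewrite lerDl mulr_ge0// sqr_ge0.
have B0 : 0 < B by exact: lt_le_trans B1.
exists (c / B ^+ size s); first by rewrite divr_gt0// exprn_gt0.
move=> x [Sx cx] z zs.
have gB y : y \in s -> 0 <= gap n y x <= B.
  move=> ys; rewrite (gap_ge0 n0 Sx (sS ys))/=.
  have := normr_dot_le x y; rewrite (Sx : enorm x = r) (sS ys : enorm y = r).
  rewrite ler_norml -expr2 => /andP[h _]; rewrite /gap /B -/r; lra.
have restB (l : seq (R3 R)) : {subset l <= s} ->
    0 <= \prod_(y <- l) gap n y x <= B ^+ size l.
  elim: l => [_|y l IH ls]; first by rewrite big_nil expr0 ler01 lexx.
  have /andP[y0 yB] : 0 <= gap n y x <= B by apply: gB; apply: ls; rewrite inE eqxx.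
  have /andP[l0 lB] := IH (fun u ul => ls u (mem_behead (s := y :: l) ul)).
  by rewrite big_cons mulr_ge0//= exprS ler_pM.
have /andP[p0 pB] := restB _ (mem_subseq (rem_subseq z s)).
rewrite ler_pdivrMr ?exprn_gt0//.
move: cx; rewrite /gaps (big_rem z)//= => /le_trans; apply.
have /andP[g0 _] := gB _ zs.
rewrite ler_wpM2l// (le_trans pB)// size_rem//.
by rewrite ler_weXn2l// leq_pred.
Qed.

(** F is tangent, so its inner product with the tangential part of [z] is F . z. *)
Lemma dot_field_gap x : S x ->
  \sum_(z <- s) (gap n z x)^-1 * dot (F x) z = 2 * dot (F x) (F x).
Proof.
move=> Sx; rewrite [in X in _ = 2 * dot _ X]/F /field dot_sumr mulr_sumr.
apply: eq_bigr => z _; rewrite dotZr dotBr dotZr (dotC _ x) dot_field//.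
by rewrite mulr0 subr0 invfM mulrA mulrA divff ?mul1r// pnatr_eq0.
Qed.

(** Along a solution the logarithm of [gaps] has derivative -2 |F|^2. *)
Lemma gaps_nonincreasing X (a b : R) : a <= b -> solution `[a, b] X ->
  gaps (X b) <= gaps (X a).
Proof.
move=> ab sX.
pose W (t : R) := \sum_(z <- s) ln (gap n z (X t)).
have dW (t : R) : a <= t <= b -> is_derive t (1 : R) W (- (2 * dot (F (X t)) (F (X t)))).
  move=> tab; have [|[SX Xs] dX] := sX t; first by rewrite /= in_itv.
  rewrite -dot_field_gap// -sumrN; apply: is_derive_sum_seq => z zs.
  have g0 : 0 < gap n z (X t).
    by apply: (gap_gt0 n0) => //; [exact: sS|move=> xz; apply: Xs; rewrite xz].
  have dd := is_derive_dot dX (is_derive_cst z t (1 : R)).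
  have dg : is_derive t (1 : R) (fun u => gap n z (X u)) (- dot (F (X t)) z).
    have := is_deriveB (is_derive_cst (r ^+ 2 : R) t (1 : R)) dd.
    by move=> h; apply: (is_derive_eq h); rewrite (dotC _ 0) dot0l addr0 sub0r.
  have dl := @is_derive1_comp R (@ln R) _ t _ _ (is_derive1_ln g0) dg.
  by apply: (is_derive_eq dl); rewrite mulrN.
have Wba : W b <= W a.
  apply: (is_derive_nonincreasing ab dW) => t _.
  by rewrite oppr_le0 mulr_ge0// dot_ge0.
have VE (t : R) : a <= t <= b -> gaps (X t) = expR (W t).
  move=> tab; have [|[SX Xs] _] := sX t; first by rewrite /= in_itv.
  rewrite /W expR_sum /gaps; apply: eq_big_seq => z zs; rewrite lnK// posrE.
  by apply: (gap_gt0 n0) => //; [exact: sS|move=> xz; apply: Xs; rewrite xz].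
by rewrite !VE ?ler_expR ?lexx ?ab.
Qed.

(** Control at the final time gives control at all earlier times; hence the estimates below on a
    solution assume it at the end of the interval only. *)
Lemma solution_superlevel X (a b c : R) : a <= b -> solution `[a, b] X ->
  superlevel c (X b) -> forall t, a <= t <= b -> superlevel c (X t).
Proof.
move=> ab sX [SX cX] t /andP[at_ tb]; split.
  by have [|[]] := sX t; first by rewrite /= in_itv/= at_.
apply: le_trans cX _; apply: gaps_nonincreasing => //.
by apply: sub_solution sX => u /=; rewrite !in_itv/= => /andP[tu ->]; rewrite (le_trans at_).
Qed.

Section superlevel_bounds.
Variables (c M : R).
Hypotheses (c0 : 0 < c) (M0 : 0 <= M).
Hypothesis Fb : forall x, superlevel c x -> enorm (F x) <= M.
Hypothesis Fl : forall x y, superlevel c x -> superlevel c y ->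
  enorm (F x - F y) <= M * enorm (x - y).

Let sq (X Y : R -> R3 R) t := dot (X t - Y t) (X t - Y t).

Let dsq X Y (a b : R) : solution `[a, b] X -> solution `[a, b] Y ->
  (forall t, a <= t <= b -> superlevel c (X t) /\ superlevel c (Y t)) ->
  forall t, a <= t <= b -> exists2 d, is_derive t (1 : R) (sq X Y) d &
    `|d| <= 2 * M * sq X Y t.
Proof.
move=> sX sY cXY t tab; have [cX cY] := cXY t tab.
have [|_ dX] := sX t; first by rewrite /= in_itv.
have [|_ dY] := sY t; first by rewrite /= in_itv.
have dB : is_derive t (1 : R) (fun u => X u - Y u) (F (X t) - F (Y t)).
  exact: is_deriveB.
exists (dot (F (X t) - F (Y t)) (X t - Y t) + dot (X t - Y t) (F (X t) - F (Y t))).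
  exact: is_derive_dot.
rewrite [X in _ + X]dotC.
have -> (q : R) : q + q = 2 * q by ring.
rewrite normrM ger0_norm// -mulrA ler_wpM2l//.
rewrite (le_trans (normr_dot_le _ _))//.
rewrite (le_trans (ler_wpM2r (enorm_ge0 _) (Fl cX cY)))//.
by rewrite -mulrA -expr2 sqr_enorm.
Qed.

(* e is 1 (resp. -1) when going forward (resp. backward) in time. *)
Let gronwall_sq X Y (a b e : R) : a <= b -> `|e| = 1 ->
  solution `[a, b] X -> solution `[a, b] Y ->
  (forall t, a <= t <= b -> superlevel c (X t) /\ superlevel c (Y t)) ->
  e * (expR (- e * (2 * M) * b) * sq X Y b) <= e * (expR (- e * (2 * M) * a) * sq X Y a).
Proof.
move=> ab e1 sX sY cXY.
have ee : e * e = 1.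
  by rewrite -expr2 -(real_normK (num_real e)) e1 expr1n.
have H := dsq sX sY cXY.
pose d t := if pselect (a <= t <= b) is left h then projT1 (cid2 (H t h)) else 0.
have dE (t : R) : a <= t <= b -> is_derive t (1 : R) (sq X Y) (d t) /\ `|d t| <= 2 * M * sq X Y t.
  by move=> h; rewrite /d; case: pselect => // h'; case: cid2.
pose f t := e * (expR (- e * (2 * M) * t) * sq X Y t).
pose df t := e * (expR (- e * (2 * M) * t) * d t + sq X Y t * (expR (- e * (2 * M) * t) * (- e * (2 * M)))).
apply: (@is_derive_nonincreasing R f df a b ab) => t tab.
  have [dt _] := dE t tab.
  have de : is_derive t (1 : R) (fun t => expR (- e * (2 * M) * t))
      (expR (- e * (2 * M) * t) * (- e * (2 * M))).
    apply: is_derive_eq; rewrite /GRing.scale /=; ring.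
  exact: is_deriveZ (is_deriveM de dt).
have [_ dt] := dE t tab.
have -> : df t = expR (- e * (2 * M) * t) * (e * d t - e * e * (2 * M * sq X Y t)).
  by rewrite /df; ring.
rewrite ee mul1r pmulr_rle0 ?expR_gt0// subr_le0.
by rewrite (le_trans (ler_norm _))// normrM e1 mul1r.
Qed.

(** The squared distance q satisfies |q'| <= 2 M q, so exp (-2 M t) q is nonincreasing and exp (2 M
    t) q is nondecreasing. *)
Lemma gronwall X Y (a b : R) : a <= b ->
  solution `[a, b] X -> solution `[a, b] Y ->
  (forall t, a <= t <= b -> superlevel c (X t) /\ superlevel c (Y t)) ->
  enorm (X b - Y b) <= expR (M * (b - a)) * enorm (X a - Y a) /\
  enorm (X a - Y a) <= expR (M * (b - a)) * enorm (X b - Y b).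
Proof.
move=> ab sX sY cXY.
have eE : expR (M * (b - a)) ^+ 2 = expR (2 * M * b) * expR (- (2 * M * a)).
  by rewrite -expRM_natl -expRD; congr expR; ring.
have h1 := gronwall_sq ab (normr1 _) sX sY cXY.
have eN1 : `|- 1 : R| = 1 by rewrite normrN1.
have h2 := gronwall_sq ab eN1 sX sY cXY.
have c1 (t : R) : expR (2 * M * t) * expR (- (2 * M * t)) = 1 by exact: expRxMexpNx_1.
have p1 (t : R) : 0 < expR t by exact: expR_gt0.
split; rewrite le_enorm ?mulr_ge0 ?expR_ge0 ?enorm_ge0// exprMn sqr_enorm eE.
  move: h1; rewrite !mul1r !mulN1r !mulNr => h1.
  have := ler_wpM2l (ltW (p1 (2 * M * b))) h1.
  by rewrite !mulrA c1 mul1r -/(sq X Y b) -/(sq X Y a).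
move: h2; rewrite !mulN1r opprK lerN2 !mul1r => h2.
have := ler_wpM2l (ltW (p1 (- (2 * M * a)))) h2.
rewrite !mulrA (mulrC (expR (- _))) c1 mul1r -/(sq X Y b) -/(sq X Y a).
by rewrite (mulrC (expR (- _))).
Qed.

(** The mean value theorem is applied to each coordinate, hence the factor 3. *)
Lemma solution_speed X (a b : R) : a <= b -> solution `[a, b] X ->
  superlevel c (X b) -> enorm (X b - X a) <= 3 * M * (b - a).
Proof.
move=> ab sX cX; have cXt := solution_superlevel ab sX cX.
have dX t : a <= t <= b -> is_derive t (1 : R) X (F (X t)).
  by move=> tab; have [|_] := sX t; first by rewrite /= in_itv.
have comp (p : R3 R -> R) : (forall x, `|p x| <= enorm x) ->
    (forall t, a <= t <= b -> is_derive t (1 : R) (p \o X) (p (F (X t)))) ->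
    `|p (X b) - p (X a)| <= M * (b - a).
  move=> pe dp.
  have [||t] := @MVT_segment R (p \o X) (fun t => p (F (X t))) a b ab.
  - by move=> t; rewrite in_itv/= => /andP[? ?]; apply: dp; rewrite !ltW.
  - by apply: derivable_within_continuous => t; rewrite in_itv/= => /dp[].
  rewrite in_itv/= => tab /= ->; rewrite normrM (ger0_norm (_ : 0 <= b - a)) ?subr_ge0//.
  by rewrite ler_wpM2r ?subr_ge0// (le_trans (pe _))// Fb//; exact: cXt.
apply: le_trans (enorm_le_coord _) _ => /=.
have h1 := comp (fun x => x.1.1) (fun x => let: And3 h _ _ := enorm_ge_coord x in h)
  (fun t tab => let: And3 h _ _ := is_derive_coord (dX t tab) in h).
have h2 := comp (fun x => x.1.2) (fun x => let: And3 _ h _ := enorm_ge_coord x in h)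
  (fun t tab => let: And3 _ h _ := is_derive_coord (dX t tab) in h).
have h3 := comp (fun x => x.2) (fun x => let: And3 _ _ h := enorm_ge_coord x in h)
  (fun t tab => let: And3 _ _ h := is_derive_coord (dX t tab) in h).
by move: h1 h2 h3 => /=; lra.
Qed.

(** In each coordinate the mean value theorem gives the velocity at an intermediate time, which
    differs from that at time 0 by at most M times 3 M d; three coordinates make 9. *)
Lemma backward_euler X (d : R) : 0 <= d -> solution `[(- d), 0] X ->
  superlevel c (X 0) ->
  enorm (X (- d) - (X 0 - d *: F (X 0))) <= 9 * M ^+ 2 * d ^+ 2.
Proof.
move=> d0 sX cX.
have nd : - d <= 0 by rewrite oppr_le0.
have cXt := solution_superlevel nd sX cX.
have dX t : - d <= t <= 0 -> is_derive t (1 : R) X (F (X t)).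
  by move=> tab; have [|_] := sX t; first by rewrite /= in_itv.
have comp (p : R3 R -> R) : (forall x, `|p x| <= enorm x) ->
    (forall x y, p (x - y) = p x - p y) ->
    (forall t, - d <= t <= 0 -> is_derive t (1 : R) (p \o X) (p (F (X t)))) ->
    `|p (X (- d)) - (p (X 0) - d * p (F (X 0)))| <= 3 * M ^+ 2 * d ^+ 2.
  move=> pe pB dp.
  have [||t] := @MVT_segment R (p \o X) (fun t => p (F (X t))) (- d) 0 nd.
  - by move=> t; rewrite in_itv/= => /andP[? ?]; apply: dp; rewrite !ltW.
  - by apply: derivable_within_continuous => t; rewrite in_itv/= => /dp[].
  rewrite in_itv/= => /andP[dt t0]; rewrite sub0r opprK => /= e.
  have -> : p (X (- d)) - (p (X 0) - d * p (F (X 0))) = d * p (F (X 0) - F (X t)).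
    by rewrite pB; move: e; lra.
  rewrite normrM (ger0_norm d0).
  have cXt' : superlevel c (X t) by apply: cXt; rewrite dt.
  have h1 : enorm (F (X 0) - F (X t)) <= M * (3 * M * d).
    rewrite (le_trans (Fl cX cXt'))// ler_wpM2l//.
    have sX' : solution `[t, 0] X.
      by apply: sub_solution sX => u /=; rewrite !in_itv/= => /andP[tu ->]; rewrite (le_trans dt).
    rewrite (le_trans (solution_speed t0 sX' cX))//.
    by rewrite sub0r ler_wpM2l ?mulr_ge0// lerNl.
  rewrite (@le_trans _ _ (d * (M * (3 * M * d))))//.
    by rewrite ler_wpM2l// (le_trans (pe _)).
  by rewrite le_eqVlt; apply/orP; left; apply/eqP; ring.
apply: le_trans (enorm_le_coord _) _ => /=.
have h1 := comp (fun x => x.1.1) (fun x => let: And3 h _ _ := enorm_ge_coord x in h)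
  (fun _ _ => erefl) (fun t tab => let: And3 h _ _ := is_derive_coord (dX t tab) in h).
have h2 := comp (fun x => x.1.2) (fun x => let: And3 _ h _ := enorm_ge_coord x in h)
  (fun _ _ => erefl) (fun t tab => let: And3 _ h _ := is_derive_coord (dX t tab) in h).
have h3 := comp (fun x => x.2) (fun x => let: And3 _ _ h := enorm_ge_coord x in h)
  (fun _ _ => erefl) (fun t tab => let: And3 _ _ h := is_derive_coord (dX t tab) in h).
by move: h1 h2 h3 => /=; rewrite /GRing.scale /=; lra.
Qed.

End superlevel_bounds.

Hypothesis szs : size s = n.

(* The vector field has divergence 2 pi. *)
Lemma stepper_superlevel c : 0 < c -> exists v D E,
  stepper n v D E /\ forall x, superlevel c x -> v x = F x /\ D x = 2 * pi.
Proof.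
move=> c0; have [c' c'0 gc] := superlevel_gap c0.
have [v [D [E [st vD]]]] := stepper_field n0 s c'0.
exists v, D, E; split=> // x cx.
have [|-> ->] := vD x cx.1; first by move=> z zs; split; [exact: sS|exact: gc cx _ zs].
split=> //; rewrite szs /sphere_radius sqr_sqrtr; last first.
  by rewrite divr_ge0// mulr_ge0// pi_ge0.
have p0 : (pi : R) != 0 by rewrite gt_eqF// pi_gt0.
have nn : (n%:R : R) != 0 by rewrite pnatr_eq0 -lt0n.
have pqE (p q : R) : p != 0 -> q != 0 -> q / (2 * (q / (4 * p))) = 2 * p.
  by move=> ? ?; field; apply/andP; split.
exact: pqE.
Qed.

(** On a superlevel set the field coincides with a regularized one, which is bounded and Lipschitz
    on the whole sphere. *)
Lemma field_bounds c : 0 < c -> exists M, [/\ 0 <= M,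
  forall x, superlevel c x -> enorm (F x) <= M &
  forall x y, superlevel c x -> superlevel c y ->
    enorm (F x - F y) <= M * enorm (x - y)].
Proof.
move=> /stepper_superlevel[v [D [E [[d0 [C [_ C0 _ [vb vl] _]]] vD]]]].
exists C; split=> // [x cx|x y cx cy].
  by have [<- _] := vD _ cx; exact: vb cx.1.
by have [<- _] := vD _ cx; have [<- _] := vD _ cy; apply: vl; [exact: cx.1|exact: cy.1].
Qed.

(** Both solutions stay in the superlevel set given by their values at the final time [b]; there
    Gronwall's inequality applies from [t0] in both directions. *)
Lemma solution_unique X Y (a b t0 : R) : a <= t0 <= b ->
  solution `[a, b] X -> solution `[a, b] Y -> X t0 = Y t0 ->
  forall t, a <= t <= b -> X t = Y t.
Proof.
move=> t0ab sX sY XY t tab.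
have bb : `[a, b]%classic b.
  by rewrite /= in_itv/= lexx andbT; case/andP: t0ab; exact: le_trans.
have ab : a <= b by case/andP: t0ab; exact: le_trans.
have [UX _] := sX _ bb; have [UY _] := sY _ bb.
pose c := Num.min (gaps (X b)) (gaps (Y b)).
have c0 : 0 < c by rewrite lt_min !gaps_gt0.
have cX : superlevel c (X b) by split; [exact: UX.1|rewrite ge_min lexx].
have cY : superlevel c (Y b) by split; [exact: UY.1|rewrite ge_min lexx orbT].
have cXt := solution_superlevel ab sX cX; have cYt := solution_superlevel ab sY cY.
have [M [M0 Fb Fl]] := field_bounds c0.
have sub x y : a <= x -> y <= b -> `[x, y] `<=` `[a, b]%classic.
  by move=> ax yb u /=; rewrite !in_itv/= => /andP[xu uy]; rewrite (le_trans ax)// (le_trans uy).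
apply/eqP; rewrite -subr_eq0 -enorm_eq0 eq_le enorm_ge0 andbT.
case/andP: t0ab => at0 t0b; case/andP: tab => at_ tb.
have [tt0|/ltW t0t] := leP t t0.
  have [] := gronwall Fl tt0 (sub_solution (sub _ _ at_ t0b) sX)
    (sub_solution (sub _ _ at_ t0b) sY).
    by move=> u /andP[? ?]; split; [apply: cXt|apply: cYt]; apply/andP; split; lra.
  by move=> _; rewrite XY subrr enorm0 mulr0.
have [] := gronwall Fl t0t (sub_solution (sub _ _ at0 tb) sX)
  (sub_solution (sub _ _ at0 tb) sY).
  by move=> u /andP[? ?]; split; [apply: cXt|apply: cYt]; apply/andP; split; lra.
by rewrite XY subrr enorm0 mulr0.
Qed.

End solutions.

(** * The flow and transported functions *)

Section flow.
Context {R : realType} (n : nat) (n0 : (0 < n)%N).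
Let r : R := sphere_radius n.
Let S : set (R3 R) := sphere n.
Variable s : seq (R3 R).
Hypotheses (us : uniq s) (sS : forall z, z \in s -> S z) (szs : size s = n).
Variables (Y : R3 R -> R -> R3 R) (tau : R3 R -> \bar R).
Hypothesis Yflow : is_flow n [set` s] Y tau.

Let F : R3 R -> R3 R := field n s.
Let U : set (R3 R) := S `\` [set` s].
Let V : R3 R -> R := gaps n s.

Lemma beforeE (b : \bar R) (t : R) : before b t = (t%:E < b)%E :> Prop.
Proof. by []. Qed.

Lemma before_itv (b : \bar R) (t u : R) : (u%:E < b)%E -> `[t, u] `<=` before b.
Proof.
move=> ub v /=; rewrite in_itv/= => /andP[_ vu].
by rewrite /before /= (le_lt_trans _ ub)// lee_fin.
Qed.

Lemma flowP x : U x ->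
  [/\ (0 < tau x)%E, Y x 0 = x & solution n s (before (tau x)) (Y x)].
Proof.
move=> Ux; have [t0 [Y0 Yc] _] := Yflow Ux; split=> // t tt.
by have [UY dY] := Yc t tt; split=> //; rewrite /F -(forceE n0 us sS).
Qed.

Lemma flow_agree x X (b : \bar R) : U x -> (0 < b)%E -> X 0 = x ->
  solution n s (before b) X -> forall t, before b t -> before (tau x) t ->
  X t = Y x t.
Proof.
move=> Ux b0 X0 sX t tb tt; have [t0 Y0 sY] := flowP Ux.
have mb : ((Num.max 0 t)%:E < b)%E by rewrite /Num.max; case: ifP.
have mt : ((Num.max 0 t)%:E < tau x)%E by rewrite /Num.max; case: ifP.
apply: (@solution_unique _ _ n0 _ sS szs _ _ (Num.min 0 t) (Num.max 0 t) 0).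
- by rewrite ge_min le_max lexx.
- exact: sub_solution (before_itv mb) sX.
- exact: sub_solution (before_itv mt) sY.
- by rewrite X0 Y0.
- by rewrite ge_min le_max lexx !orbT.
Qed.

(** By uniqueness a solution agrees with [Y x] wherever both are defined; were [b] larger than
    [tau x], it would extend [Y x], against maximality. *)
Lemma flow_maximal x X (b : \bar R) : U x -> (0 < b)%E -> X 0 = x ->
  solution n s (before b) X ->
  (b <= tau x)%E /\ forall t, before b t -> X t = Y x t.
Proof.
move=> Ux b0 X0 sX; have agree := flow_agree Ux b0 X0 sX.
suff bt : (b <= tau x)%E.
  by split=> // t tb; apply: agree => //; exact: lt_le_trans tb bt.
rewrite leNgt; apply/negP => tb; move: (tb); apply/negP; rewrite -leNgt.
have [_ _ mx] := Yflow Ux; apply: (mx b X).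
  split=> // t tb'; have [UX dX] := sX t tb'; split=> //.
  by rewrite (forceE n0 us sS).
move=> t; rewrite inE => tt; apply: agree => //.
exact: lt_trans tt tb.
Qed.

(** Maximality is used twice: for the time translate of [Y x], which starts at [Y x a], and for the
    curve of [Y x a] translated back. *)
Lemma flow_shift x (a : R) : U x -> (a%:E < tau x)%E ->
  tau (Y x a) = (tau x - a%:E)%E /\
  forall t, (t%:E < tau x - a%:E)%E -> Y (Y x a) t = Y x (t + a).
Proof.
move=> Ux ax; have [t0 Y0 sY] := flowP Ux.
have [Uq _] := sY a ax; set q := Y x a.
have [q0 Yq0 sYq] := flowP Uq.
have s1 : solution n s (before (tau x - a%:E)%E) (fun t => Y x (t + a)).
  move=> t; rewrite beforeE lteBrDr// -EFinD => tt.
  have [U1 d1] := sY _ tt; split=> //; exact: is_derive_shift.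
have b1 : (0 < tau x - a%:E)%E by rewrite lteBrDr// add0e.
have x0 : Y x (0 + a) = q by rewrite add0r.
have [le1 ag1] := flow_maximal Uq b1 x0 s1.
split; last by move=> t tt; rewrite ag1.
apply/eqP; rewrite eq_le le1 andbT.
have s2 : solution n s (before (tau q + a%:E)%E) (fun t => Y q (t + - a)).
  move=> t; rewrite beforeE -lteBlDr// -EFinB => tt.
  have [U1 d1] := sYq _ tt; split=> //; exact: is_derive_shift.
have ma : ((- a)%:E < tau x - a%:E)%E by rewrite lteBrDr// -EFinD addNr.
have b2 : (0 < tau q + a%:E)%E.
  by rewrite -lteBlDr// sub0e (lt_le_trans ma).
have q0' : Y q (0 - a) = x by rewrite sub0r -ag1 ?addNr.
have [le2 _] := flow_maximal Ux b2 q0' s2.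
by rewrite leeBrDr.
Qed.

(** The limit is the supremum of the lower bounds f t - M (e - t), each of which lies below every f
    u + M (e - u). *)
Lemma lipschitz_left_limit (f : R -> R) (M e : R) : 0 < e ->
  (forall t u, 0 <= t -> t <= u -> u < e -> `|f u - f t| <= M * (u - t)) ->
  exists l, forall t, 0 <= t < e -> `|f t - l| <= M * (e - t).
Proof.
move=> e0 fM.
pose A := [set f t - M * (e - t) | t in [set t | 0 <= t < e]].
have A0 : A !=set0 by exists (f 0 - M * (e - 0)), 0 => //=; rewrite lexx.
have fM' t u : 0 <= t < e -> 0 <= u < e -> f t - M * (e - t) <= f u + M * (e - u).
  move=> /andP[t0 te] /andP[u0 ue].
  have M0 : 0 <= M.
    have h := fM 0 (e / 2) (lexx _); have e2 : 0 < e / 2 by rewrite divr_gt0.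
    have := le_trans (normr_ge0 _) (h (ltW e2) ltac:(lra)); rewrite subr0.
    by rewrite pmulr_lge0.
  have [tu|/ltW ut] := leP t u.
    have := fM t u t0 tu ue; rewrite ler_norml => /andP[h _].
    by have := mulr_ge0 M0 (ltW (_ : 0 < e - u)); rewrite subr_gt0 => /(_ ue); lra.
  have := fM u t u0 ut te; rewrite ler_norml => /andP[_ h].
  by have := mulr_ge0 M0 (ltW (_ : 0 < e - t)); rewrite subr_gt0 => /(_ te); lra.
exists (sup A) => t te.
have h1 : f t - M * (e - t) <= sup A.
  apply: ub_le_sup; last by exists t.
  by exists (f t + M * (e - t)) => _ [u ue <-]; exact: fM'.
have h2 : sup A <= f t + M * (e - t).
  by apply: ge_sup => // _ [u ue <-]; exact: fM'.
by rewrite ler_norml; apply/andP; split; lra.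
Qed.

(** Otherwise the curve stays in a superlevel set up to time [e], is Lipschitz there and has a limit
    [p] in it. The flow provides a curve through [p], which extends [Y x] past its lifetime. *)
Lemma flow_escape x (e c : R) : U x -> 0 < c -> tau x = e%:E ->
  exists2 t, 0 <= t < e & V (Y x t) < c.
Proof.
move=> Ux c0 xe; apply: contrapT => ne.
have [t0 Y0 sY] := flowP Ux; rewrite xe lte_fin in t0; rewrite xe in sY.
have cY t : 0 <= t < e -> superlevel n s c (Y x t).
  move=> te; have [|[SY _] _] := sY t; first by case/andP: te => _; rewrite /before /= lte_fin.
  by split=> //; rewrite leNgt; apply/negP => h; apply: ne; exists t.
have [M [M0 Fb Fl]] := field_bounds n0 sS szs c0.
have sub (t u : R) : u < e -> solution n s `[t, u] (Y x).
  by move=> ue; apply: sub_solution (before_itv _) sY; rewrite lte_fin.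
have speed t u : 0 <= t -> t <= u -> u < e -> enorm (Y x u - Y x t) <= 3 * M * (u - t).
  move=> t_0 tu ue; apply: (solution_speed n0 sS Fb tu (sub _ _ ue)).
  by apply: cY; rewrite ue (le_trans t_0).
have lim (p : R3 R -> R) : (forall x, `|p x| <= enorm x) ->
    (forall x y, p x - p y = p (x - y)) ->
    exists l, forall t, 0 <= t < e -> `|p (Y x t) - l| <= 3 * M * (e - t).
  move=> pe pB; apply: (@lipschitz_left_limit (p \o Y x)) => // t u h1 h2 h3 /=.
  by rewrite pB (le_trans (pe _))// speed.
have [l1 h1] := lim (fun x => x.1.1) (fun x => let: And3 h _ _ := enorm_ge_coord x in h) (fun _ _ => erefl).
have [l2 h2] := lim (fun x => x.1.2) (fun x => let: And3 _ h _ := enorm_ge_coord x in h) (fun _ _ => erefl).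
have [l3 h3] := lim (fun x => x.2) (fun x => let: And3 _ _ h := enorm_ge_coord x in h) (fun _ _ => erefl).
pose p : R3 R := (l1, l2, l3).
have Yp t : 0 <= t < e -> enorm (Y x t - p) <= 9 * M * (e - t).
  move=> te; apply: le_trans (enorm_le_coord _) _ => /=.
  have := h1 t te; have := h2 t te; have := h3 t te; lra.
have small d : 0 < d -> exists2 t, 0 <= t < e & 9 * M * (e - t) <= d.
  move=> d0; pose k := Num.min e (d / (9 * M + 1)).
  have m0 : 0 < 9 * M + 1 by rewrite ltr_wpDl// mulr_ge0.
  have k0 : 0 < k by rewrite lt_min t0 divr_gt0.
  exists (e - k).
    by rewrite subr_ge0 /k ge_min lexx/=; move: k0; rewrite /k; lra.
  rewrite opprB addrCA subrr addr0.
  have : k * (9 * M + 1) <= d by rewrite -ler_pdivlMr// /k ge_min lexx orbT.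
  by move: k0; lra.
have Sp : S p.
  rewrite /S /sphere /=; apply/eqP; rewrite -subr_eq0 -normr_le0.
  apply/ler_addgt0Pl => d d0; rewrite addr0.
  have [t te td] := small d d0; have [SY _] := cY t te.
  by rewrite -(SY : enorm _ = _) (le_trans (lerB_enorm _ _))// enormC (le_trans (Yp t te)).
have cp : superlevel n s c p.
  split=> //; apply/ler_addgt0Pl => d d0.
  have [K K0 KV] := gaps_bl n0 s.
  have K1 : 0 < K + 1 by rewrite ltr_wpDl.
  have [t te td] := small (d / (K + 1)) (divr_gt0 d0 K1).
  have [SY cYt] := cY t te.
  have := KV _ _ SY Sp; rewrite ler_norml => /andP[_ h].
  have e1 := Yp t te; have e2 := le_trans e1 td.
  have : enorm (Y x t - p) * (K + 1) <= d by rewrite -ler_pdivlMr.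
  by have := enorm_ge0 (Y x t - p); lra.
have Up := superlevel_U n0 c0 cp.
have [tp0 Yp0 sYp] := flowP Up.
(* The curve through [p], translated so as to reach [p] at time [e]. *)
pose Z (t : R) := Y p (t - e).
have sZ : solution n s (before (tau p + e%:E)%E) Z.
  move=> t; rewrite beforeE -lteBlDr// -EFinB => tt.
  have [U1 d1] := sYp _ tt; split=> //; exact: is_derive_shift.
have eb : (e%:E < tau p + e%:E)%E by rewrite -lteBlDr// subee.
have Ze : Z e = p by rewrite /Z subrr.
have subZ (t u : R) : u <= e -> solution n s `[t, u] Z.
  move=> ue; apply: sub_solution (before_itv _) sZ.
  by rewrite (le_lt_trans _ eb)// lee_fin.
have cZ t : t <= e -> superlevel n s c (Z t).
  move=> te; apply: (solution_superlevel n0 sS te (subZ t e (lexx _))).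
    by rewrite Ze.
  by rewrite lexx.
(* [Z] and [Y x] both tend to [p] at time [e]; Gronwall's inequality carries their small distance at
   a time [u] close to [e] back to [t]. *)
have ZY t : 0 <= t < e -> Z t = Y x t.
  move=> /andP[t_0 te]; apply/eqP; rewrite -subr_eq0 -enorm_eq0 eq_le enorm_ge0 andbT.
  apply/ler_addgt0Pl => d d0; rewrite addr0.
  have E0 := expR_gt0 (M * e).
  have d2 : 0 < d / (2 * expR (M * e)) by rewrite divr_gt0// mulr_gt0.
  have [u0 /andP[u00 u0e] u0d] := small _ d2.
  pose u := Num.max t u0.
  have tu : t <= u by rewrite le_max lexx.
  have ue : u < e by rewrite gt_max te.
  have u0' : 0 <= u by rewrite (le_trans t_0).
  have uM : 9 * M * (e - u) <= d / (2 * expR (M * e)).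
    rewrite (le_trans _ u0d)// ler_wpM2l ?mulr_ge0// lerB//.
    by rewrite le_max lexx orbT.
  have [] := gronwall Fl tu (subZ t u (ltW ue)) (sub t u ue).
    move=> v /andP[tv vu]; split; first by apply: cZ; lra.
    by apply: cY; apply/andP; split; lra.
  move=> _ g2; rewrite (le_trans g2)//.
  have z1 : enorm (Z u - p) <= d / (2 * expR (M * e)).
    rewrite enormC -Ze (le_trans (solution_speed n0 sS Fb (ltW ue) (subZ u e (lexx _)) _))//.
      by rewrite Ze.
    rewrite (le_trans _ uM)// ler_wpM2r ?subr_ge0 ?(ltW ue)//.
    by rewrite ler_wpM2r// ler_nat.
  have z2 : enorm (p - Y x u) <= d / (2 * expR (M * e)).
    by rewrite enormC (le_trans (Yp u _))// u0' ue.
  have z3 : enorm (Z u - Y x u) <= d / expR (M * e).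
    rewrite (le_trans (enorm_distD p _ _))// (le_trans (lerD z1 z2))//.
    by rewrite le_eqVlt; apply/orP; left; apply/eqP; field; rewrite gt_eqF.
  have e1 : expR (M * (u - t)) <= expR (M * e).
    by rewrite ler_expR ler_wpM2l//; lra.
  rewrite (le_trans (ler_wpM2r (enorm_ge0 _) e1))//.
  by rewrite mulrC -ler_pdivlMr.
have Z0 : Z 0 = x by rewrite ZY ?lexx ?t0// Y0.
have b0 : (0 < tau p + e%:E)%E by rewrite adde_gt0.
have [] := flow_maximal Ux b0 Z0 sZ; rewrite xe leNgt => + _.
by rewrite eb.
Qed.

Lemma continuous_gaps X (t : R) v : is_derive t (1 : R) X v ->
  {for t, continuous (V \o X)}.
Proof.
move=> dX; rewrite /V /gaps.
have cg z : {for t, continuous (fun u => gap n z (X u))}.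
  have dd := is_derive_dot dX (is_derive_cst z t (1 : R)).
  have dg := is_deriveB (is_derive_cst (r ^+ 2 : R) t (1 : R)) dd.
  exact: (is_derive_continuous dg).
elim: s => [|z l IH].
  rewrite (_ : _ \o X = cst 1); first exact: cst_continuous.
  by apply/funext => u /=; rewrite big_nil.
rewrite (_ : _ \o X = (fun u => gap n z (X u) * \prod_(z <- l) gap n z (X u))).
  exact: (@continuousM _ _ (fun u => gap n z (X u)) _ _ (cg z) IH).
by apply/funext => u /=; rewrite big_cons.
Qed.

Lemma gaps_flow_le x (t u : R) : U x -> t <= u -> (u%:E < tau x)%E ->
  V (Y x u) <= V (Y x t).
Proof.
move=> Ux tu ux; have [_ _ sY] := flowP Ux.
exact: (gaps_nonincreasing n0 sS tu (sub_solution (before_itv ux) sY)).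
Qed.

(** Either the curve is defined at [T] and below level [c], or it has ended by then and
    [flow_escape] gives an earlier time below level [c]; the intermediate value theorem finds the
    crossing. *)
Lemma exit_time x (c t T : R) : U x -> 0 < c -> t <= T -> (t%:E < tau x)%E ->
  c <= V (Y x t) -> ~ ((T%:E < tau x)%E /\ c <= V (Y x T)) ->
  exists u, [/\ t <= u <= T, (u%:E < tau x)%E & V (Y x u) = c].
Proof.
move=> Ux c0 tT tx ct nT; have [tau0 Y0 sY] := flowP Ux.
have [t' [tt' tT' t'x ct']] : exists t', [/\ t <= t', t' <= T, (t'%:E < tau x)%E & V (Y x t') < c].
  have [Tx|xT] := ltP T%:E (tau x).
    exists T; split=> //; rewrite ltNge; apply/negP => cT; exact: nT.
  have [e xe] : exists e, tau x = e%:E.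
    by move: xT tau0; case: (tau x) => // e _ _; exists e.
  have [t' /andP[t'0 t'e] ct'] := flow_escape Ux c0 xe.
  have t'x : (t'%:E < tau x)%E by rewrite xe lte_fin.
  exists t'; split=> //.
    rewrite leNgt; apply/negP => t't.
    by have := gaps_flow_le Ux (ltW t't) tx; rewrite leNgt (lt_le_trans ct' ct).
  by rewrite xe lee_fin in xT; exact: le_trans (ltW t'e) xT.
have cV : {within `[t, t'], continuous (V \o Y x)}.
  apply: continuous_in_subspaceT => u; rewrite inE/= in_itv/= => /andP[_ ut'].
  have [|_ dY] := sY u; first by rewrite /before /= (le_lt_trans _ t'x)// lee_fin.
  exact: continuous_gaps dY.
have [|u] := IVT tt' cV (v := c).
  by rewrite ge_min le_max /= ct (ltW ct') orbT.
rewrite in_itv/= => /andP[tu ut'] cu; exists u; split=> //.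
  by rewrite tu (le_trans ut').
by rewrite (le_lt_trans _ t'x)// lee_fin.
Qed.

End flow.

(** * Exponential decay of transported integrals *)

Section quadratic_increments.
Context {R : realType}.

(** N + 1 steps of length d = T / (N + 1) cost C d^2 each, in total C T^2 / (N + 1), which tends to
    0. *)
Lemma quadratic_increments_constant (f : R -> R) (T C d0 : R) :
  0 <= T -> 0 < d0 ->
  (forall t d, 0 <= t -> 0 <= d -> d <= d0 -> t + d <= T ->
     `|f (t + d) - f t| <= C * d ^+ 2) ->
  f T = f 0.
Proof.
move=> T0 d00 fC.
(* The sign of [C] is read off an admissible step of positive length, available when [T] is not
   0. *)
have C0 : 0 <= C * T ^+ 2.
  have [->|T1] := eqVneq T 0; first by rewrite expr0n mulr0.
  have T2 : 0 < T by rewrite lt_def T1.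
  have k0 : 0 < Num.min d0 T by rewrite lt_min d00.
  have := fC 0 (Num.min d0 T) (lexx _) (ltW k0).
  rewrite ge_min lexx add0r ge_min lexx orbT => /(_ isT isT).
  by move=> /(le_trans (normr_ge0 _)); rewrite pmulr_lge0 ?exprn_gt0// => ?; rewrite mulr_ge0 ?sqr_ge0.
have step (N : nat) : T / N.+1%:R <= d0 -> `|f T - f 0| <= C * T ^+ 2 / N.+1%:R.
  move=> Nd; set d := T / N.+1%:R.
  have N0 : 0 < N.+1%:R :> R by rewrite ltr0n.
  have d_0 : 0 <= d by rewrite divr_ge0// ltW.
  have dT : N.+1%:R * d = T by rewrite /d mulrC divfK// gt_eqF.
  have sum k : (k <= N.+1)%N -> `|f (k%:R * d) - f 0| <= k%:R * (C * d ^+ 2).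
    elim: k => [_|k IH kN]; first by rewrite !mul0r subrr normr0.
    have kd : k%:R * d + d = k.+1%:R * d by rewrite -natr1 mulrDl mul1r.
    have kT : k%:R * d + d <= T by rewrite kd -dT ler_wpM2r// ler_nat.
    have st := fC (k%:R * d) d (mulr_ge0 (ler0n _ _) d_0) d_0 Nd kT.
    have := ler_normD (f (k%:R * d + d) - f (k%:R * d)) (f (k%:R * d) - f 0).
    rewrite addrA subrK kd; move: st (IH (ltnW kN)); rewrite kd.
    by rewrite -natr1 (mulrDl _ _ (C * _)) mul1r; lra.
  have := sum N.+1 (leqnn _); rewrite dT => /le_trans; apply.
  by rewrite /d le_eqVlt; apply/orP; left; apply/eqP; field; rewrite gt_eqF.
apply/eqP; rewrite -subr_eq0 -normr_le0; apply/ler_addgt0Pl => e e0; rewrite addr0.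
have [N1 N1P] : exists N : nat, T / d0 + C * T ^+ 2 / e <= N%:R.
  exists (Num.truncn (T / d0 + C * T ^+ 2 / e)).+1.
  by apply: ltW; apply: truncnS_gt.
have p1 : 0 <= T / d0 by rewrite divr_ge0// ltW.
have p2 : 0 <= C * T ^+ 2 / e by rewrite divr_ge0// ltW.
have N0 : 0 < N1.+1%:R :> R by rewrite ltr0n.
have N2 : T / d0 + C * T ^+ 2 / e <= N1.+1%:R by rewrite (le_trans N1P)// ler_nat.
rewrite (le_trans (step N1 _))//.
  have : T / d0 <= N1.+1%:R by apply: le_trans N2; rewrite lerDl.
  by rewrite !ler_pdivrMr// mulrC.
have : C * T ^+ 2 / e <= N1.+1%:R by apply: le_trans N2; rewrite lerDr.
by rewrite !ler_pdivrMr// [e * _]mulrC.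
Qed.

End quadratic_increments.

Section evolution.
Context {R : realType} (n : nat) (n0 : (0 < n)%N).
Let r : R := sphere_radius n.
Let S : set (R3 R) := sphere n.
Variable s : seq (R3 R).
Hypotheses (us : uniq s) (sS : forall z, z \in s -> S z) (szs : size s = n).
Variables (Y : R3 R -> R -> R3 R) (tau : R3 R -> \bar R).
Hypothesis Yflow : is_flow n [set` s] Y tau.
Variables (h : R3 R -> R) (K c : R).
Hypotheses (K0 : 0 <= K) (hK : blip S K h) (c0 : 0 < c).
Hypothesis h0 : forall x, S x -> 0 <= h x.
Hypothesis hc : forall x, S x -> gaps n s x < 2 * c -> h x = 0.

Let F : R3 R -> R3 R := field n s.
Let U : set (R3 R) := S `\` [set` s].
Let V : R3 R -> R := gaps n s.
Let SI := @sphere_integral R n.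

(** The value 0 after the lifetime of the curve and on [s] preserves continuity: a curve passes
    below level 2 c, where [h] vanishes, before it ends. *)
Definition evolve (t : R) (x : R3 R) : R :=
  if `[< U x /\ (t%:E < tau x)%E >] then h (Y x t) else 0.

Lemma evolve_in t x : U x -> (t%:E < tau x)%E -> evolve t x = h (Y x t).
Proof. by move=> Ux tx; rewrite /evolve asboolT. Qed.

Let fl x (Ux : U x) := flowP n0 us sS Yflow Ux.

Let SY t x : U x -> (t%:E < tau x)%E -> S (Y x t).
Proof. by move=> Ux tx; have [_ _ sY] := fl Ux; have [[]] := sY t tx. Qed.

Lemma evolve_neq0 t x : evolve t x != 0 ->
  [/\ U x, (t%:E < tau x)%E & superlevel n s (2 * c) (Y x t)].
Proof.
rewrite /evolve; case: asboolP => [[Ux tx] hx|]; last by rewrite eqxx.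
split=> //; split; first exact: SY.
by rewrite leNgt; apply/negP => /(hc (SY Ux tx)) hx0; rewrite hx0 eqxx in hx.
Qed.

Lemma evolve_ge0 t x : 0 <= evolve t x.
Proof. by rewrite /evolve; case: asboolP => // -[Ux tx]; apply: h0; exact: SY. Qed.

Lemma evolve0 x : S x -> evolve 0 x = h x.
Proof.
move=> Sx; have [xs|xs] := pselect ([set` s] x).
  rewrite /evolve asboolF; last by move=> [[_ +] _].
  by rewrite hc// (gaps_eq0 n0)// mulr_gt0.
by have [t0 Y0 _] := fl (conj Sx xs); rewrite evolve_in// Y0.
Qed.

Lemma evolve_superlevel t x : 0 <= t -> evolve t x != 0 ->
  forall u, 0 <= u <= t -> superlevel n s (2 * c) (Y x u).
Proof.
move=> t0 /evolve_neq0[Ux tx cx] u /andP[u0 ut].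
have [_ _ sY] := fl Ux.
apply: (solution_superlevel n0 sS ut _ cx); last by rewrite lexx.
exact: sub_solution (before_itv tx) sY.
Qed.

Lemma evolve_support t x : 0 <= t -> evolve t x != 0 -> superlevel n s (2 * c) x.
Proof.
move=> t0 tx; have [Ux _ _] := evolve_neq0 tx; have [_ Y0 _] := fl Ux.
by rewrite -{1}Y0; apply: (evolve_superlevel t0 tx); rewrite lexx.
Qed.

(** Flowing back for a time [d] and then forward for [t + d] amounts to flowing for [t], and the
    lifetime is shifted accordingly. *)
Lemma evolve_shift t d y : U y -> 0 <= d ->
  evolve (t + d) (Y y (- d)) = evolve t y.
Proof.
move=> Uy d0; have [t0 Y0 sY] := fl Uy.
have dy : ((- d)%:E < tau y)%E by rewrite (le_lt_trans _ t0)// lee_fin oppr_le0.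
have [tq Yq] := flow_shift n0 us sS szs Yflow Uy dy.
have [Uq _] := sY _ dy.
have E : (((t + d)%:E < tau (Y y (- d))) = (t%:E < tau y))%E.
  by rewrite tq lteBrDr// -EFinD addrK.
have [ty|ty] := boolP (t%:E < tau y)%E.
  rewrite !evolve_in//; last by rewrite E.
  by rewrite Yq ?addrK// -tq E.
by rewrite /evolve !asboolF//; [move=> [_]; apply/negP|rewrite E => -[_]; apply/negP].
Qed.

Let c2c : c <= 2 * c. Proof. by have := c0; lra. Qed.

(* Here and in evolve_bl, a trajectory leaving the superlevel set is compared up to
   its exit time, where it is still under control and h already vanishes. *)
Lemma evolve_time T : 0 <= T -> exists2 C, 0 <= C &
  forall x t u, S x -> 0 <= t <= T -> 0 <= u <= T ->
    `|evolve t x - evolve u x| <= C * `|t - u|.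
Proof.
move=> T0; have [M [M0 Fb Fl]] := field_bounds n0 sS szs c0.
exists (K * (3 * M)); first by rewrite !mulr_ge0.
move=> x t u Sx; wlog tu : t u / t <= u.
  move=> W tT uT; have [tu|/ltW ut] := leP t u; first exact: W.
  by rewrite distrC (distrC t); exact: W.
move=> /andP[t0 tT] /andP[u0 uT].
have path v : t <= v -> v <= u -> U x -> (v%:E < tau x)%E ->
    superlevel n s c (Y x v) ->
    `|h (Y x t) - h (Y x v)| <= K * (3 * M) * `|t - u|.
  move=> tv vu Ux vx cv; have [_ _ sY] := fl Ux.
  have tx : (t%:E < tau x)%E by rewrite (le_lt_trans _ vx)// lee_fin.
  rewrite (le_trans (hK.2 _ _ (SY Ux tx) (SY Ux vx)))// -mulrA ler_wpM2l// enormC.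
  rewrite (le_trans (solution_speed n0 sS Fb tv (sub_solution (before_itv vx) sY) cv))//.
  rewrite ler_wpM2l ?mulr_ge0// distrC ger0_norm ?subr_ge0//.
  by rewrite lerB.
have [u_0|u_0] := eqVneq (evolve u x) 0; last first.
  have [Ux ux cu] := evolve_neq0 u_0.
  have tx : (t%:E < tau x)%E by rewrite (le_lt_trans _ ux)// lee_fin.
  by rewrite !evolve_in// path//; exact: superlevel_le cu.
have [t_0|t_0] := eqVneq (evolve t x) 0.
  by rewrite u_0 t_0 subrr normr0 !mulr_ge0.
have [Ux tx ct] := evolve_neq0 t_0.
rewrite u_0 (evolve_in Ux tx).
have [[ux cu]|nu] := pselect ((u%:E < tau x)%E /\ c <= V (Y x u)).
  by rewrite -u_0 evolve_in// path//; split=> //; exact: SY.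
have [v [/andP[tv vu] vx cv]] := exit_time n0 us sS szs Yflow Ux c0 tu tx
  (le_trans c2c ct.2) nu.
have <- : h (Y x v) = 0 by apply: hc; [exact: SY|rewrite cv; have := c0; lra].
by apply: path => //; split; [exact: SY|rewrite cv].
Qed.

Lemma evolve_bl T : 0 <= T -> bl S [set t | 0 <= t <= T] evolve.
Proof.
move=> T0; have [M [M0 Fb Fl]] := field_bounds n0 sS szs c0.
have [KV KV0 VL] := gaps_bl n0 s.
have E0 : 0 < expR (M * T) by exact: expR_gt0.
have E1 : 1 <= expR (M * T) by rewrite -expR0 ler_expR mulr_ge0.
(* By Gronwall's inequality, curves starting closer than [e] stay within c / (KV + 1) up to time
   [T]; this does not exhaust the margin between the levels 2 c and c of [gaps]. *)
pose e := c / ((KV + 1) * expR (M * T)).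
have KV1 : 0 < KV + 1 by rewrite ltr_wpDl.
have e0 : 0 < e by rewrite divr_gt0// mulr_gt0.
pose C := K * expR (M * T) + K / e + K.
have C1 : 0 <= K * expR (M * T) by rewrite mulr_ge0// ltW.
have C2 : 0 <= K / e by rewrite divr_ge0// ltW.
have C_0 : 0 <= C by apply: addr_ge0 => //; exact: addr_ge0.
have evb t x : `|evolve t x| <= K.
  rewrite /evolve; case: asboolP => [[Ux tx]|_]; last by rewrite normr0.
  by apply: hK.1; exact: SY.
(* By symmetry one inequality is enough. It is clear if the value at [x] is 0; otherwise the curve
   of [x] stays above level 2 c and guides that of [y]. *)
have half t x y : 0 <= t <= T -> S x -> S y ->
    evolve t x - evolve t y <= C * enorm (x - y).
  move=> /andP[t0 tT] Sx Sy; have n1 := enorm_ge0 (x - y).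
  have [x_0|x_0] := eqVneq (evolve t x) 0.
    rewrite x_0 sub0r; have y_0 := evolve_ge0 t y.
    by apply: (@le_trans _ _ 0); [rewrite oppr_le0|exact: mulr_ge0].
  have [Ux tx ct] := evolve_neq0 x_0.
  have cx := evolve_superlevel t0 x_0.
  (* For distant points, the bound [K] is at most K / e times the distance. *)
  have [big|near_] := leP e (enorm (x - y)).
    have : evolve t x - evolve t y <= K.
      by have := evb t x; have := evolve_ge0 t y; rewrite ler_norml => ? /andP[_ ?]; lra.
    move=> /le_trans; apply.
    have : K <= K / e * enorm (x - y) by rewrite mulrAC ler_pdivlMr// ler_wpM2l.
    by have := mulr_ge0 C1 n1; have := mulr_ge0 K0 n1; rewrite /C; lra.
  have [_ Y0x sYx] := fl Ux.
  have close w y' : superlevel n s (2 * c) w -> S y' ->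
      enorm (w - y') <= expR (M * T) * enorm (x - y) -> c < V y'.
    move=> [Sw cw] Sy' wy.
    have := VL _ _ Sw Sy'; rewrite ler_norml => /andP[_ hV].
    have h1 : (KV + 1) * (expR (M * T) * enorm (x - y)) < c.
      rewrite mulrA mulrC -ltr_pdivlMr ?mulr_gt0//.
    have h2 : KV * enorm (w - y') <= (KV + 1) * (expR (M * T) * enorm (x - y)).
      by apply: ler_pM => //; [exact: enorm_ge0|rewrite lerDl].
    rewrite /V; move: cw hV h1 h2; lra.
  have cy0 : c < V y.
    have cx0 : superlevel n s (2 * c) x by rewrite -Y0x; apply: cx; rewrite lexx.
    by apply: (close x) => //; rewrite ler_peMl.
  have Uy : U y by apply: (superlevel_U n0 c0); split=> //; exact: ltW.
  have [ty0 Y0y sYy] := fl Uy.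
  have follow v : 0 <= v -> v <= t -> (v%:E < tau y)%E -> c <= V (Y y v) ->
      enorm (Y x v - Y y v) <= expR (M * T) * enorm (x - y) /\ c < V (Y y v).
    move=> v0 vt vy cv.
    have vx : (v%:E < tau x)%E by rewrite (le_lt_trans _ tx)// lee_fin.
    have cyv : superlevel n s c (Y y v) by split=> //; exact: SY.
    have sYyv := sub_solution (before_itv (t := 0) vy) sYy.
    have g : enorm (Y x v - Y y v) <= expR (M * T) * enorm (x - y).
      have [] := gronwall Fl v0 (sub_solution (before_itv (t := 0) vx) sYx) sYyv.
        move=> w /andP[w0 wv]; split.
          by apply: (superlevel_le c2c); apply: cx; rewrite w0 (le_trans wv).
        by apply: (solution_superlevel n0 sS v0 sYyv cyv); rewrite w0.
      move=> + _; rewrite Y0x Y0y subr0 => /le_trans; apply.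
      by rewrite ler_wpM2r// ler_expR ler_wpM2l// (le_trans vt).
    split=> //; apply: (close (Y x v)) => //; last exact: SY.
    by apply: cx; rewrite v0.
  have [[ty cy]|nty] := pselect ((t%:E < tau y)%E /\ c <= V (Y y t)).
    have [g _] := follow t t0 (lexx _) ty cy.
    rewrite !evolve_in// (le_trans (ler_norm _))// (le_trans (hK.2 _ _ (SY Ux tx) (SY Uy ty)))//.
    rewrite (le_trans (ler_wpM2l K0 g))// mulrA ler_wpM2r//.
    by rewrite /C -addrA lerDl addr_ge0.
  have ty0' : c <= V (Y y 0) by rewrite Y0y ltW.
  (* The curve of [y] cannot reach level [c], since [follow] places it strictly above. *)
  have [v [/andP[v0 vt] vy cv]] := exit_time n0 us sS szs Yflow Uy c0 t0 ty0 ty0' nty.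
  have cv' : c <= V (Y y v) by rewrite /V cv.
  have [_] := follow v v0 vt vy cv'.
  by rewrite /V cv ltxx.
exists C => // t /= tT; split=> [x Sx|x y Sx Sy].
  by rewrite (le_trans (evb _ _))// /C lerDr addr_ge0.
rewrite ler_norml half// andbT -(opprB (evolve t y)) lerN2 enormC.
exact: half.
Qed.

Let bl_evolve t : 0 <= t -> bl S setT (fun _ : unit => evolve t).
Proof. by move=> t0; apply: bl_family (evolve_bl t0); rewrite /= t0 lexx. Qed.

(** With g = [evolve (t + d)], the function [evolve t] is g composed with the flow at time -d, hence
    up to O(d^2) with the stepper at -d. The last clause of [stepper] then produces 2 pi d times the
    integral of g, the divergence being 2 pi on the support of g. *)
Lemma evolve_integral_step T : 0 <= T -> exists C d0, [/\ 0 < d0, 0 <= C &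
  forall t d, 0 <= t -> 0 <= d -> d <= d0 -> t + d <= T ->
    `|SI (evolve t) - SI (evolve (t + d)) - 2 * pi * d * SI (evolve (t + d))|
      <= C * d ^+ 2].
Proof.
move=> T0; have [M [M0 Fb Fl]] := field_bounds n0 sS szs c0.
have [KV KV0 VL] := gaps_bl n0 s.
have [v [D [E [[d1 [C1 [/andP[d10 d11] C10 DC [vb vl] HE]]] vD]]]] :=
  stepper_superlevel n0 sS szs c0.
have [L L0 evL] := evolve_bl T0.
pose A := fine (surface_area n S).
have A0 : 0 <= A by exact: sphere_area_ge0.
(* Such a step changes [gaps] by at most [c], so a point below level [c] is not moved to level 2 c;
   both functions compared in [pt] vanish there. *)
pose d0 := Num.min d1 (c / ((KV + 1) * (C1 + C1) + 1)).
have q0 : 0 < (KV + 1) * (C1 + C1) + 1.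
  by rewrite ltr_wpDl// mulr_ge0// addr_ge0.
exists (C1 * L + L * (C1 + 9 * M ^+ 2) * A), d0; split.
- by rewrite lt_min d10 divr_gt0.
- by rewrite addr_ge0 ?mulr_ge0// addr_ge0// mulr_ge0// sqr_ge0.
move=> t d t0 d_0 dd0 tdT.
have td0 : 0 <= t + d by exact: addr_ge0.
have tT : t <= T by rewrite (le_trans _ tdT)// lerDl.
set g := evolve (t + d).
have gL : blip S L g by apply: evL; rewrite /= td0.
have g0 x : S x -> 0 <= g x by move=> _; exact: evolve_ge0.
have dN : `|- d| <= d1 by rewrite normrN ger0_norm// (le_trans dd0)// ge_min lexx.
have [SE LE FE IE] := HE _ dN.
have hI : `|SI (g \o E (- d)) - SI g + - d * SI (fun x => D x * g x)| <= C1 * L * d ^+ 2.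
  by have := IE L g L0 gL g0; rewrite sqrrN.
have d1' : d <= 1 by rewrite (le_trans dd0)// ge_min d11.
have dc : ((KV + 1) * (C1 + C1) + 1) * d <= c.
  by rewrite mulrC -ler_pdivlMr// (le_trans dd0)// ge_min lexx orbT.
have DgE : SI (fun x => D x * g x) = 2 * pi * SI g.
  rewrite -(sphere_integralZ n0); last exact: bl_evolve.
  apply: eq_sphere_integral => x Sx.
  have [g_0|g_0] := eqVneq (g x) 0; first by rewrite g_0 !mulr0.
  have cx := superlevel_le c2c (evolve_support td0 g_0).
  by have [_ ->] := vD _ cx.
have pt x : S x -> `|evolve t x - (g \o E (- d)) x| <= L * ((C1 + 9 * M ^+ 2) * d ^+ 2).
  move=> Sx; have d2 := sqr_ge0 d.
  have [cx|cx] := pselect (superlevel n s c x).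
    have Ux := superlevel_U n0 c0 cx.
    have [t0x Y0 sY] := fl Ux.
    have t0x' : (0%:E < tau x)%E by exact: t0x.
    have dx : ((- d)%:E < tau x)%E by rewrite (le_lt_trans _ t0x)// lee_fin oppr_le0.
    rewrite -(evolve_shift t Ux d_0) -/g /=.
    rewrite (le_trans (gL.2 _ _ (SY Ux dx) (SE _ Sx)))// ler_wpM2l//.
    rewrite (le_trans (enorm_distD (x - d *: F x) _ _))// mulrDl addrC lerD//.
      have := FE x Sx; rewrite sqrrN scaleNr; have [-> _] := vD _ cx.
      by rewrite enormC.
    have := backward_euler n0 sS M0 Fb Fl d_0 (sub_solution (before_itv t0x') sY).
    by rewrite Y0; exact.
  have nx : V x < c by rewrite ltNge; apply/negP => h'; exact: cx.
  have -> : evolve t x = 0.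
    apply/eqP/negPn/negP => /(evolve_support t0) [_ cx'].
    by apply: cx; split=> //; exact: le_trans c2c cx'.
  have -> : (g \o E (- d)) x = 0.
    apply/eqP/negPn/negP => /(evolve_support td0) [SEx cEx].
    have mv : enorm (E (- d) x - x) <= (C1 + C1) * d.
      rewrite (le_trans (enorm_distD (x + (- d) *: v x) _ _))// mulrDl lerD//.
        rewrite (le_trans (FE _ Sx))// sqrrN expr2 mulrA ler_wpM2r//.
        by rewrite ler_piMr.
      by rewrite addrC addKr enormZ normrN ger0_norm// mulrC ler_wpM2r// vb.
    have := VL _ _ SEx Sx; rewrite ler_norml => /andP[_ hV].
    have m1 : KV * enorm (E (- d) x - x) <= (KV + 1) * ((C1 + C1) * d).
      by apply: ler_pM => //; [exact: enorm_ge0|rewrite lerDl].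
    by move: nx cEx hV m1 dc; rewrite /V; lra.
  by rewrite subrr normr0 !mulr_ge0// addr_ge0// mulr_ge0// sqr_ge0.
have bE : bl S setT (fun _ : unit => g \o E (- d)).
  exists (L * (C1 + 1)); first by rewrite mulr_ge0// addr_ge0.
  by move=> _ _; apply: blip_comp.
have h2 : `|SI (evolve t) - SI (g \o E (- d))| <= L * ((C1 + 9 * M ^+ 2) * d ^+ 2) * A.
  exact: (sphere_integral_dist n0 (bl_evolve t0) bE pt).
rewrite DgE in hI.
have -> : SI (evolve t) - SI g - 2 * pi * d * SI g =
  (SI (evolve t) - SI (g \o E (- d))) +
  (SI (g \o E (- d)) - SI g + - d * (2 * pi * SI g)) by ring.
rewrite (le_trans (ler_normD _ _))//.
move: hI h2; rewrite -/A; lra.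
Qed.

(** The product of exp (2 pi t) with the integral at time t has increments of order d^2, so it is
    constant. *)
Lemma evolve_integral T : 0 <= T -> SI (evolve T) = expR (- (2 * pi * T)) * SI h.
Proof.
move=> T0; have [C [d0 [d00 C0 step]]] := evolve_integral_step T0.
pose f t := expR (2 * pi * t) * SI (evolve t).
have pi0 := pi_gt0 R.
pose A := fine (surface_area n S).
have A0 : 0 <= A by exact: sphere_area_ge0.
have SIb t : 0 <= t -> `|SI (evolve t)| <= K * A.
  move=> t0; apply: (sphere_integral_bound n0); first exact: bl_evolve.
  move=> x Sx; rewrite /evolve; case: asboolP => [[Ux tx]|_]; last by rewrite normr0.
  by apply: hK.1; exact: SY.
(* On [0, y] the derivative of exp x - x is at most [expR 1 * y]. *)
have expq (y : R) : 0 <= y -> y <= 1 -> `|expR y - 1 - y| <= expR 1 * y ^+ 2.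
  move=> y0 y1.
  have e1 x : 0 <= x -> x <= y -> `|expR x - 1| <= expR 1 * y.
    move=> x0 xy; rewrite -[X in `|_ - X|]expR0.
    apply: (@le_trans _ _ (expR 1 * `|x - 0|)).
      apply: (@is_derive_lipschitz _ expR expR) => u.
      rewrite (min_idPr x0) (max_idPl x0) => /andP[u0 ux].
      by rewrite ger0_norm ?expR_ge0// ler_expR; lra.
    rewrite subr0 (ger0_norm x0); apply: ler_wpM2l => //; exact: expR_ge0.
  have := @is_derive_lipschitz _ (fun x => expR x - x) (fun x => expR x - 1) (expR 1 * y) y 0.
  rewrite expR0 !subr0 (ger0_norm y0) -mulrA -expr2 => H.
  rewrite (_ : expR y - 1 - y = expR y - y - 1); last ring.
  apply: H => x.
  by rewrite (min_idPr y0) (max_idPl y0) => /andP[x0 xy]; exact: e1.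
suff : f T = f 0.
  rewrite /f mulr0 expR0 mul1r (_ : SI (evolve 0) = SI h); last first.
    by apply: eq_sphere_integral => x Sx; exact: evolve0.
  move=> <-; rewrite mulrA -expRD addNr expR0 mul1r//.
pose C' := expR (2 * pi * T) * (C + expR 1 * (2 * pi) ^+ 2 * (K * A)).
(* Steps of length at most 1 / (2 pi) keep the argument 2 pi d of [expq] in [0, 1]. *)
apply: (@quadratic_increments_constant R f T C' (Num.min d0 (2 * pi)^-1)) => //.
  by rewrite lt_min d00 invr_gt0 mulr_gt0.
move=> t d t0 d_0; rewrite le_min => /andP[dd0 dpi] tdT.
have td0 : 0 <= t + d by exact: addr_ge0.
have st := step t d t0 d_0 dd0 tdT.
have y0 : 0 <= 2 * pi * d by rewrite !mulr_ge0// ltW.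
have y1 : 2 * pi * d <= 1.
  have p2 : 0 < 2 * pi :> R by rewrite mulr_gt0.
  by have := ler_wpM2l (ltW p2) dpi; rewrite mulfV// gt_eqF.
have ex := expq _ y0 y1.
have -> : f (t + d) - f t = expR (2 * pi * t) *
   ((expR (2 * pi * d) - 1 - 2 * pi * d) * SI (evolve (t + d)) -
    (SI (evolve t) - SI (evolve (t + d)) - 2 * pi * d * SI (evolve (t + d)))).
  by rewrite /f mulrDr expRD; ring.
rewrite normrM (ger0_norm (expR_ge0 _)) /C' -[leRHS]mulrA.
apply: ler_pM; [exact: expR_ge0|exact: normr_ge0| |].
  rewrite ler_expR ler_wpM2l ?mulr_ge0 ?(ltW pi0)//.
  by rewrite (le_trans _ tdT)// lerDl.
rewrite (le_trans (ler_normB _ _))// [leRHS]mulrDl addrC lerD// normrM.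
rewrite (le_trans (ler_pM _ _ ex (SIb _ td0)))//.
by rewrite le_eqVlt; apply/orP; left; apply/eqP; ring.
Qed.

End evolution.

(** * Integration in time *)

Section cutoff.
Context {R : realType}.
Implicit Types (k : nat) (v w : R).

(** A ramp from 0 at v = 1 / (k + 1) to 1 at v = 2 / (k + 1); as k grows it increases to the
    indicator of v > 0. *)
Definition cutoff k v : R := Num.max 0 (Num.min 1 (k.+1%:R * v - 1)).

Lemma cutoff_ge0 k v : 0 <= cutoff k v.
Proof. by rewrite /cutoff le_max lexx. Qed.

Lemma cutoff_le1 k v : cutoff k v <= 1.
Proof. by rewrite /cutoff ge_max ler01 ge_min lexx. Qed.

(** The bound is 1 / (k + 1), written as 2 c for the level c = 1 / (2 (k + 1)) at which the flow is
    controlled. *)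
Lemma cutoff_eq0 k v : v < 2 * (2 * k.+1%:R)^-1 -> cutoff k v = 0.
Proof.
have k0 : 0 < k.+1%:R :> R by rewrite ltr0n.
rewrite invfM mulrA mulfV ?mul1r// => vk; apply/max_idPl.
rewrite ge_min; apply/orP; right; rewrite subr_le0.
by have := ler_wpM2l (ltW k0) (ltW vk); rewrite mulfV ?lt0r_neq0.
Qed.

Lemma cutoff_le k k' v : 0 <= v -> (k <= k')%N -> cutoff k v <= cutoff k' v.
Proof.
move=> v0 kk; rewrite /cutoff.
have le1 : k.+1%:R * v - 1 <= k'.+1%:R * v - 1 :> R.
  by rewrite lerB// ler_wpM2r// ler_nat.
move: (k.+1%:R * v - 1) (k'.+1%:R * v - 1) le1 => a b ab.
rewrite !maxEle !minEle; case: (leP 1 a) => /= h1; case: (leP 1 b) => /= h2.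
all: case: (leP 0 a) => /= h3; case: (leP 0 b) => /= h4; rewrite ?ler01; lra.
Qed.

Lemma cutoff_lipschitz k v w : `|cutoff k v - cutoff k w| <= k.+1%:R * `|v - w|.
Proof.
have k0 : 0 <= k.+1%:R :> R by rewrite ler0n.
rewrite -[X in X * `|_|](ger0_norm k0) -normrM mulrBr /cutoff.
move: (k.+1%:R * v) (k.+1%:R * w) => a b.
have := ler_norm (b - a); rewrite distrC; have := ler_norm (a - b).
rewrite !maxEle !minEle; case: (leP 1 (a - 1)) => /= h1; case: (leP 1 (b - 1)) => /= h2.
all: case: (leP 0 (a - 1)) => /= h3; case: (leP 0 (b - 1)) => /= h4; rewrite ?ler01 ler_norml; lra.
Qed.

Lemma cutoff_eq1 v : 0 < v -> \forall k \near \oo, cutoff k v = 1.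
Proof.
move=> v0; near=> k.
have kv : 2 / v <= k.+1%:R.
  rewrite (@le_trans _ _ (k%:R))// ?ler_nat//.
  by near: k; exact: nbhs_infty_ger.
have kv1 : 1 <= k.+1%:R * v - 1 by move: kv; rewrite ler_pdivrMr//; lra.
by rewrite /cutoff (min_idPl kv1); apply/max_idPr.
Unshelve. all: by end_near. Qed.

Lemma clamp_contraction (T v w : R) : 0 <= v <= T ->
  `|v - Num.max 0 (Num.min T w)| <= `|v - w| :> R.
Proof.
move=> /andP[v0 vT]; have T0 := le_trans v0 vT.
have := ler_norm (w - v); rewrite distrC; have := ler_norm (v - w).
rewrite maxEle minEle; case: (leP T w) => /= h1; case: (leP 0 w) => /= h2 h3 h4.
all: rewrite ?T0 ?lexx// ler_norml; lra.
Qed.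

End cutoff.

Section sphere_time.
Context {R : realType} (n : nat) (n0 : (0 < n)%N).
Let S : set (R3 R) := sphere n.
Variables (e : R -> R3 R -> R).
Hypothesis eS : forall T : R, 0 <= T -> bl S [set t | 0 <= t <= T] e.
Hypothesis eT : forall T : R, 0 <= T -> exists2 C, 0 <= C &
  forall x (t u : R), S x -> 0 <= t <= T -> 0 <= u <= T ->
    `|e t x - e u x| <= C * `|t - u|.

(** As on the sphere alone, [e] is an infimum of cones with vertices in a countable dense set, now
    of space and time; rational times are clamped to [0, T], where the bounds hold. *)
Lemma measurable_sphere_time_bounded (T : R) : 0 <= T ->
  measurable_fun (S `*` `[0%R, T]) (fun p : R3 R * R => e p.2 p.1).
Proof.
move=> T0; have [K K0 eK] := eS T0; have [C C0 eC] := eT T0.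
have [u [Su uS]] := @sphere_net R n n0.
pose a (q : rat) : R := Num.max 0 (Num.min T (ratr q)).
have a_in q : 0 <= a q <= T.
  by rewrite /a le_max lexx /= ge_max T0 ge_min lexx.
have aP (t : R) q : 0 <= t <= T -> `|t - a q| <= `|t - ratr q| by exact: clamp_contraction.
pose g (q : (rat * rat * rat) * rat) (p : R3 R * R) : R :=
  e (a q.2) (u q.1) + K * enorm (p.1 - u q.1) + C * `|p.2 - a q.2|.
apply: (@measurable_fun_dense R _ _ _ _ _ g).
- move=> q; apply: measurable_funTS; apply: measurable_funD.
    apply: measurable_funD => //; apply: measurable_funM => //.
    exact: measurableT_comp (measurable_enormB (u q.1)) measurable_fst.
  apply: measurable_funM => //; apply: measurableT_comp => //.
  exact: measurable_funB measurable_snd (measurable_cst _).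
- move=> q [x t] [/= Sx]; rewrite in_itv/= => tT.
  have := (eK _ (a_in q.2)).2 _ _ Sx (Su q.1).
  have := eC x _ _ Sx tT (a_in q.2).
  rewrite !ler_norml /g /= => /andP[_ ?] /andP[_ ?]; lra.
- move=> [x t] d [/= Sx]; rewrite in_itv/= => tT d0.
  have KC : 0 < 2 * K + 2 * C + 1 by lra.
  pose de := d / (2 * K + 2 * C + 1).
  have de0 : 0 < de by rewrite divr_gt0.
  have [q1 q1P] := uS x _ Sx de0.
  have [q2] : exists q : rat, ratr q \in `](t - de), (t + de)[%R.
    by apply: rat_in_itvoo; lra.
  rewrite in_itv/= => /andP[q2a q2b].
  exists (q1, q2).
  have td : `|t - a q2| <= de.
    by rewrite (le_trans (aP _ _ tT))// ler_norml; lra.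
  have := (eK _ (a_in q2)).2 _ _ Sx (Su q1).
  have := eC x _ _ Sx tT (a_in q2).
  have h1 : C * `|t - a q2| <= C * de by exact: ler_wpM2l.
  have h2 : K * enorm (x - u q1) <= K * de by rewrite ler_wpM2l// ltW.
  have h3 : 2 * (K * de) + 2 * (C * de) + de = d.
    by rewrite /de; field; rewrite gt_eqF.
  rewrite !ler_norml /g /= => /andP[? _] /andP[? _]; lra.
Qed.

Lemma measurable_sphere_time :
  measurable_fun (S `*` (`[0, +oo[%classic : set R)) (fun p : R3 R * R => e p.2 p.1).
Proof.
have -> : S `*` (`[0, +oo[%classic : set R) = \bigcup_k (S `*` (`[0, k%:R]%classic : set R)) :> set (R3 R * R).
  apply/seteqP; split=> [[x t] [/= Sx]|[x t] [k _] [/= Sx]].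
    rewrite in_itv/= andbT => t0; exists (Num.truncn t).+1 => //; split => //=.
    by rewrite in_itv/= t0 ltW// truncnS_gt.
  by rewrite !in_itv/= => /andP[t0 _]; split => //=; rewrite ?in_itv/= t0.
apply/measurable_fun_bigcup => k.
  by apply: measurableX => //; exact: measurable_sphere.
exact: measurable_sphere_time_bounded.
Qed.

End sphere_time.

Section tonelli_sphere.
Context {R : realType} (n : nat) (n0 : (0 < n)%N).
Let S : set (R3 R) := sphere n.
Notation leb := (@lebesgue_measure R).

Lemma surface_area_fin_num_fun : fin_num_fun (@surface_area R n).
Proof.
move=> A mA; rewrite ge0_fin_numE//.
apply: (le_lt_trans _ (surface_area_sphere_fin (R := R) n0)).
rewrite /surface_area; apply: ge0_subset_integral.
- apply: measurableI; first exact: measurable_angles.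
  by rewrite -[X in measurable X]setTI; exact: measurable_spherical_coord.
- apply: measurableI; first exact: measurable_angles.
  rewrite -[X in measurable X]setTI; apply: measurable_spherical_coord => //.
  exact: measurable_sphere.
- by apply: measurable_funTS; apply/measurable_EFinP; exact: measurable_area_element.
- by move=> p [ap _]; rewrite lee_fin area_element_ge0.
- by move=> p [ap _]; split=> //; exact: spherical_coord_sphere.
Qed.

Let mu : {finite_measure set (R3 R) -> \bar R} :=
  HB.pack (@surface_area R n)
    (Measure_isFinite.Build _ _ _ (@surface_area R n) surface_area_fin_num_fun).

Let half : set R := `[0, +oo[%classic.

Lemma tonelli_sphere (f : R3 R * R -> \bar R) :
  measurable_fun (S `*` half) f ->
  (forall p, (S `*` half) p -> 0 <= f p)%E ->
  (\int[surface_area n]_(x in S) \int[leb]_(t in half) f (x, t) =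
   \int[leb]_(t in half) \int[surface_area n]_(x in S) f (x, t))%E.
Proof.
move=> mf f0; apply: (@fubini_tonelli_rectangleC _ _ _ _ R mu leb S half f) => //.
  exact: measurable_sphere.
exact: measurable_itv.
Qed.

End tonelli_sphere.

Section exponential.
Context {R : realType}.

Lemma measurable_expR_decay (D : set R) (a : R) :
  measurable_fun D (fun t => (expR (- (a * t)))%:E).
Proof.
apply: measurable_funTS; apply/measurable_EFinP.
apply: (@measurableT_comp _ _ _ _ _ _ (@expR R) _ (fun t => - (a * t))).
  exact: measurable_expR.
apply: (@measurableT_comp _ _ _ _ _ _ (@GRing.opp R) _ (fun t => a * t)).
  exact: oppr_measurable.
by apply: continuous_measurable_fun; exact: mulrl_continuous.
Qed.

Lemma integral_expR_decay (a : R) : 0 < a ->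
  (\int[lebesgue_measure]_(t in `[0%R, +oo[) (expR (- (a * t)))%:E = (a^-1)%:E)%E.
Proof.
move=> a0; have a1 : a != 0 by rewrite gt_eqF.
have H := integral_exponential_pdf a0.
have : (\int[lebesgue_measure]_(t in `[0%R, +oo[) (a%:E * (expR (- (a * t)))%:E) = 1)%E.
  rewrite -[RHS]H [LHS]integral_mkcond; apply: eq_integral => t _.
  rewrite /exponential_pdf !patchE; case: ifP => // _.
  by rewrite -EFinM mulNr.
rewrite ge0_integralZl//; last 2 first.
- exact: measurable_expR_decay.
- by rewrite lee_fin ltW.
set I := (\int[_]_(_ in _) _)%E.
move=> /(congr1 (fun y => (a^-1)%:E * y)%E).
by rewrite mule1 muleA -EFinM mulVf// mul1e.
Qed.

End exponential.

Lemma set_seq_cons (T : eqType) (z : T) (s : seq T) : [set` z :: s] = z |` [set` s].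
Proof.
apply/seteqP; split=> x /=; rewrite inE; first by move=> /orP[/eqP|]; [left|right].
by move=> [->|->]; rewrite ?eqxx ?orbT.
Qed.

Section finite_sets.
Context {R : realType} (n : nat) (n0 : (0 < n)%N).
Let S : set (R3 R) := sphere n.

Lemma measurable_point (z : R3 R) : measurable [set z].
Proof.
rewrite (_ : [set z] = [set z.1.1] `*` [set z.1.2] `*` [set z.2]).
  by apply: measurableX => //; exact: measurableX.
apply/seteqP; split=> [_ -> //|x [] [] /= x1 x2 x3].
exact: R3_eqP.
Qed.

Lemma measurable_seq (s : seq (R3 R)) : measurable [set` s].
Proof.
elim: s => [|z s IH]; first by rewrite set_nil.
by rewrite set_seq_cons; apply: measurableU => //; exact: measurable_point.
Qed.

Lemma measurable_fun_seq d (T : measurableType d) (s : seq (R3 R)) (f : R3 R -> T) :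
  measurable_fun [set` s] f.
Proof.
elim: s => [|z s IH]; first by rewrite set_nil; exact: measurable_fun_set0.
rewrite set_seq_cons; apply/measurable_funU; [exact: measurable_point|exact: measurable_seq|].
by split=> //; exact: measurable_fun_set1.
Qed.

(** A point determines its polar angle, poles included, so its preimage lies on a line in the plane
    of angles. *)
Lemma surface_area_point (z : R3 R) : surface_area n [set z] = 0%E.
Proof.
have r0 := sphere_radius_gt0 (R := R) n0.
set D := @angles R `&` spherical_coord n @^-1` [set z].
have mD : measurable D.
  apply: measurableI; first exact: measurable_angles.
  rewrite -[X in measurable X]setTI; apply: measurable_spherical_coord => //.
  exact: measurable_point.
apply: null_set_integral => //.
  by apply: measurable_funTS; apply/measurable_EFinP; exact: measurable_area_element.
have [D0|/set0P[p0 [ap0 zp0]]] := eqVneq D set0; first by rewrite -/D D0 measure0.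
have N0 : ((@lebesgue_measure R) \x (@lebesgue_measure R))%E
    ([set p0.1] `*` [set: R]) = 0%E.
  rewrite product_measure1E//.
  rewrite [X in (X * _)%E](_ : _ = 0%E) ?mul0e//.
  exact: lebesgue_measure_set1.
apply: subset_measure0 N0 => //; first exact: measurableX.
move=> p [ap zp]; split=> //=.
apply: cos_inj; [by case: ap|by case: ap0|].
have : (spherical_coord n p).2 = (spherical_coord n p0).2.
  by rewrite (zp : _ = z) (zp0 : _ = z).
by move=> /(mulfI (lt0r_neq0 r0)).
Qed.

Lemma surface_area_seq (s : seq (R3 R)) : surface_area n [set` s] = 0%E.
Proof.
elim: s => [|z s IH]; first by rewrite set_nil measure0.
have mz := measurable_point z; have ms := measurable_seq s.
by rewrite set_seq_cons measureU0//; exact: surface_area_point.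
Qed.

(** The values of [f] on [s], where the flow is arbitrary, are harmless: every function is
    measurable on a finite set of points, and this set is null. *)
Lemma sphere_integral_setD (s : seq (R3 R)) (f : R3 R -> \bar R) :
  (forall x, S x -> 0 <= f x)%E -> measurable_fun (S `\` [set` s]) f ->
  (\int[surface_area n]_(x in S) f x =
   \int[surface_area n]_(x in S `\` [set` s]) f x)%E.
Proof.
move=> f0 mf; have mS := measurable_sphere (R := R) n; have ms := measurable_seq s.
apply: ge0_negligible_integral => //; last exact: surface_area_seq.
rewrite -(setDUK (A := [set` s] `&` S) (B := S)); last by move=> x [].
apply/measurable_funU; [exact: measurableI|by apply: measurableD => //; exact: measurableI|].
split; last by rewrite setDIr setDv setU0.
apply: measurable_funS (measurable_fun_seq (s := s) f); [exact: ms|by move=> x []].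
Qed.

End finite_sets.

(** * Removal of the cutoff *)

Section time_integral.
Context {R : realType} (n : nat) (n0 : (0 < n)%N).
Let S : set (R3 R) := sphere n.
Variable s : seq (R3 R).
Hypotheses (us : uniq s) (sS : forall z, z \in s -> S z) (szs : size s = n).
Variables (Y : R3 R -> R -> R3 R) (tau : R3 R -> \bar R).
Hypothesis Yflow : is_flow n [set` s] Y tau.
Notation leb := (@lebesgue_measure R).

Let F : R3 R -> R3 R := field n s.
Let U : set (R3 R) := S `\` [set` s].
Let V : R3 R -> R := gaps n s.
Let half : set R := `[0, +oo[%classic.

Definition cut_speed k x : R := enorm (F x) * cutoff k (V x).

Let c k : R := (2 * k.+1%:R)^-1.

Let c_gt0 k : 0 < c k.
Proof. by rewrite invr_gt0 mulr_gt0// ltr0n. Qed.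

Let V_ge0 x : S x -> 0 <= V x.
Proof.
move=> Sx; rewrite /V /gaps big_seq; apply: prodr_ge0 => z zs.
by apply: (gap_ge0 n0) => //; exact: sS.
Qed.

Lemma cut_speed_ge0 k x : 0 <= cut_speed k x.
Proof. by rewrite mulr_ge0 ?enorm_ge0 ?cutoff_ge0. Qed.

Lemma cut_speed_eq0 k x : V x < 2 * c k -> cut_speed k x = 0.
Proof. by move=> /cutoff_eq0; rewrite /cut_speed => ->; rewrite mulr0. Qed.

Lemma cut_speed_le k k' x : S x -> (k <= k')%N -> cut_speed k x <= cut_speed k' x.
Proof. by move=> Sx kk; rewrite ler_wpM2l ?enorm_ge0// cutoff_le// V_ge0. Qed.

Lemma cut_speed_cvg x : U x -> \forall k \near \oo, cut_speed k x = enorm (F x).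
Proof.
move=> Ux; have := cutoff_eq1 (gaps_gt0 n0 sS Ux).
by apply: filterS => k; rewrite /cut_speed => ->; rewrite mulr1.
Qed.

(** Where the cutoff is not 0, the field agrees with that of a stepper, which is bounded and
    Lipschitz on the whole sphere. *)
Lemma cut_speed_bl k : bl S setT (fun _ : unit => cut_speed k).
Proof.
have [v [D [E [[d1 [C1 [_ C10 _ [vb vl] _]]] vD]]]] := stepper_superlevel n0 sS szs (c_gt0 k).
apply: (@eq_bl _ _ _ _ (fun _ x => enorm (v x) * cutoff k (V x))).
  move=> _ x _ Sx; have [lt|ge] := ltP (V x) (2 * c k).
    by rewrite cut_speed_eq0// cutoff_eq0// mulr0.
  have cx : superlevel n s (c k) x.
    by split=> //; apply: le_trans ge; have := c_gt0 k; lra.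
  by have [-> _] := vD _ cx.
apply: blM.
  exists C1 => // _ _; split=> [x Sx|x y Sx Sy].
    by rewrite ger0_norm ?enorm_ge0// vb.
  by rewrite (le_trans (lerB_enorm _ _))// vl.
apply: (@bl_comp _ _ _ _ (fun _ => cutoff k) (fun _ => V) k.+1%:R).
- move=> _ x _ _; rewrite ger0_norm ?cutoff_ge0//.
  by rewrite (le_trans (cutoff_le1 _ _))// ler1n.
- by move=> _ x y _ _ _; exact: cutoff_lipschitz.
- by apply: bl_prod => z; exact: bl_gap.
Qed.

Let ev k := evolve n s Y tau (cut_speed k).

Let ev_ge0 k t x : 0 <= ev k t x.
Proof. by apply: (evolve_ge0 n0 us sS Yflow) => y _; exact: cut_speed_ge0. Qed.

Let measurable_ev k : measurable_fun (S `*` half) (fun p : R3 R * R => (ev k p.2 p.1)%:E).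
Proof.
have [K K0 /(_ tt I) hK] := cut_speed_bl k.
apply/measurable_EFinP; apply: (measurable_sphere_time n0) => T T0.
  apply: (evolve_bl n0 us sS szs Yflow K0 hK (c_gt0 k)) => // x Sx.
    exact: cut_speed_ge0.
  exact: cut_speed_eq0.
apply: (evolve_time n0 us sS szs Yflow K0 hK (c_gt0 k)) => // x Sx.
exact: cut_speed_eq0.
Qed.

Local Open Scope ereal_scope.

(** Tonelli's theorem leaves the decay factor exp (-2 pi t), whose integral over t >= 0 is 1 / (2
    pi). *)
Lemma time_integral_cut_speed k :
  \int[surface_area n]_(x in S) \int[leb]_(t in half) (ev k t x)%:E =
  ((2 * pi)^-1)%:E * \int[surface_area n]_(x in S) (cut_speed k x)%:E.
Proof.
have [K K0 /(_ tt I) hK] := cut_speed_bl k.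
have p2 : (0 < 2 * pi :> R)%R by rewrite mulr_gt0// pi_gt0.
have SI0 : (0 <= sphere_integral n (cut_speed k))%R.
  by apply: Rintegral_ge0 => x _; exact: cut_speed_ge0.
rewrite (@tonelli_sphere _ _ n0 (fun p => (ev k p.2 p.1)%:E))//; last first.
  by move=> p _; rewrite lee_fin.
rewrite (sphere_integral_EFin n0 (cut_speed_bl k)) -(integral_expR_decay p2).
rewrite muleC -ge0_integralZl//; last exact: measurable_expR_decay.
apply: eq_integral => t; rewrite inE/= in_itv/= andbT => t0.
have evt : bl S setT (fun _ : unit => ev k t).
  have H : bl S [set u | (0 <= u <= t)%R] (evolve n s Y tau (cut_speed k)).
    apply: (evolve_bl n0 us sS szs Yflow K0 hK (c_gt0 k)) => // x Sx.
      exact: cut_speed_ge0.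
    exact: cut_speed_eq0.
  by apply: bl_family H; rewrite /= t0 lexx.
rewrite (sphere_integral_EFin n0 evt) -EFinM; congr EFin; rewrite mulrC.
apply: (evolve_integral n0 us sS szs Yflow K0 hK (c_gt0 k)) => // x Sx.
  exact: cut_speed_ge0.
exact: cut_speed_eq0.
Qed.

Let life x : set R := [set t | (0 <= t)%R /\ t%:E < tau x].

Let mhalf : measurable half. Proof. exact: measurable_itv. Qed.

(** Monotone convergence in k; as [ev] is 0 after the lifetime, the half-line reduces to the
    lifetime in the limit. *)
Lemma cvg_time_integral x : U x ->
  \int[leb]_(t in half) (ev k t x)%:E @[k --> \oo] -->
  \int[leb]_(t in life x) (enorm (force n [set` s] (Y x t)))%:E.
Proof.
move=> Ux; have [_ _ sY] := flowP n0 us sS Yflow Ux.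
have evE k t : t%:E < tau x -> ev k t x = cut_speed k (Y x t) by move=> tx; exact: evolve_in.
have ev0 k t : ~ t%:E < tau x -> ev k t x = 0%R.
  by move=> tx; rewrite /ev /evolve asboolF// => -[].
have -> : life x = half `&` [set t | t%:E < tau x].
  by apply/seteqP; split=> t; rewrite /half /= in_itv/= andbT.
rewrite integral_mkcondr.
have := @cvg_monotone_convergence _ _ _ leb half mhalf (fun k t => (ev k t x)%:E).
rewrite [X in _ -> _ -> _ -> _ --> X](_ : _ =
  \int[leb]_(t in half) ((fun t => (enorm (force n [set` s] (Y x t)))%:E) \_
     [set t | t%:E < tau x]) t); last first.
  apply: eq_integral => t _; apply/cvg_lim => //; rewrite patchE.
  case: ifPn => tx.
    have tx' : t%:E < tau x by exact/set_mem.
    have [UY _] := sY _ tx'; rewrite (forceE n0 us sS UY).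
    apply: cvg_near_cst; have := cut_speed_cvg UY.
    by apply: filterS => k; rewrite evE// => ->.
  apply: cvg_near_cst; apply: nearW => k; rewrite ev0//.
  by move=> tx'; move/negP: tx; apply; exact/mem_set.
apply.
- move=> k; have Sx : S x by case: Ux.
  exact: (measurable_fun_section_rectangle (measurable_sphere n) mhalf (measurable_ev k)).
- by move=> k t _; rewrite lee_fin.
- move=> t _ k k' kk; rewrite lee_fin.
  have [tx|tx] := pselect (t%:E < tau x); last by rewrite !ev0.
  by rewrite !evE// cut_speed_le//; have [[]] := sY _ tx.
Qed.

Let mU : measurable U.
Proof. by apply: measurableD; [exact: measurable_sphere|exact: measurable_seq]. Qed.

Let subUS : U `<=` S. Proof. by move=> x []. Qed.

Lemma cvg_integral_speed :
  \int[surface_area n]_(x in S) (cut_speed k x)%:E @[k --> \oo] -->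
  \int[surface_area n]_(x in S) (enorm (force n [set` s] x))%:E.
Proof.
have mcut k : measurable_fun U (fun x => (cut_speed k x)%:E).
  apply/measurable_EFinP; apply: (measurable_funS (measurable_sphere n) subUS).
  exact: (bl_measurable n0 (cut_speed_bl k)).
have lim x : U x -> (cut_speed k x)%:E @[k --> \oo] --> (enorm (force n [set` s] x))%:E.
  move=> Ux; rewrite (forceE n0 us sS Ux); apply: cvg_near_cst.
  by have := cut_speed_cvg Ux; apply: filterS => k ->.
rewrite (sphere_integral_setD n0 (s := s)); last 2 first.
- by move=> x _; rewrite lee_fin enorm_ge0.
- exact: emeasurable_fun_cvg mcut lim.
have -> : (fun k => \int[surface_area n]_(x in S) (cut_speed k x)%:E) =
          (fun k => \int[surface_area n]_(x in U) (cut_speed k x)%:E).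
  apply/funext => k; apply: (sphere_integral_setD n0); last exact: mcut.
  by move=> x _; rewrite lee_fin cut_speed_ge0.
have := @cvg_monotone_convergence _ _ _ (surface_area n) U mU (fun k x => (cut_speed k x)%:E).
rewrite [X in _ -> _ -> _ -> _ --> X](_ : _ =
  \int[surface_area n]_(x in U) (enorm (force n [set` s] x))%:E); last first.
  by apply: eq_integral => x; rewrite inE => Ux; apply/cvg_lim => //; exact: lim.
apply=> //.
- by move=> k x _; rewrite lee_fin cut_speed_ge0.
- by move=> x Ux k k' kk; rewrite lee_fin cut_speed_le//; exact: subUS.
Qed.

Lemma integral_time_integral :
  \int[surface_area n]_(x in S)
    \int[leb]_(t in life x) (enorm (force n [set` s] (Y x t)))%:E =
  ((2 * pi)^-1)%:E * \int[surface_area n]_(x in S) (enorm (force n [set` s] x))%:E.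
Proof.
pose G k x := \int[leb]_(t in half) (ev k t x)%:E.
have mG k : measurable_fun S (G k).
  apply: (@measurable_fun_integral_rectangle _ _ _ _ _ leb S half
    (fun p => (ev k p.2 p.1)%:E)).
  - exact: measurable_sphere.
  - exact: mhalf.
  - exact: measurable_ev.
  - by move=> p _; rewrite lee_fin.
have mGU k : measurable_fun U (G k).
  exact: measurable_funS (measurable_sphere n) subUS (mG k).
have G0 k x : 0 <= G k x by apply: integral_ge0 => t _; rewrite lee_fin.
rewrite (sphere_integral_setD n0 (s := s)); last 2 first.
- by move=> x _; apply: integral_ge0 => t _; rewrite lee_fin enorm_ge0.
(* The dependence of the flow on [x] is controlled only through [ev]; the time integral is
   measurable as a limit of integrals of [ev]. *)
- exact: emeasurable_fun_cvg mGU cvg_time_integral.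
have lim1 : \int[surface_area n]_(x in U) G k x @[k --> \oo] -->
    \int[surface_area n]_(x in U)
      \int[leb]_(t in life x) (enorm (force n [set` s] (Y x t)))%:E.
  have := @cvg_monotone_convergence _ _ _ (surface_area n) U mU G.
  rewrite [X in _ -> _ -> _ -> _ --> X](_ : _ = \int[surface_area n]_(x in U)
      \int[leb]_(t in life x) (enorm (force n [set` s] (Y x t)))%:E); last first.
    by apply: eq_integral => x; rewrite inE => Ux; apply/cvg_lim => //; exact: cvg_time_integral.
  apply=> // x Ux k k' kk; apply: ge0_le_integral => //.
  - by move=> t _; rewrite lee_fin.
  - exact: (measurable_fun_section_rectangle (measurable_sphere n) mhalf (measurable_ev k) (subUS Ux)).
  - exact: (measurable_fun_section_rectangle (measurable_sphere n) mhalf (measurable_ev k') (subUS Ux)).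
  - move=> t _; rewrite lee_fin /ev /evolve; case: asboolP => // -[_ tx].
    by have [_ _ /(_ t tx)[UY _]] := flowP n0 us sS Yflow Ux; apply: cut_speed_le; [case: UY|].
have lim2 := cvgeZl (y := ((2 * pi)^-1)%:E) isT cvg_integral_speed.
have <- := cvg_lim (@ereal_hausdorff R) lim1; have <- := cvg_lim (@ereal_hausdorff R) lim2.
congr (lim (_ @ \oo)).
apply/funext => k; rewrite -time_integral_cut_speed; apply/esym.
by apply: (sphere_integral_setD n0); [move=> x _; exact: G0|exact: mGU].
Qed.

End time_integral.

Theorem mainTheorem7 (R : realType) (n : nat) (L : set (R3 R))
    (Y : R3 R -> R -> R3 R) (tau : R3 R -> \bar R) :
  (0 < n)%N ->
  L `<=` sphere n ->
  (L #= `I_n)%card ->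
  is_flow n L Y tau ->
  ((n%:R^-1)%:E *
     \int[surface_area n]_(x in sphere n)
       \int[lebesgue_measure]_(t in [set t : R | (0 <= t)%R /\ t%:E < tau x])
         (enorm (force n L (Y x t)))%:E
   = ((2 * pi * n%:R)^-1)%:E *
     \int[surface_area n]_(x in sphere n) (enorm (force n L x))%:E)%E.
Proof.
move=> n0 LS Ln Yflow.
have Lfin : finite_set L by exists n.
pose s := finmap.enum_fset (fset_set L).
have us : uniq s by exact: finmap.fset_uniq.
have Ls : L = [set` s] by rewrite -[LHS](fset_setK Lfin).
have szs : size s = n by exact: card_fset_set Ln.
have sS z : z \in s -> sphere n z by move=> zs; apply: LS; rewrite Ls.
rewrite Ls in Yflow *.
rewrite (integral_time_integral n0 us sS szs Yflow) muleA -EFinM.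
by rewrite -invfM (mulrC n%:R).
Qed.
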